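(* Let $\mathcal{C}$ be a modular tensor category and let $A$ be an algebra in $\mathcal C$. (i) $A$ is absolutely simple if and only if $R(A)$ is absolutely simple. (ii) Let $A$ be in addition Frobenius. Then $A$ is simple and special if and only if $R(A)$ is simple and special.
   Context: A modular tensor category is an abelian semisimple finite $\mathbb{C}$-linear ribbon category with simple tensor unit $\mathbf 1$, braiding $c_{U,V}:U\otimes V\to V\otimes U$ and twist $\theta$, such that, for representatives $\{U_i\}_{i\in\mathcal I}$ of the isomorphism classes of simple objects, the matrix $s_{i,j}=\mathrm{tr}(c_{U_j,U_i}\circ c_{U_i,U_j})$ is invertible. Associators and unit isomorphisms are suppressed. Dualities: $d_U:U^\vee\otimes U\to\mathbf 1$, $b_U:\mathbf 1\to U\otimes U^\vee$, $\tilde d_U:U\otimes U^\vee\to\mathbf 1$, $\tilde b_U:\mathbf 1\to U^\vee\otimes U$; $\dim U=d_U\circ\tilde b_U$; $\mathrm{Dim}\,\mathcal C=\sum_i(\dim U_i)^2$. $\mathcal C_+=\mathcal C$; $\mathcal C_-$ is $\mathcal C$ with inverse braiding and twist; $\mathcal C^2_\pm=\mathcal C_+\boxtimes\mathcal C_-$ has objects finite direct sums of pairs $V\times W$, $\mathrm{Hom}(V\times W,V'\times W')=\mathrm{Hom}_{\mathcal C}(V,V')\otimes_{\mathbb C}\mathrm{Hom}_{\mathcal C}(W,W')$, and componentwise tensor product. For $V\in\mathcal C$, $\{b_V^{(i;\alpha)}\}_\alpha$ is a basis of $\mathrm{Hom}(V,U_i)$ and $\{b^V_{(i;\alpha)}\}_\alpha$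 the dual basis of $\mathrm{Hom}(U_i,V)$, $b_V^{(i;\alpha)}\circ b^V_{(i;\beta)}=\delta_{\alpha\beta}\mathrm{id}_{U_i}$. An algebra $A$ is simple if it is simple as a bimodule over itself, and absolutely simple if $\dim_{\mathbb C}\mathrm{Hom}_{A|A}(A,A)=1$, where $\mathrm{Hom}_{A|A}$ denotes $A$-bimodule maps. A Frobenius algebra $(A,m,\eta,\Delta,\varepsilon)$ is an algebra and coalgebra with $(\mathrm{id}\otimes m)(\Delta\otimes\mathrm{id})=\Delta\circ m=(m\otimes\mathrm{id})(\mathrm{id}\otimes\Delta)$. Special: $m\circ\Delta=\zeta\,\mathrm{id}_A$ and $\varepsilon\circ\eta=\xi\,\mathrm{id}_{\mathbf 1}$ with $\zeta,\xi\in\mathbb C^\times$. $T:\mathcal C^2_\pm\to\mathcal C$, $T(\oplus_iV_i\times W_i)=\oplus_iV_i\otimes W_i$, is a tensor functor with $\phi^T_0=\mathrm{id}_{\mathbf 1}$ and $\phi^T_2=\mathrm{id}_U\otimes c^{-1}_{W,V}\otimes\mathrm{id}_X:T(U\times V)\otimes T(W\times X)\to T((U\times V)\otimes(W\times X))$; put $\psi^T_k=(\phi^T_k)^{-1}$. $R:\mathcal C\to\mathcal C^2_\pm$ is $R(A)=\oplus_{i\in\mathcal I}(A\otimes U_i^\vee)\times U_i$, $R(f)=\oplus_i(f\otimes\mathrm{id}_{U_i^\vee})\times\mathrm{id}_{U_i}$. For $M=\oplus_nM^l_n\times M^r_n$ there are natural isomorphisms $\hat\chi:\mathrm{Hom}(T(M),A)\to\mathrm{Hom}(M,R(A))$,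 $\oplus_nf_n\mapsto\oplus_{n,i}\sum_\alpha[(f_n\otimes\mathrm{id}_{U_i^\vee})(\mathrm{id}_{M^l_n}\otimes b^{M^r_n}_{(i;\alpha)}\otimes\mathrm{id}_{U_i^\vee})(\mathrm{id}_{M^l_n}\otimes b_{U_i})]\times b_{M^r_n}^{(i;\alpha)}$, and $\check\chi:\mathrm{Hom}(A,T(M))\to\mathrm{Hom}(R(A),M)$, $\oplus_ng_n\mapsto\oplus_{n,i}\sum_\alpha\frac{\mathrm{Dim}\,\mathcal C}{\dim U_i}[(\mathrm{id}_{M^l_n}\otimes\tilde d_{U_i})(\mathrm{id}_{M^l_n}\otimes b_{M^r_n}^{(i;\alpha)}\otimes\mathrm{id}_{U_i^\vee})(g_n\otimes\mathrm{id}_{U_i^\vee})]\times b^{M^r_n}_{(i;\alpha)}$. Put $\hat\delta_M=\hat\chi(\mathrm{id}_{T(M)})$, $\hat\rho_A=\hat\chi^{-1}(\mathrm{id}_{R(A)})$, $\check\rho_M=\check\chi(\mathrm{id}_{T(M)})$, $\check\delta_A=\check\chi^{-1}(\mathrm{id}_{R(A)})$, and $\phi^R_0=\hat\chi(\psi^T_0)$, $\phi^R_2=R(\hat\rho_A\otimes\hat\rho_B)\circ R(\psi^T_2)\circ\hat\delta:R(A)\otimes R(B)\to R(A\otimes B)$, $\psi^R_0=\check\chi(\phi^T_0)$, $\psi^R_2=\check\rho\circ R(\phi^T_2)\circ R(\check\delta_A\otimes\check\delta_B):R(A\otimes B)\to R(A)\otimes R(B)$. For an algebra $A$, $R(A)$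 is an algebra with $m_{R(A)}=R(m)\phi^R_2$, $\eta_{R(A)}=R(\eta)\phi^R_0$; for $A$ Frobenius, $R(A)$ is Frobenius with in addition $\Delta_{R(A)}=\psi^R_2R(\Delta)$, $\varepsilon_{R(A)}=\psi^R_0R(\varepsilon)$. *)

(* Defs.v *)
From HB Require Import structures.
From mathcomp Require Import all_boot all_order all_algebra.
From mathcomp Require Import reals complex.
Set Implicit Arguments.
Unset Strict Implicit.
Unset Printing Implicit Defensive.
Import GRing.Theory.
Local Open Scope ring_scope.

Declare Scope cat_scope.
Delimit Scope cat_scope with cat.

(* An element of [V (x) W] is the matrix of its coordinates in the basis
   [e_a (x) e_b], where [e] is the library's basis [vbasis fullv]. *)

Section TensorSpace.
Variable K : fieldType.

Definition tens (V W : vectType K) : vectType K :=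
  'M[K]_(\dim (fullv : {vspace V}), \dim (fullv : {vspace W})).

Definition pure (V W : vectType K) (v : V) (w : W) : tens V W :=
  \matrix_(a, b) (coord (vbasis fullv) a v * coord (vbasis fullv) b w).

(* The linear map out of [tens V W] induced by a bilinear [B]. *)
Definition tlift (V W X : vectType K) (B : V -> W -> X) (t : tens V W) : X :=
  \sum_a \sum_b (t a b *: B (vbasis fullv)`_a (vbasis fullv)`_b).

(* [(v (x) w) (v' (x) w') := B v v' (x) B' w w'], extended bilinearly. *)
Definition tlift2 (V W V' W' X Y : vectType K)
    (B : V -> V' -> X) (B' : W -> W' -> Y) (t : tens V W) (u : tens V' W') :
    tens X Y :=
  tlift (fun v w => tlift (fun v' w' => pure (B v v') (B' w w')) u) t.

Lemma linear_bigsum (V W : vectType K) (f : V -> W) (fl : linear f)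
    (J : finType) (c : J -> K) (v : J -> V) :
  f (\sum_j c j *: v j) = \sum_j c j *: f (v j).
Proof.
pose Lf := GRing.isLinear.Build K V W *:%R f fl.
pose g : {linear V -> W} := HB.pack f Lf.
rewrite -[f]/(g : V -> W) linear_sum.
by apply: eq_bigr => j _; rewrite linearZ.
Qed.

Lemma tlift_pure (V W X : vectType K) (B : V -> W -> X)
    (Bl : forall w, linear (B^~ w)) (Br : forall v, linear (B v)) v w :
  tlift B (pure v w) = B v w.
Proof.
rewrite {2}(coord_vbasis (memvf v)) (linear_bigsum (Bl w)).
apply: eq_bigr => a _; rewrite {2}(coord_vbasis (memvf w)).
rewrite (linear_bigsum (Br _)) scaler_sumr.
by apply: eq_bigr => b _; rewrite scalerA mxE.
Qed.

End TensorSpace.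

Section Monoidal.
Variable K : fieldType.

(* The operations only, the laws are in [monoidal_laws].  Composition is in
   applicative order; [alpha U V W : (U V) W -> U (V W)]. *)
Record mcat := MCat {
  ob :> Type;
  mor : ob -> ob -> vectType K;
  idm : forall U, mor U U;
  compm : forall U V W, mor V W -> mor U V -> mor U W;
  tob : ob -> ob -> ob;
  tmor : forall U V U' V', mor U U' -> mor V V' -> mor (tob U V) (tob U' V');
  uob : ob;
  alpha : forall U V W, mor (tob (tob U V) W) (tob U (tob V W));
  alphaV : forall U V W, mor (tob U (tob V W)) (tob (tob U V) W);
  lam : forall U, mor (tob uob U) U;
  lamV : forall U, mor U (tob uob U);
  rho : forall U, mor (tob U uob) U;
  rhoV : forall U, mor U (tob U uob)
}.

End Monoidal.

Arguments mor {K m} U V : rename.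
Arguments idm {K m} U : rename.
Arguments compm {K m U V W} g f : rename.
Arguments tob {K m} U V : rename.
Arguments tmor {K m U V U' V'} f g : rename.
Arguments uob {K m} : rename.
Arguments alpha {K m} U V W : rename.
Arguments alphaV {K m} U V W : rename.
Arguments lam {K m} U : rename.
Arguments lamV {K m} U : rename.
Arguments rho {K m} U : rename.
Arguments rhoV {K m} U : rename.

Notation "g ∘ f" := (compm g f) (at level 40, left associativity) : cat_scope.
Notation "U ⊗ V" := (tob U V) (at level 39, left associativity) : cat_scope.
Notation "f ⊠ g" := (tmor f g) (at level 39, left associativity) : cat_scope.

Local Open Scope cat_scope.

Section Laws.
Variables (K : fieldType) (D : mcat K).
Implicit Types U V W X : D.

Definition inverse_mor U V (f : mor U V) (g : mor V U) : Prop :=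
  g ∘ f = idm U /\ f ∘ g = idm V.
Definition is_iso U V (f : mor U V) : Prop := exists g, inverse_mor f g.
Definition isomorphic U V : Prop := exists f : mor U V, is_iso f.
Definition is_mono U V (f : mor U V) : Prop :=
  forall X (g h : mor X U), f ∘ g = f ∘ h -> g = h.
Definition is_epi U V (f : mor U V) : Prop :=
  forall X (g h : mor V X), g ∘ f = h ∘ f -> g = h.
Definition is_kernel U V X (f : mor U V) (k : mor X U) : Prop :=
  f ∘ k = 0 /\
  forall Y (g : mor Y U), f ∘ g = 0 -> exists! h : mor Y X, k ∘ h = g.
Definition is_cokernel U V X (f : mor U V) (q : mor V X) : Prop :=
  q ∘ f = 0 /\
  forall Y (g : mor V Y), g ∘ f = 0 -> exists! h : mor X Y, h ∘ q = g.

(* [idm U <> 0] says that [U] is not a zero object. *)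
Definition simple_object U : Prop :=
  idm U <> 0 /\
  forall X (f : mor X U), is_mono f -> f = 0 \/ is_iso f.

Record linear_category_laws : Prop := {
  comp_assoc : forall U V W X (f : mor U V) (g : mor V W) (h : mor W X),
    h ∘ (g ∘ f) = h ∘ g ∘ f;
  comp_idl : forall U V (f : mor U V), idm V ∘ f = f;
  comp_idr : forall U V (f : mor U V), f ∘ idm U = f;
  comp_linl : forall U V W (f : mor U V),
    linear (fun g : mor V W => g ∘ f);
  comp_linr : forall U V W (g : mor V W),
    linear (fun f : mor U V => g ∘ f)
}.

Record monoidal_laws : Prop := {
  tmor_id : forall U V, idm U ⊠ idm V = idm (U ⊗ V);
  tmor_comp : forall U U' U'' V V' V'' (f : mor U U') (f' : mor U' U'')
      (g : mor V V') (g' : mor V' V''),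
    (f' ∘ f) ⊠ (g' ∘ g) = (f' ⊠ g') ∘ (f ⊠ g);
  tmor_linl : forall U V U' V' (g : mor V V'),
    linear (fun f : mor U U' => f ⊠ g);
  tmor_linr : forall U V U' V' (f : mor U U'),
    linear (fun g : mor V V' => f ⊠ g);
  alpha_inv : forall U V W, inverse_mor (alpha U V W) (alphaV U V W);
  lam_inv : forall U, inverse_mor (lam U) (lamV U);
  rho_inv : forall U, inverse_mor (rho U) (rhoV U);
  alpha_nat : forall U U' V V' W W'
      (f : mor U U') (g : mor V V') (h : mor W W'),
    alpha U' V' W' ∘ (f ⊠ g ⊠ h) = (f ⊠ (g ⊠ h)) ∘ alpha U V W;
  lam_nat : forall U U' (f : mor U U'), lam U' ∘ (idm uob ⊠ f) = f ∘ lam U;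
  rho_nat : forall U U' (f : mor U U'), rho U' ∘ (f ⊠ idm uob) = f ∘ rho U;
  pentagon : forall U V W X,
    alpha U V (W ⊗ X) ∘ alpha (U ⊗ V) W X =
    (idm U ⊠ alpha V W X) ∘ alpha U (V ⊗ W) X ∘ (alpha U V W ⊠ idm X);
  triangle : forall U V,
    (idm U ⊠ lam V) ∘ alpha U uob V = rho U ⊠ idm V
}.

End Laws.

(* The operations of a ribbon category, together with chosen finite
   biproducts, chosen representatives [simp] of the simple objects, and
   chosen dual bases [sbas V i] of [mor V U_i] and [sdbas V i] of
   [mor U_i V].  [Tob] and the isomorphisms between hom spaces below are
   defined relative to such choices. *)
Record modular_data (K : fieldType) := ModularData {
  base :> mcat K;
  bigsum : forall J : finType, (J -> base) -> base;
  incl : forall (J : finType) (F : J -> base) (j : J), mor (F j) (bigsum F);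
  proj : forall (J : finType) (F : J -> base) (j : J), mor (bigsum F) (F j);
  braid : forall U V : base, mor (U ⊗ V) (V ⊗ U);
  braidV : forall U V : base, mor (V ⊗ U) (U ⊗ V);
  twist : forall U : base, mor U U;
  dualob : base -> base;
  ev : forall U : base, mor (dualob U ⊗ U) uob;
  coev : forall U : base, mor uob (U ⊗ dualob U);
  label : finType;
  simp : label -> base;
  sbas : forall V i, 'I_(\dim {: mor V (simp i)}) -> mor V (simp i);
  sdbas : forall V i, 'I_(\dim {: mor V (simp i)}) -> mor (simp i) V
}.

Arguments bigsum {K m J} F : rename.
Arguments incl {K m J} F j : rename.
Arguments proj {K m J} F j : rename.
Arguments braid {K m} U V : rename.
Arguments braidV {K m} U V : rename.
Arguments twist {K m} U : rename.
Arguments dualob {K m} U : rename.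
Arguments ev {K m} U : rename.
Arguments coev {K m} U : rename.
Arguments label {K} m : rename.
Arguments simp {K m} i : rename.
Arguments sbas {K m} V i a : rename.
Arguments sdbas {K m} V i a : rename.

Section Modular.
Variables (K : fieldType) (C : modular_data K).
Implicit Types U V W X : C.

Definition coev' U : mor (uob : C) (dualob U ⊗ U) :=
  (idm (dualob U) ⊠ twist U) ∘ braid U (dualob U) ∘ coev U.
Definition ev' U : mor (U ⊗ dualob U) (uob : C) :=
  ev U ∘ braid U (dualob U) ∘ (twist U ⊠ idm (dualob U)).

Definition dual_mor U V (f : mor U V) : mor (dualob V) (dualob U) :=
  lam (dualob U) ∘ (ev V ⊠ idm (dualob U)) ∘ alphaV (dualob V) V (dualob U)
  ∘ (idm (dualob V) ⊠ (f ⊠ idm (dualob U))) ∘ (idm (dualob V) ⊠ coev U)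
  ∘ rhoV (dualob V).

(* The scalar [c] such that [f = c *: idm uob], when [End uob] is the line
   spanned by [idm uob]. *)
Definition scal (f : mor (uob : C) uob) : K := coord [tuple idm uob] ord0 f.

Definition qtrace U (f : mor U U) : K :=
  scal (ev U ∘ (idm (dualob U) ⊠ f) ∘ coev' U).
Definition qdim U : K := scal (ev U ∘ coev' U).
Definition Dim : K := \sum_(i : label C) qdim (simp i) ^+ 2.

Definition smatrix : 'M[K]_#|label C| :=
  \matrix_(a, b) let U := simp (enum_val a) in let V := simp (enum_val b) in
    qtrace (braid V U ∘ braid U V).

Record biproduct_laws : Prop := {
  proj_inj : forall (J : finType) (F : J -> C) j, proj F j ∘ incl F j = idm _;
  proj_inj0 : forall (J : finType) (F : J -> C) j k,
    j != k -> proj F k ∘ incl F j = 0;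
  sum_inj_proj : forall (J : finType) (F : J -> C),
    \sum_j incl F j ∘ proj F j = idm (bigsum F)
}.

Record abelian_laws : Prop := {
  has_biproducts : biproduct_laws;
  has_kernels : forall U V (f : mor U V), exists X (k : mor X U), is_kernel f k;
  has_cokernels : forall U V (f : mor U V),
    exists X (q : mor V X), is_cokernel f q;
  mono_kernel : forall U V (f : mor U V),
    is_mono f -> exists W (g : mor V W), is_kernel g f;
  epi_cokernel : forall U V (f : mor U V),
    is_epi f -> exists W (g : mor W U), is_cokernel g f
}.

(* Finiteness of the category: hom spaces are [vectType]s, and the label set
   of the simple objects is a [finType]. *)
Record semisimple_finite_laws : Prop := {
  semisimple : forall U, exists (J : finType) (F : J -> C),
    (forall j, simple_object (F j)) /\ isomorphic U (bigsum F);
  simp_simple : forall i : label C, simple_object (simp i);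
  simp_inj : forall i j : label C, isomorphic (simp i) (simp j) -> i = j;
  simp_surj : forall U, simple_object U ->
    exists i : label C, isomorphic U (simp i);
  sbas_basis : forall V i, basis_of {: mor V (simp i)} (codom (sbas V i));
  sdbas_basis : forall V i, basis_of {: mor (simp i) V} (codom (sdbas V i));
  sbas_dual : forall V i a b,
    sbas V i a ∘ sdbas V i b = (a == b)%:R *: idm (simp i)
}.

Record ribbon_laws : Prop := {
  braid_inv : forall U V, inverse_mor (braid U V) (braidV U V);
  braid_nat : forall U U' V V' (f : mor U U') (g : mor V V'),
    braid U' V' ∘ (f ⊠ g) = (g ⊠ f) ∘ braid U V;
  hexagon1 : forall U V W,
    alpha V W U ∘ braid U (V ⊗ W) ∘ alpha U V W =
    (idm V ⊠ braid U W) ∘ alpha V U W ∘ (braid U V ⊠ idm W);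
  hexagon2 : forall U V W,
    alphaV W U V ∘ braid (U ⊗ V) W ∘ alphaV U V W =
    (braid U W ⊠ idm V) ∘ alphaV U W V ∘ (idm U ⊠ braid V W);
  twist_iso : forall U, is_iso (twist U);
  twist_nat : forall U V (f : mor U V), twist V ∘ f = f ∘ twist U;
  twist_tensor : forall U V,
    twist (U ⊗ V) = braid V U ∘ braid U V ∘ (twist U ⊠ twist V);
  zigzag : forall U,
    rho U ∘ (idm U ⊠ ev U) ∘ alpha U (dualob U) U ∘ (coev U ⊠ idm U) ∘ lamV U
    = idm U;
  zigzag_dual : forall U,
    lam (dualob U) ∘ (ev U ⊠ idm (dualob U)) ∘ alphaV (dualob U) U (dualob U)
      ∘ (idm (dualob U) ⊠ coev U) ∘ rhoV (dualob U)
    = idm (dualob U);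
  twist_dual : forall U, twist (dualob U) = dual_mor (twist U)
}.

Record modular_laws : Prop := {
  mod_linear : linear_category_laws C;
  mod_monoidal : monoidal_laws C;
  mod_abelian : abelian_laws;
  mod_semisimple : semisimple_finite_laws;
  mod_ribbon : ribbon_laws;
  mod_one : simple_object (uob : C);
  mod_smatrix : smatrix \in unitmx
}.

End Modular.

Record modular_category (K : fieldType) := ModularCategory {
  mdata :> modular_data K;
  mdataP : modular_laws mdata
}.

Section Algebras.
Variables (K : fieldType) (D : mcat K).

Record algebra := Algebra {
  aob :> D;
  mul : mor (aob ⊗ aob) aob;
  unt : mor uob aob
}.

Record algebra_laws (A : algebra) : Prop := {
  mul_assoc :
    mul A ∘ (mul A ⊠ idm A) = mul A ∘ (idm A ⊠ mul A) ∘ alpha A A A;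
  mul_unitl : mul A ∘ (unt A ⊠ idm A) = lam A;
  mul_unitr : mul A ∘ (idm A ⊠ unt A) = rho A
}.

Record bimodule (A : algebra) := Bimodule {
  bob :> D;
  lact : mor (A ⊗ bob) bob;
  ract : mor (bob ⊗ A) bob
}.

Record bimodule_laws (A : algebra) (M : bimodule A) : Prop := {
  lact_mul :
    lact M ∘ (mul A ⊠ idm M) = lact M ∘ (idm A ⊠ lact M) ∘ alpha A A M;
  lact_unit : lact M ∘ (unt A ⊠ idm M) = lam M;
  ract_mul :
    ract M ∘ (ract M ⊠ idm A) = ract M ∘ (idm M ⊠ mul A) ∘ alpha M A A;
  ract_unit : ract M ∘ (idm M ⊠ unt A) = rho M;
  lract :
    ract M ∘ (lact M ⊠ idm A) = lact M ∘ (idm A ⊠ ract M) ∘ alpha A M A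
}.

Definition bimodule_map (A : algebra) (M N : bimodule A) (f : mor M N) : Prop :=
  f ∘ lact M = lact N ∘ (idm A ⊠ f) /\ f ∘ ract M = ract N ∘ (f ⊠ idm A).

Definition bimodule_mono (A : algebra) (M N : bimodule A) (f : mor M N) : Prop :=
  forall X : bimodule A, bimodule_laws X ->
  forall g h : mor X M, bimodule_map g -> bimodule_map h ->
    f ∘ g = f ∘ h -> g = h.

(* The inverse of an invertible bimodule map is again a bimodule map, and a
   monomorphism is zero only if its source is. *)
Definition simple_bimodule (A : algebra) (M : bimodule A) : Prop :=
  idm M <> 0 /\
  forall N : bimodule A, bimodule_laws N ->
  forall f : mor N M, bimodule_map f -> bimodule_mono f -> f = 0 \/ is_iso f.

Definition regular_bimodule (A : algebra) : bimodule A :=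
  Bimodule (mul A) (mul A).

Definition simple_algebra (A : algebra) : Prop :=
  simple_bimodule (regular_bimodule A).

Definition absolutely_simple (A : algebra) : Prop :=
  exists E : {vspace mor A A},
    (forall f : mor A A, f \in E <->
       @bimodule_map A (regular_bimodule A) (regular_bimodule A) f)
    /\ \dim E = 1%N.

Record frobenius := Frobenius {
  falg :> algebra;
  comul : mor falg (falg ⊗ falg);
  counit : mor falg uob
}.

Record frobenius_laws (A : frobenius) : Prop := {
  frob_algebra : algebra_laws A;
  comul_coassoc :
    alpha A A A ∘ (comul A ⊠ idm A) ∘ comul A = (idm A ⊠ comul A) ∘ comul A;
  comul_counitl : lam A ∘ (counit A ⊠ idm A) ∘ comul A = idm A;
  comul_counitr : rho A ∘ (idm A ⊠ counit A) ∘ comul A = idm A;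
  frob_left :
    (idm A ⊠ mul A) ∘ alpha A A A ∘ (comul A ⊠ idm A) = comul A ∘ mul A;
  frob_right :
    (mul A ⊠ idm A) ∘ alphaV A A A ∘ (idm A ⊠ comul A) = comul A ∘ mul A
}.

Definition special (A : frobenius) : Prop :=
  exists zeta xi : K,
    [/\ zeta != 0, xi != 0,
        mul A ∘ comul A = zeta *: idm A
      & counit A ∘ unt A = xi *: idm uob].

End Algebras.

(* The product of [C] with [C_-], which is [C] with inverse braiding and twist.
   As monoidal categories [C_-] and [C] are equal, and only the monoidal
   structure of the product is needed. *)

Section Product.
Variables (K : fieldType) (C : modular_data K).

(* A formal finite direct sum of pairs. *)
Record pairsum := PairSum {
  pidx : finType;
  pl : pidx -> C;
  pr : pidx -> C
}.

Definition phom_tens (M N : pairsum) (m : pidx M) (n : pidx N) : vectType K :=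
  tens (mor (pl m) (pl n)) (mor (pr m) (pr n)).

(* A morphism [M -> N] is a family of elements of the spaces [phom_tens m n],
   which depend on [m] and [n].  It is stored as the scalar function of all
   the matrix entries of the members of the family. *)
Definition pentry (M N : pairsum) : finType :=
  {mn : pidx M * pidx N &
   ('I_(\dim {: mor (pl mn.1) (pl mn.2)}) *
    'I_(\dim {: mor (pr mn.1) (pr mn.2)}))%type}.

Definition phom (M N : pairsum) : vectType K := {ffun pentry M N -> K^o}.

Definition mk (M N : pairsum)
    (F : forall (m : pidx M) (n : pidx N), phom_tens m n) : phom M N :=
  [ffun x => F (tag x).1 (tag x).2 (tagged x).1 (tagged x).2].

Definition ent (M N : pairsum) (f : phom M N) (m : pidx M) (n : pidx N) :
    phom_tens m n :=
  \matrix_(a, b) f (existT _ (m, n) (a, b)).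

Definition diag_entry (J : finType) (T : J -> J -> vectType K)
    (F : forall j, T j j) (j k : J) : T j k :=
  match j =P k with
  | ReflectT e => match e in _ = l return T j l with erefl => F j end
  | ReflectF _ => 0
  end.

Definition pid (M : pairsum) : phom M M :=
  mk (diag_entry (T := @phom_tens M M)
        (fun m => pure (idm (pl m)) (idm (pr m)))).

Definition tcomp (U U' V V' W W' : C)
    (t : tens (mor V W) (mor V' W')) (u : tens (mor U V) (mor U' V')) :
    tens (mor U W) (mor U' W') :=
  tlift2 (@compm K C U V W) (@compm K C U' V' W') t u.

Definition ttens (U U' V V' X X' Y Y' : C)
    (t : tens (mor U V) (mor U' V')) (u : tens (mor X Y) (mor X' Y')) :
    tens (mor (U ⊗ X) (V ⊗ Y)) (mor (U' ⊗ X') (V' ⊗ Y')) :=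
  tlift2 (@tmor K C U X V Y) (@tmor K C U' X' V' Y') t u.

Definition pcomp (M N P : pairsum) (g : phom N P) (f : phom M N) : phom M P :=
  mk (fun m p => \sum_n tcomp (ent g n p) (ent f m n)).

Definition ptob (M N : pairsum) : pairsum :=
  @PairSum (pidx M * pidx N)%type
    (fun x => pl x.1 ⊗ pl x.2) (fun x => pr x.1 ⊗ pr x.2).

Definition ptmor (M N M' N' : pairsum) (f : phom M M') (g : phom N N') :
    phom (ptob M N) (ptob M' N') :=
  mk (M := ptob M N) (N := ptob M' N')
    (fun x y => ttens (ent f x.1 y.1) (ent g x.2 y.2)).

Definition pone : pairsum := @PairSum unit (fun=> uob) (fun=> uob).

(* The index sets of the source and target of the structure isomorphisms are
   not equal but in bijection.  The entries are those of the componentwise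
   structure isomorphisms of [C] along this bijection, and zero elsewhere;
   the identities [pid] supply both the selection of the indices and the
   casts. *)
Definition palpha (M N P : pairsum) :
    phom (ptob (ptob M N) P) (ptob M (ptob N P)) :=
  mk (M := ptob (ptob M N) P) (N := ptob M (ptob N P))
    (fun x y =>
       let: (m, (n, p)) := y in
       tcomp (pure (alpha (pl m) (pl n) (pl p)) (alpha (pr m) (pr n) (pr p)))
         (ttens (ttens (ent (pid M) x.1.1 m) (ent (pid N) x.1.2 n))
                (ent (pid P) x.2 p))).

Definition palphaV (M N P : pairsum) :
    phom (ptob M (ptob N P)) (ptob (ptob M N) P) :=
  mk (M := ptob M (ptob N P)) (N := ptob (ptob M N) P)
    (fun x y =>
       let: (m, n, p) := y in
       tcomp (pure (alphaV (pl m) (pl n) (pl p)) (alphaV (pr m) (pr n) (pr p)))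
         (ttens (ent (pid M) x.1 m)
                (ttens (ent (pid N) x.2.1 n) (ent (pid P) x.2.2 p)))).

Definition plam (M : pairsum) : phom (ptob pone M) M :=
  mk (M := ptob pone M)
    (fun x m => tcomp (ent (pid M) x.2 m) (pure (lam (pl x.2)) (lam (pr x.2)))).

Definition plamV (M : pairsum) : phom M (ptob pone M) :=
  mk (N := ptob pone M)
    (fun m x =>
       tcomp (pure (lamV (pl x.2)) (lamV (pr x.2))) (ent (pid M) m x.2)).

Definition prho (M : pairsum) : phom (ptob M pone) M :=
  mk (M := ptob M pone)
    (fun x m => tcomp (ent (pid M) x.1 m) (pure (rho (pl x.1)) (rho (pr x.1)))).

Definition prhoV (M : pairsum) : phom M (ptob M pone) :=
  mk (N := ptob M pone)
    (fun m x =>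
       tcomp (pure (rhoV (pl x.1)) (rhoV (pr x.1))) (ent (pid M) m x.1)).

Definition C2 : mcat K :=
  MCat pid pcomp ptmor palpha palphaV plam plamV prho prhoV.

End Product.

Section Functors.
Variables (K : fieldType) (C : modular_data K).
Notation CC := (C2 C).

Definition Tsummand (M : CC) (m : pidx M) : C := pl m ⊗ pr m.
Definition Tob (M : CC) : C := bigsum (@Tsummand M).

Definition Tmor (M N : CC) (f : mor M N) : mor (Tob M) (Tob N) :=
  \sum_m \sum_n
    incl (@Tsummand N) n ∘ tlift (@tmor K C _ _ _ _) (ent f m n)
    ∘ proj (@Tsummand M) m.

Definition phiT0 : mor (uob : C) (Tob (uob : CC)) :=
  incl (@Tsummand (uob : CC)) tt ∘ lamV uob.
Definition psiT0 : mor (Tob (uob : CC)) (uob : C) :=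
  lam uob ∘ proj (@Tsummand (uob : CC)) tt.

(* [id_U (x) c_{W,V}^-1 (x) id_X] *)
Definition swap (U V W X : C) : mor ((U ⊗ V) ⊗ (W ⊗ X)) ((U ⊗ W) ⊗ (V ⊗ X)) :=
  alphaV U W (V ⊗ X)
  ∘ (idm U ⊠ (alpha W V X ∘ (braidV W V ⊠ idm X) ∘ alphaV V W X))
  ∘ alpha U V (W ⊗ X).
Definition swapV (U V W X : C) : mor ((U ⊗ W) ⊗ (V ⊗ X)) ((U ⊗ V) ⊗ (W ⊗ X)) :=
  alphaV U V (W ⊗ X)
  ∘ (idm U ⊠ (alpha V W X ∘ (braid W V ⊠ idm X) ∘ alphaV W V X))
  ∘ alpha U W (V ⊗ X).

Definition phiT2 (M N : CC) : mor (Tob M ⊗ Tob N) (Tob (M ⊗ N)) :=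
  \sum_m \sum_n
    incl (@Tsummand (M ⊗ N)) (m, n) ∘ swap (pl m) (pr m) (pl n) (pr n)
    ∘ (proj (@Tsummand M) m ⊠ proj (@Tsummand N) n).

(* The inverse of [phiT2]. *)
Definition psiT2 (M N : CC) : mor (Tob (M ⊗ N)) (Tob M ⊗ Tob N) :=
  \sum_m \sum_n
    (incl (@Tsummand M) m ⊠ incl (@Tsummand N) n)
    ∘ swapV (pl m) (pr m) (pl n) (pr n)
    ∘ proj (@Tsummand (M ⊗ N)) (m, n).

Definition Rob (A : C) : CC :=
  @PairSum K C (label C) (fun i => A ⊗ dualob (simp i)) (fun i => simp i).

Definition Rmor (A B : C) (f : mor A B) : mor (Rob A) (Rob B) :=
  @mk K C (Rob A) (Rob B)
    (diag_entry (T := @phom_tens K C (Rob A) (Rob B))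
       (fun i => pure (f ⊠ idm (dualob (simp i))) (idm (simp i)))).

Definition chihat (M : CC) (A : C) (f : mor (Tob M) A) : mor M (Rob A) :=
  @mk K C M (Rob A) (fun m i =>
    \sum_a pure
      (((f ∘ incl (@Tsummand M) m) ⊠ idm (dualob (simp i)))
       ∘ alphaV (pl m) (pr m) (dualob (simp i))
       ∘ (idm (pl m) ⊠ (sdbas (pr m) i a ⊠ idm (dualob (simp i))))
       ∘ (idm (pl m) ⊠ coev (simp i)) ∘ rhoV (pl m))
      (sbas (pr m) i a)).

Definition chicheck (A : C) (M : CC) (g : mor A (Tob M)) : mor (Rob A) M :=
  @mk K C (Rob A) M (fun i m =>
    \sum_a (Dim C / qdim (simp i)) *: pure
      (rho (pl m) ∘ (idm (pl m) ⊠ ev' (simp i))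
       ∘ (idm (pl m) ⊠ (sbas (pr m) i a ⊠ idm (dualob (simp i))))
       ∘ alpha (pl m) (pr m) (dualob (simp i))
       ∘ ((proj (@Tsummand M) m ∘ g) ⊠ idm (dualob (simp i))))
      (sdbas (pr m) i a)).

(* [chihat] and [chicheck] are linear bijections; [(linfun _)^-1] is the
   inverse linear map. *)
Definition chihatV (M : CC) (A : C) : 'Hom(mor M (Rob A), mor (Tob M) A) :=
  ((linfun (@chihat M A))^-1)%VF.
Definition chicheckV (A : C) (M : CC) : 'Hom(mor (Rob A) M, mor A (Tob M)) :=
  ((linfun (@chicheck A M))^-1)%VF.

Definition deltahat (M : CC) : mor M (Rob (Tob M)) := chihat (idm (Tob M)).
Definition rhohat (A : C) : mor (Tob (Rob A)) A := chihatV (Rob A) A (idm (Rob A)).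
Definition rhocheck (M : CC) : mor (Rob (Tob M)) M := chicheck (idm (Tob M)).
Definition deltacheck (A : C) : mor A (Tob (Rob A)) := chicheckV A (Rob A) (idm (Rob A)).

Definition phiR0 : mor (uob : CC) (Rob uob) := chihat psiT0.
Definition phiR2 (A B : C) : mor (Rob A ⊗ Rob B) (Rob (A ⊗ B)) :=
  Rmor (rhohat A ⊠ rhohat B) ∘ Rmor (psiT2 (Rob A) (Rob B)) ∘ deltahat (Rob A ⊗ Rob B).
Definition psiR0 : mor (Rob uob) (uob : CC) := chicheck phiT0.
Definition psiR2 (A B : C) : mor (Rob (A ⊗ B)) (Rob A ⊗ Rob B) :=
  rhocheck (Rob A ⊗ Rob B) ∘ Rmor (phiT2 (Rob A) (Rob B))
  ∘ Rmor (deltacheck A ⊠ deltacheck B).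

Definition Ralg (A : algebra C) : algebra CC :=
  @Algebra K CC (Rob A) (Rmor (mul A) ∘ phiR2 A A) (Rmor (unt A) ∘ phiR0).

Definition Rfrob (A : frobenius C) : frobenius CC :=
  @Frobenius K CC (Ralg A)
    (psiR2 A A ∘ Rmor (comul A)) (psiR0 ∘ Rmor (counit A)).

End Functors.

(* Main.v *)
(* By the bijections [chihat] and [chicheck], [R] is both right and left adjoint
   to [T]; as [rhohat ∘ deltacheck = id], [R] is faithful.  The transpose of
   the product in [R(A)] of two morphisms [M -> R(A)], [N -> R(A)] is the
   product in [A] of their transposes, precomposed with [psiT2], and [psiT2]
   is invertible.

   An endomorphism [g] of the bimodule [R(A)] is determined by [g ∘ unt], whose
   transpose is a morphism [1 -> A]; so [g = R(f)] for an endomorphism [f] of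
   the bimodule [A].

   A mono of bimodules over any algebra is a mono of the underlying category.
   A proper subbimodule of [A] is sent to one of [R(A)].  Conversely, if
   [f : N -> R(A)] is a mono of bimodules then the image of its transpose
   [T(N) -> A] is an ideal, so if [A] is simple the transpose has a section [s].
   Bending one strand of [s ∘ unt : 1 -> T(N)] and acting by [R(A)] from the
   right, one finds [u : 1 -> N] with [f ∘ u = unt], whence [f] is onto.

   Specialness passes between [A] and [R(A)] as [phiR2 ∘ psiR2 = id] and
   [psiR0 ∘ phiR0 = Dim C]: the former is the fusion identity
   [\sum_(i, j) dim i * dim j * N_ij^k = Dim C * dim k], the latter is
   completeness of the dual bases.  That [Dim C != 0] is a consequence of the
   invertibility of the matrix [s]. *)

From HB Require Import structures.
From mathcomp Require Import all_boot all_order all_algebra.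
From mathcomp Require Import reals complex.
Require Import Defs.
Set Implicit Arguments.
Unset Strict Implicit.
Unset Printing Implicit Defensive.
Import GRing.Theory.
Local Open Scope ring_scope.
Local Open Scope cat_scope.

(* The field is arbitrary up to the last statement: that simple objects have only scalar
   endomorphisms is drawn from the chosen dual bases. Once [tr] is known to invert [chihat],
   equations between morphisms into [R(A)] are mostly proved after the injective transposition [tr],
   and those between morphisms out of [R(A)] after [ctr]. The laws of [R(A)] and of its bimodules
   thus reduce to those of [A] and to the coherence of [psiT2]. The delicate direction is that
   [R(A)] inherits simplicity. A section [s] of the transpose of [f : N -> R(A)] lives in [C], and
   [s ∘ unt : 1 -> T(N)] is not a morphism [1 -> N] of the product, since it does not separate the
   left from the right factors of [N]. Tensoring with duals of the right factors separates them, and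
   the right action of [R(A)] absorbs these duals again. *)
Existing Class linear_category_laws.
Existing Class monoidal_laws.

(** * Monoidal categories *)

Section LinearMaps.
Variables (K : fieldType) (V W : lmodType K) (f : V -> W).
Hypothesis fl : linear f.
(** The laws state linearity as the proposition [linear f]; packing it locally gives access to the
    theory of linear maps for operations that carry no canonical structure. *)
Let Lf := GRing.isLinear.Build K V W *:%R f fl.
Let g : {linear V -> W} := HB.pack f Lf.

Lemma lin0 : f 0 = 0. Proof. exact: (linear0 g). Qed.
Lemma linD u v : f (u + v) = f u + f v. Proof. exact: (linearD g). Qed.
Lemma linN u : f (- u) = - f u. Proof. exact: (linearN g). Qed.
Lemma linZ a u : f (a *: u) = a *: f u.
Proof. by rewrite -[a *: u]addr0 fl lin0 addr0. Qed.
Lemma lin_sum (J : Type) (r : seq J) (P : pred J) (F : J -> V) :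
  f (\sum_(j <- r | P j) F j) = \sum_(j <- r | P j) f (F j).
Proof. exact: (linear_sum g). Qed.
End LinearMaps.

Section Category.
Context {K : fieldType} {D : mcat K} {HL : linear_category_laws D}.
Implicit Types U V W X Y Z : D.

Lemma compA U V W X (f : mor U V) (g : mor V W) (h : mor W X) :
  h ∘ (g ∘ f) = h ∘ g ∘ f.
Proof. exact: comp_assoc. Qed.
Lemma comp1m U V (f : mor U V) : idm V ∘ f = f.
Proof. exact: comp_idl. Qed.
Lemma compm1 U V (f : mor U V) : f ∘ idm U = f.
Proof. exact: comp_idr. Qed.
Lemma compDl U V W (g g' : mor V W) (f : mor U V) :
  (g + g') ∘ f = g ∘ f + g' ∘ f.
Proof. exact: (linD (comp_linl HL f)). Qed.
Lemma compDr U V W (g : mor V W) (f f' : mor U V) :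
  g ∘ (f + f') = g ∘ f + g ∘ f'.
Proof. exact: (linD (comp_linr HL g)). Qed.
Lemma compNl U V W (g : mor V W) (f : mor U V) : (- g) ∘ f = - (g ∘ f).
Proof. exact: (linN (comp_linl HL f)). Qed.
Lemma compNr U V W (g : mor V W) (f : mor U V) : g ∘ (- f) = - (g ∘ f).
Proof. exact: (linN (comp_linr HL g)). Qed.
Lemma compZl U V W a (g : mor V W) (f : mor U V) : (a *: g) ∘ f = a *: (g ∘ f).
Proof. exact: (linZ (comp_linl HL f)). Qed.
Lemma compZr U V W a (g : mor V W) (f : mor U V) : g ∘ (a *: f) = a *: (g ∘ f).
Proof. exact: (linZ (comp_linr HL g)). Qed.
Lemma comp0l U V W (f : mor U V) : (0 : mor V W) ∘ f = 0.
Proof. exact: (lin0 (comp_linl HL f)). Qed.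
Lemma comp0r U V W (g : mor V W) : g ∘ (0 : mor U V) = 0.
Proof. exact: (lin0 (comp_linr HL g)). Qed.
Lemma comp_suml U V W (J : Type) (r : seq J) (P : pred J)
    (F : J -> mor V W) (f : mor U V) :
  (\sum_(j <- r | P j) F j) ∘ f = \sum_(j <- r | P j) F j ∘ f.
Proof. exact: (lin_sum (comp_linl HL f)). Qed.
Lemma comp_sumr U V W (J : Type) (r : seq J) (P : pred J)
    (g : mor V W) (F : J -> mor U V) :
  g ∘ (\sum_(j <- r | P j) F j) = \sum_(j <- r | P j) g ∘ F j.
Proof. exact: (lin_sum (comp_linr HL g)). Qed.

(** Composites are kept associated to the left, where an inner [g ∘ f] is not a subterm. With the
    prefix [k] it is, and these lemmas let an equation between short composites rewrite in the
    middle of a long one. *)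
Lemma compE U V W X (f : mor U V) (g : mor V W) (h : mor U W) (k : mor W X) :
  g ∘ f = h -> k ∘ g ∘ f = k ∘ h.
Proof. by move=> <-; rewrite compA. Qed.
Lemma compE2 U U' V W X (f : mor U V) (g : mor V W) (f' : mor U U') (g' : mor U' W)
    (k : mor W X) :
  g ∘ f = g' ∘ f' -> k ∘ g ∘ f = k ∘ g' ∘ f'.
Proof. by move=> e; rewrite (compE k e) compA. Qed.
Lemma compE3 U V W X Y (f : mor U V) (g : mor V W) (h : mor W X) (r : mor U X)
    (k : mor X Y) :
  h ∘ g ∘ f = r -> k ∘ h ∘ g ∘ f = k ∘ r.
Proof. by move=> <-; rewrite !compA. Qed.
Lemma compK U V X (f : mor U V) (g : mor V U) (k : mor U X) :
  g ∘ f = idm U -> k ∘ g ∘ f = k.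
Proof. by move=> e; rewrite (compE k e) compm1. Qed.

Lemma mono_cancel U V (f : mor U V) :
  (forall X (g : mor X U), f ∘ g = 0 -> g = 0) -> is_mono f.
Proof.
move=> H X g h e; apply/eqP; rewrite -subr_eq0; apply/eqP/H.
by rewrite compDr compNr e subrr.
Qed.

(** Applied to structural isomorphisms, this and [section_epi] are the cancellation rules: an
    equation is first composed with an isomorphism, then proved. *)
Lemma retract_mono U V (f : mor U V) (s : mor V U) : s ∘ f = idm U -> is_mono f.
Proof. by move=> e X g h E; rewrite -[g]comp1m -[h]comp1m -e -!compA E. Qed.
Lemma section_epi U V (f : mor U V) (s : mor V U) : f ∘ s = idm V -> is_epi f.
Proof. by move=> e X g h E; rewrite -[g]compm1 -[h]compm1 -e !compA E. Qed.

End Category.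

Section MonoidalTheory.
Context {K : fieldType} {D : mcat K}.
Context {HL : linear_category_laws D} {HM : monoidal_laws D}.
Implicit Types U V W X Y Z : D.

Lemma tmor1 U V : idm U ⊠ idm V = idm (U ⊗ V).
Proof. exact: tmor_id. Qed.
Lemma tmorC U U' U'' V V' V'' (f : mor U U') (f' : mor U' U'')
      (g : mor V V') (g' : mor V' V'') :
  (f' ∘ f) ⊠ (g' ∘ g) = (f' ⊠ g') ∘ (f ⊠ g).
Proof. exact: tmor_comp. Qed.
Lemma tmorCl U U' U'' V (f : mor U U') (f' : mor U' U'') :
  (f' ∘ f) ⊠ idm V = (f' ⊠ idm V) ∘ (f ⊠ idm V).
Proof. by rewrite -tmorC comp1m. Qed.
Lemma tmorCr U V V' V'' (g : mor V V') (g' : mor V' V'') :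
  idm U ⊠ (g' ∘ g) = (idm U ⊠ g') ∘ (idm U ⊠ g).
Proof. by rewrite -tmorC comp1m. Qed.
Lemma tmorLR U U' V V' (f : mor U U') (g : mor V V') :
  f ⊠ g = (f ⊠ idm V') ∘ (idm U ⊠ g).
Proof. by rewrite -tmorC comp1m compm1. Qed.
Lemma tmorRL U U' V V' (f : mor U U') (g : mor V V') :
  f ⊠ g = (idm U' ⊠ g) ∘ (f ⊠ idm V).
Proof. by rewrite -tmorC comp1m compm1. Qed.
Lemma tmor_exch U U' V V' (f : mor U U') (g : mor V V') :
  (f ⊠ idm V') ∘ (idm U ⊠ g) = (idm U' ⊠ g) ∘ (f ⊠ idm V).
Proof. by rewrite -tmorLR -tmorRL. Qed.
Lemma tmor_exchV U U' V V' (f : mor U U') (g : mor V V') :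
  (idm U' ⊠ g) ∘ (f ⊠ idm V) = (f ⊠ idm V') ∘ (idm U ⊠ g).
Proof. by rewrite tmor_exch. Qed.
Lemma tmorCrV U V V' V'' (g : mor V V') (g' : mor V' V'') :
  (idm U ⊠ g') ∘ (idm U ⊠ g) = idm U ⊠ (g' ∘ g).
Proof. by rewrite tmorCr. Qed.
Lemma tmorClV U U' U'' V (f : mor U U') (f' : mor U' U'') :
  (f' ⊠ idm V) ∘ (f ⊠ idm V) = (f' ∘ f) ⊠ idm V.
Proof. by rewrite tmorCl. Qed.
Lemma tmorDl U V U' V' (f f' : mor U U') (g : mor V V') :
  (f + f') ⊠ g = f ⊠ g + f' ⊠ g.
Proof. exact: (linD (tmor_linl HM g)). Qed.
Lemma tmorDr U V U' V' (f : mor U U') (g g' : mor V V') :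
  f ⊠ (g + g') = f ⊠ g + f ⊠ g'.
Proof. exact: (linD (tmor_linr HM f)). Qed.
Lemma tmorZl U V U' V' a (f : mor U U') (g : mor V V') :
  (a *: f) ⊠ g = a *: (f ⊠ g).
Proof. exact: (linZ (tmor_linl HM g)). Qed.
Lemma tmorZr U V U' V' a (f : mor U U') (g : mor V V') :
  f ⊠ (a *: g) = a *: (f ⊠ g).
Proof. exact: (linZ (tmor_linr HM f)). Qed.
Lemma tmor0l U V U' V' (g : mor V V') : (0 : mor U U') ⊠ g = 0.
Proof. exact: (lin0 (tmor_linl HM g)). Qed.
Lemma tmor0r U V U' V' (f : mor U U') : f ⊠ (0 : mor V V') = 0.
Proof. exact: (lin0 (tmor_linr HM f)). Qed.
Lemma tmor_suml U V U' V' (J : Type) (r : seq J) (P : pred J)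
    (F : J -> mor U U') (g : mor V V') :
  (\sum_(j <- r | P j) F j) ⊠ g = \sum_(j <- r | P j) F j ⊠ g.
Proof. exact: (lin_sum (tmor_linl HM g)). Qed.
Lemma tmor_sumr U V U' V' (J : Type) (r : seq J) (P : pred J)
    (f : mor U U') (G : J -> mor V V') :
  f ⊠ (\sum_(j <- r | P j) G j) = \sum_(j <- r | P j) f ⊠ G j.
Proof. exact: (lin_sum (tmor_linr HM f)). Qed.

Lemma alphaK U V W : alphaV U V W ∘ alpha U V W = idm _.
Proof. by case: (alpha_inv HM U V W). Qed.
Lemma alphaVK U V W : alpha U V W ∘ alphaV U V W = idm _.
Proof. by case: (alpha_inv HM U V W). Qed.
Lemma lamK U : lamV U ∘ lam U = idm _.
Proof. by case: (lam_inv HM U). Qed.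
Lemma lamVK U : lam U ∘ lamV U = idm _.
Proof. by case: (lam_inv HM U). Qed.
Lemma rhoK U : rhoV U ∘ rho U = idm _.
Proof. by case: (rho_inv HM U). Qed.
Lemma rhoVK U : rho U ∘ rhoV U = idm _.
Proof. by case: (rho_inv HM U). Qed.

Lemma alphaE U U' V V' W W' (f : mor U U') (g : mor V V') (h : mor W W') :
  alpha U' V' W' ∘ (f ⊠ g ⊠ h) = (f ⊠ (g ⊠ h)) ∘ alpha U V W.
Proof. exact: alpha_nat. Qed.
Lemma alphaVE U U' V V' W W' (f : mor U U') (g : mor V V') (h : mor W W') :
  alphaV U' V' W' ∘ (f ⊠ (g ⊠ h)) = (f ⊠ g ⊠ h) ∘ alphaV U V W.
Proof.
rewrite -[LHS]compm1 -(alphaVK U V W) !compA; congr (_ ∘ _).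
by rewrite (compE2 _ (esym (alphaE f g h))) alphaK comp1m.
Qed.
Lemma alphaEl U U' V W (f : mor U U') :
  alpha U' V W ∘ (f ⊠ idm V ⊠ idm W) = (f ⊠ idm (V ⊗ W)) ∘ alpha U V W.
Proof. by rewrite alphaE tmor1. Qed.
Lemma alphaEr U V W W' (h : mor W W') :
  alpha U V W' ∘ (idm (U ⊗ V) ⊠ h) = (idm U ⊠ (idm V ⊠ h)) ∘ alpha U V W.
Proof. by rewrite -tmor1 alphaE. Qed.
Lemma alphaVEl U U' V W (f : mor U U') :
  alphaV U' V W ∘ (f ⊠ idm (V ⊗ W)) = (f ⊠ idm V ⊠ idm W) ∘ alphaV U V W.
Proof. by rewrite -tmor1 alphaVE. Qed.
Lemma alphaVEr U V W W' (h : mor W W') :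
  alphaV U V W' ∘ (idm U ⊠ (idm V ⊠ h)) = (idm (U ⊗ V) ⊠ h) ∘ alphaV U V W.
Proof. by rewrite alphaVE tmor1. Qed.

Lemma lamE U U' (f : mor U U') : lam U' ∘ (idm uob ⊠ f) = f ∘ lam U.
Proof. exact: lam_nat. Qed.
Lemma rhoE U U' (f : mor U U') : rho U' ∘ (f ⊠ idm uob) = f ∘ rho U.
Proof. exact: rho_nat. Qed.
Lemma lamVE U U' (f : mor U U') : (idm uob ⊠ f) ∘ lamV U = lamV U' ∘ f.
Proof.
rewrite -[LHS]comp1m -lamK !compA (compE _ (lamE f)) !compA.
by rewrite (compK _ (lamVK U)).
Qed.
Lemma rhoVE U U' (f : mor U U') : (f ⊠ idm uob) ∘ rhoV U = rhoV U' ∘ f.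
Proof.
rewrite -[LHS]comp1m -rhoK !compA (compE _ (rhoE f)) !compA.
by rewrite (compK _ (rhoVK U)).
Qed.

Lemma pentagonE U V W X :
  alpha U V (W ⊗ X) ∘ alpha (U ⊗ V) W X =
  (idm U ⊠ alpha V W X) ∘ alpha U (V ⊗ W) X ∘ (alpha U V W ⊠ idm X).
Proof. exact: pentagon. Qed.

Lemma tmor_invl U V W (f : mor U V) (g : mor V U) :
  g ∘ f = idm _ -> (g ⊠ idm W) ∘ (f ⊠ idm W) = idm _.
Proof. by move=> e; rewrite -tmorCl e tmor1. Qed.
Lemma tmor_invr U V W (f : mor U V) (g : mor V U) :
  g ∘ f = idm _ -> (idm W ⊠ g) ∘ (idm W ⊠ f) = idm _.
Proof. by move=> e; rewrite -tmorCr e tmor1. Qed.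

Lemma pentagonV U V W X :
  (alpha U V W ⊠ idm X) ∘ alphaV (U ⊗ V) W X =
  alphaV U (V ⊗ W) X ∘ (idm U ⊠ alphaV V W X) ∘ alpha U V (W ⊗ X).
Proof.
rewrite -[RHS]compm1 -(alphaVK (U ⊗ V) W X) !compA.
rewrite (compE _ (pentagonE U V W X)) !compA.
by rewrite (compK _ (tmor_invr _ (alphaK V W X))) alphaK comp1m.
Qed.

Lemma pentagonVV U V W X :
  alphaV (U ⊗ V) W X ∘ alphaV U V (W ⊗ X) =
  (alphaV U V W ⊠ idm X) ∘ alphaV U (V ⊗ W) X ∘ (idm U ⊠ alphaV V W X).
Proof.
apply: (retract_mono (tmor_invl X (alphaK U V W))).
rewrite !compA pentagonV (compK _ (alphaVK _ _ _)).
by rewrite (tmor_invl X (alphaVK U V W)) comp1m.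
Qed.

Lemma pentagonM U V W X :
  alphaV U V (W ⊗ X) ∘ (idm U ⊠ alpha V W X) ∘ alpha U (V ⊗ W) X =
  alpha (U ⊗ V) W X ∘ (alphaV U V W ⊠ idm X).
Proof.
apply: (section_epi (tmor_invl X (alphaVK U V W))).
rewrite (compK _ (tmor_invl X (alphaK U V W))).
by rewrite (compE3 _ (esym (pentagonE U V W X))) compA alphaK comp1m.
Qed.

Lemma triangleE U V : (idm U ⊠ lam V) ∘ alpha U uob V = rho U ⊠ idm V.
Proof. exact: triangle. Qed.

(** Tensoring with the unit is faithful because [lam] is a natural isomorphism. The spare factor
    makes room for the pentagon in the unit coherences. *)
Lemma unit_tmorI U V (f g : mor U V) : idm uob ⊠ f = idm uob ⊠ g -> f = g.
Proof.
move=> e; rewrite -[f]compm1 -(lamVK U) compA -lamE e lamE -compA lamVK.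
by rewrite compm1.
Qed.
Lemma tmor_unitI U V (f g : mor U V) : f ⊠ idm uob = g ⊠ idm uob -> f = g.
Proof.
move=> e; rewrite -[f]compm1 -(rhoVK U) compA -rhoE e rhoE -compA rhoVK.
by rewrite compm1.
Qed.

(* Kelly's two consequences of the pentagon and the triangle. *)
Lemma lam_tob U V : lam (U ⊗ V) ∘ alpha uob U V = lam U ⊠ idm V.
Proof.
apply: unit_tmorI; rewrite tmorCr.
have Hepi : is_epi (alpha uob (uob ⊗ U) V ∘ (alpha uob uob U ⊠ idm V)).
  apply: (@section_epi _ _ _ _ _ _ ((alphaV uob uob U ⊠ idm V) ∘ alphaV uob (uob ⊗ U) V)).
  by rewrite !compA (compK _ (tmor_invl _ (alphaVK _ _ _))) alphaVK.
apply: Hepi.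
transitivity (alpha uob U V ∘ (rho uob ⊠ idm U ⊠ idm V)).
  rewrite -(compA _ (idm uob ⊠ _)) (compA _ _ (idm uob ⊠ alpha _ _ _)).
  by rewrite -pentagonE compA triangleE alphaE tmor1.
by rewrite compA -alphaE -compA -tmorCl triangleE.
Qed.

Lemma rho_tob U V : rho (U ⊗ V) = (idm U ⊠ rho V) ∘ alpha U V uob.
Proof.
apply: tmor_unitI; rewrite tmorCl.
apply: (retract_mono (alphaK U V uob)).
rewrite compA alphaE -triangleE compA alphaEr -(triangleE V uob) tmorCr.
by rewrite -(compA (alpha (U ⊗ V) _ _)) pentagonE !compA.
Qed.

(** After tensoring with the unit both sides factor through [alpha], and naturality of [lam] at
    [lam uob] identifies [lam (uob ⊗ uob)] with [idm uob ⊠ lam uob]. *)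
Lemma lam_rho_unit : lam (uob : D) = rho uob.
Proof.
apply: tmor_unitI; rewrite -lam_tob -triangleE; congr (_ ∘ _).
by apply: (retract_mono (lamK uob)); rewrite lamE.
Qed.

Lemma lam_tobV U V : alphaV uob U V ∘ lamV (U ⊗ V) = lamV U ⊠ idm V.
Proof.
apply: (retract_mono (tmor_invl V (lamK U))).
by rewrite (tmor_invl V (lamVK U)) -lam_tob !compA (compK _ (alphaVK _ _ _)) lamVK.
Qed.
Lemma rho_tobV U V : rhoV (U ⊗ V) = alphaV U V uob ∘ (idm U ⊠ rhoV V).
Proof.
apply: (retract_mono (rhoK (U ⊗ V))); rewrite rhoVK rho_tob !compA.
by rewrite (compK _ (alphaVK _ _ _)) (tmor_invr U (rhoVK V)).
Qed.
Lemma triangleV U V : alpha U uob V ∘ (rhoV U ⊠ idm V) = idm U ⊠ lamV V.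
Proof.
apply: (retract_mono (tmor_invr U (lamK V))).
by rewrite (tmor_invr U (lamVK V)) compA triangleE (tmor_invl V (rhoVK U)).
Qed.
Lemma triangleVl U V : (rho U ⊠ idm V) ∘ alphaV U uob V = idm U ⊠ lam V.
Proof. by rewrite -triangleE (compK _ (alphaVK _ _ _)). Qed.

End MonoidalTheory.

(** * Bimodules *)

Section BimoduleTheory.
Context {K : fieldType} {D : mcat K}.
Context {HL : linear_category_laws D} {HM : monoidal_laws D}.
Implicit Types U V W X Y Z : D.

Lemma bimodule_map_id (A : algebra D) (M : bimodule A) :
  @bimodule_map _ _ A M M (idm M).
Proof. by split; rewrite tmor1 comp1m compm1. Qed.

Lemma bimodule_mapZ (A : algebra D) (M N : bimodule A) c (f : mor M N) :
  bimodule_map f -> @bimodule_map _ _ A M N (c *: f).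
Proof.
case=> fl fr; split; rewrite ?tmorZr ?tmorZl ?compZl ?compZr; first by rewrite fl.
by rewrite fr.
Qed.

(** The identity is always a bimodule map, so a one-dimensional space of such maps is the line that
    it spans. *)
Lemma absolutely_simpleP (A : algebra D) :
  absolutely_simple A <->
  (idm A <> 0 /\ forall f : mor A A,
     @bimodule_map _ _ A (regular_bimodule A) (regular_bimodule A) f ->
     exists c, f = c *: idm A).
Proof.
have idP := @bimodule_map_id A (regular_bimodule A).
split=> [[E [EP dE]] | [id0 H]].
  have idE : idm A \in E by apply/EP.
  have id0 : idm A <> 0.
    move=> e; suff E0 : E = 0%VS by rewrite E0 dimv0 in dE.
    apply/eqP; rewrite -subv0; apply/subvP => f _.
    by rewrite -[f]compm1 e comp0r mem0v.
  split=> // f /EP fE; have: (<[idm A]> == E)%VS.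
    by rewrite eqEdim -memvE idE dE dim_vline; case: eqP id0.
  by move/eqP=> EE; move: fE; rewrite -EE => /vlineP.
exists <[idm A]>%VS; split; last by rewrite dim_vline; case: eqP id0.
move=> f; split=> [/vlineP[c ->] | /H[c ->]]; last by rewrite memvZ ?memv_line.
exact: bimodule_mapZ.
Qed.

Lemma regular_bimodule_laws (A : algebra D) :
  algebra_laws A -> bimodule_laws (regular_bimodule A).
Proof. by case=> mA mu1 mu2; split. Qed.

(** An element is itself times the unit, so left linearity leaves only the freedom of the value at
    the unit. *)
Lemma left_linear_endo (A : algebra D) (g : mor A A) :
  algebra_laws A -> g ∘ mul A = mul A ∘ (idm A ⊠ g) ->
  g = mul A ∘ (idm A ⊠ (g ∘ unt A)) ∘ rhoV A.
Proof.
case=> _ _ m2 gl; rewrite tmorCr !compA -gl (compE _ m2) -compA rhoVK.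
by rewrite compm1.
Qed.
Lemma right_linear_endo (A : algebra D) (g : mor A A) :
  algebra_laws A -> g ∘ mul A = mul A ∘ (g ⊠ idm A) ->
  g = mul A ∘ ((g ∘ unt A) ⊠ idm A) ∘ lamV A.
Proof.
case=> _ m1 _ gr; rewrite tmorCl !compA -gr (compE _ m1) -compA lamVK.
by rewrite compm1.
Qed.

Section FreeBimodule.
Variables (A : algebra D) (HA : algebra_laws A).

Definition is_rmod Y (r : mor (Y ⊗ A) Y) : Prop :=
  r ∘ (r ⊠ idm A) = r ∘ (idm Y ⊠ mul A) ∘ alpha Y A A /\
  r ∘ (idm Y ⊠ unt A) = rho Y.

(** Used twice on the regular module, this gives the right action on the free bimodule
    [A ⊗ (Z ⊗ A)]. *)
Lemma tens_rmod Z Y (r : mor (Y ⊗ A) Y) :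
  is_rmod r -> is_rmod ((idm Z ⊠ r) ∘ alpha Z Y A).
Proof.
case=> rA r1; split; last first.
  by rewrite -compA alphaEr compA -tmorCr r1 rho_tob.
rewrite tmorCl !compA (compE2 _ (alphaE _ _ _)) -!tmorCr rA !tmorCr.
rewrite (compE3 _ (esym (pentagonE Z Y A A))) !compA.
by rewrite (compE2 _ (alphaEr _ _ _)).
Qed.

Definition free_bimodule Z : bimodule A :=
  @Bimodule K D A (A ⊗ (Z ⊗ A))
    ((mul A ⊠ idm (Z ⊗ A)) ∘ alphaV A A (Z ⊗ A))
    ((idm A ⊠ ((idm Z ⊠ mul A) ∘ alpha Z A A)) ∘ alpha A (Z ⊗ A) A).

Lemma free_bimodule_laws Z : bimodule_laws (free_bimodule Z).
Proof.
case: (HA) => mA mu1 mu2.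
have rA : is_rmod (mul A) by split.
have [r1 r2] := tens_rmod A (tens_rmod Z rA).
split=> //=; set Y := Z ⊗ A.
- rewrite -compA alphaVEl compA -tmorCl mA tmorCr !compA.
  rewrite (compE2 _ (alphaVE (idm A) (mul A) (idm Y))) -tmorCl !tmorCl -!compA.
  do 2! congr (_ ∘ _); rewrite pentagonV !compA; congr (_ ∘ _ ∘ _).
- by rewrite -compA alphaVEl compA -tmorCl mu1 -lam_tob (compK _ (alphaVK _ _ _)).
set r := (idm Z ⊠ mul A) ∘ alpha Z A A.
rewrite tmorCl tmorCr !compA (compE2 _ (alphaEl _ _ _)).
rewrite (compE2 _ (alphaVEr _ _ _)) -tmorRL -tmorLR.
by rewrite (compE3 _ (pentagonM _ _ _ _)) !compA.
Qed.

(** In elements, [a ⊗ z ⊗ b] is sent to [a d(z) b]. *)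
Definition free_map Z (N : bimodule A) (d : mor Z N) : mor (free_bimodule Z) N :=
  lact N ∘ (idm A ⊠ (ract N ∘ (d ⊠ idm A))).

Lemma free_mapP Z (N : bimodule A) (d : mor Z N) :
  bimodule_laws N -> bimodule_map (free_map d).
Proof.
case=> lm _ rm _ lr; rewrite /free_map; set x := ract N ∘ _.
split=> /=.
  rewrite !compA (compE2 _ (tmor_exchV _ _)) lm.
  by rewrite (compE2 _ (alphaEr _ _ _)) (compK _ (alphaVK _ _ _)) -compA -tmorCr.
rewrite tmorCl !compA lr (compE2 _ (alphaE _ _ _)) !(compE _ (tmorCrV _ _ _)).
congr (_ ∘ (_ ⊠ _) ∘ _).
rewrite /x tmorCl !compA rm (compE2 _ (alphaEl _ _ _)).
by rewrite (compE2 _ (tmor_exch _ _)).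
Qed.

(** The morphism from [Z] is the universal one, [z] to [1 ⊗ z ⊗ 1], so a free map determines [d]. *)
Lemma free_map_unit Z (N : bimodule A) (d : mor Z N) :
  bimodule_laws N ->
  free_map d ∘ ((unt A ⊠ idm _) ∘ lamV _ ∘ (idm Z ⊠ unt A) ∘ rhoV Z) = d.
Proof.
case=> _ lu _ ru _; rewrite /free_map !compA.
rewrite (compE2 _ (tmor_exchV _ _)) lu lamE (compK _ (lamVK _)).
by rewrite (compE2 _ (tmor_exch _ _)) ru rhoE (compK _ (rhoVK _)).
Qed.

Lemma comp_free_map Z (N M : bimodule A) (f : mor N M) (d : mor Z N) :
  bimodule_map f -> f ∘ free_map d = free_map (f ∘ d).
Proof.
case=> fl fr; rewrite /free_map !compA fl (compE _ (tmorCrV _ _ _)) compA fr.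
by rewrite (compE _ (tmorClV _ _ _)).
Qed.

(* Morphisms out of [Z] are the bimodule maps out of the free bimodule on [Z]. *)
Lemma bimodule_mono_mono (N M : bimodule A) (f : mor N M) :
  bimodule_laws N -> bimodule_map f -> bimodule_mono f -> is_mono f.
Proof.
move=> HN fP fM Z g h e.
rewrite -(free_map_unit g HN) -(free_map_unit h HN); congr (_ ∘ _).
apply: fM; [exact: free_bimodule_laws | exact: free_mapP | exact: free_mapP |].
by rewrite !comp_free_map // e.
Qed.

Lemma mono_bimodule_mono (N M : bimodule A) (f : mor N M) :
  is_mono f -> bimodule_mono f.
Proof. by move=> fm X _ g h _ _; apply: fm. Qed.
End FreeBimodule.

Section SubBimodule.
Variables (A : algebra D) (M : bimodule A) (I : D) (i : mor I M) (p : mor M I).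
Hypotheses (modM : bimodule_laws M) (pi : p ∘ i = idm I).
Hypothesis il : i ∘ p ∘ lact M ∘ (idm A ⊠ i) = lact M ∘ (idm A ⊠ i).
Hypothesis ir : i ∘ p ∘ ract M ∘ (i ⊠ idm A) = ract M ∘ (i ⊠ idm A).

Definition sub_bimodule : bimodule A :=
  @Bimodule K D A I (p ∘ lact M ∘ (idm A ⊠ i)) (p ∘ ract M ∘ (i ⊠ idm A)).

Lemma sub_bimodule_incl : @bimodule_map K D A sub_bimodule M i.
Proof. by split; rewrite /= !compA ?il ?ir. Qed.

(** Each law is tested after the monomorphism [i], where [il] and [ir] remove the projections and
    the laws of [M] apply. *)
Lemma sub_bimodule_laws : bimodule_laws sub_bimodule.
Proof.
case: modM => lm lu rm ru lr; have im := retract_mono pi.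
case: sub_bimodule_incl => /= i1 i2.
split=> /=; apply: im; rewrite !compA.
- rewrite il (compE2 _ (tmor_exchV _ _)) lm (compE2 _ (alphaEr _ _ _)).
  by rewrite !(compE _ (tmorCrV _ _ _)) !compA il.
- by rewrite il (compE2 _ (tmor_exchV _ _)) lu lamE.
- rewrite ir (compE _ (tmorClV _ _ _)) !compA ir tmorCl !compA rm.
  rewrite (compE2 _ (alphaEl _ _ _)) (compE2 _ (tmor_exch _ _)); congr (_ ∘ _).
- by rewrite ir (compE2 _ (tmor_exch _ _)) ru rhoE.
rewrite ir (compE _ (tmorClV _ _ _)) !compA il tmorCl !compA lr.
by rewrite (compE2 _ (alphaE _ _ _)) !(compE _ (tmorCrV _ _ _)) !compA ir.
Qed.
End SubBimodule.
End BimoduleTheory.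

(** * The product category *)

Section TensorTheory.
Context {K : fieldType}.
Implicit Types V W X Y : vectType K.

Lemma pure_linl V W (w : W) : linear (fun v : V => pure v w : tens V W).
Proof. by move=> a u v; apply/matrixP=> i j; rewrite !mxE linearP mulrDl mulrA. Qed.
Lemma pure_linr V W (v : V) : linear (fun w : W => pure v w : tens V W).
Proof.
by move=> a u w; apply/matrixP=> i j; rewrite !mxE linearP mulrDr mulrCA.
Qed.

Lemma tlift_lin V W X (B : V -> W -> X) : linear (tlift B).
Proof.
move=> a t u; rewrite /tlift scaler_sumr -big_split; apply: eq_bigr => i _ /=.
rewrite scaler_sumr -big_split; apply: eq_bigr => j _ /=.
by rewrite !mxE scalerDl scalerA.
Qed.

Lemma tens_decomp V W (t : tens V W) :
  t = \sum_a \sum_b t a b *: (pure (vbasis fullv)`_a (vbasis fullv)`_b : tens V W).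
Proof.
apply/matrixP=> i j; rewrite summxE (bigD1 i) //= summxE (bigD1 j) //=.
rewrite !mxE !coord_free ?(basis_free (vbasisP _)) // !eqxx !mulr1.
rewrite !big1 ?addr0 // => [a ai | b bj]; last first.
  by rewrite !mxE !coord_free ?(basis_free (vbasisP _)) // eqxx (negPf bj) !mulr0.
rewrite summxE big1 // => b _.
by rewrite !mxE !coord_free ?(basis_free (vbasisP _)) // (negPf ai) mul0r mulr0.
Qed.

Lemma tens_ext V W X (phi psi : tens V W -> X) :
  linear phi -> linear psi -> (forall v w, phi (pure v w) = psi (pure v w)) ->
  phi =1 psi.
Proof.
move=> lphi lpsi E t; rewrite (tens_decomp t) (lin_sum lphi) (lin_sum lpsi).
apply: eq_bigr => a _; rewrite (lin_sum lphi) (lin_sum lpsi).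
by apply: eq_bigr => b _; rewrite (linZ lphi) (linZ lpsi) E.
Qed.

Lemma lin_comp V W X (f : V -> W) (g : W -> X) :
  linear f -> linear g -> linear (fun v => g (f v)).
Proof. by move=> fl gl a u v; rewrite fl gl. Qed.

Lemma tlift_lin2 V W X Y (B : Y -> V -> W -> X) t :
  (forall v w, linear (fun y => B y v w)) -> linear (fun y => tlift (B y) t).
Proof.
move=> Bl a u v; rewrite /tlift scaler_sumr -big_split; apply: eq_bigr => i _ /=.
rewrite scaler_sumr -big_split; apply: eq_bigr => j _ /=.
by rewrite Bl scalerDr !scalerA mulrC.
Qed.

Section Tlift2.
Variables (V W V' W' X Y : vectType K) (B : V -> V' -> X) (B' : W -> W' -> Y).
Hypotheses (Bl : forall v', linear (B^~ v')) (Br : forall v, linear (B v)).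
Hypotheses (Bl' : forall v', linear (B'^~ v')) (Br' : forall v, linear (B' v)).

Lemma tlift2_linl (u : tens V' W') : linear (fun t : tens V W => tlift2 B B' t u).
Proof. exact: tlift_lin. Qed.
Lemma tlift2_linr (t : tens V W) : linear (tlift2 B B' t).
Proof.
by apply: (@tlift_lin2 V W (tens X Y) (tens V' W')) => v w; apply: tlift_lin.
Qed.
Lemma tlift2_pure v w v' w' :
  tlift2 B B' (pure v w) (pure v' w') = pure (B v v') (B' w w').
Proof.
rewrite /tlift2 tlift_pure => [||y]; last 2 first.
- move=> y; apply: (@tlift_lin2 V' W' (tens X Y) V) => a b.
  exact: (lin_comp (Bl a) (pure_linl _)).
- apply: (@tlift_lin2 V' W' (tens X Y) W) => a b.
  exact: (lin_comp (Bl' b) (pure_linr _)).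
rewrite tlift_pure //; first by move=> b; apply: (lin_comp (Br v) (pure_linl _)).
by move=> a; apply: (lin_comp (Br' w) (pure_linr _)).
Qed.
End Tlift2.
End TensorTheory.

Arguments compm : simpl never.
Arguments tmor : simpl never.
Arguments idm : simpl never.
Arguments C2 : simpl never.

Section ProductCategory.
Context {K : fieldType} {C : modular_data K}.
Context {HL : linear_category_laws C} {HM : monoidal_laws C}.
Implicit Types M N P Q : C2 C.

Lemma tcomp_linl (U U' V V' W W' : C) (u : tens (mor U V) (mor U' V')) :
  linear (fun t : tens (mor V W) (mor V' W') => tcomp t u).
Proof. exact: tlift2_linl. Qed.
Lemma tcomp_linr (U U' V V' W W' : C) (t : tens (mor V W) (mor V' W')) :
  linear (@tcomp K C U U' V V' W W' t).
Proof. exact: tlift2_linr. Qed.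
Lemma tcomp_pure (U U' V V' W W' : C) (g : mor V W) (g' : mor V' W')
    (f : mor U V) (f' : mor U' V') :
  tcomp (pure g g') (pure f f') = pure (g ∘ f) (g' ∘ f').
Proof.
apply: tlift2_pure; [exact: comp_linl | exact: comp_linr | exact: comp_linl
  | exact: comp_linr].
Qed.
Lemma ttens_linl (U U' V V' X X' Y Y' : C) (u : tens (mor X Y) (mor X' Y')) :
  linear (fun t : tens (mor U V) (mor U' V') => ttens t u).
Proof. exact: tlift2_linl. Qed.
Lemma ttens_linr (U U' V V' X X' Y Y' : C) (t : tens (mor U V) (mor U' V')) :
  linear (@ttens K C U U' V V' X X' Y Y' t).
Proof. exact: tlift2_linr. Qed.
Lemma ttens_pure (U U' V V' X X' Y Y' : C) (g : mor U V) (g' : mor U' V')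
    (f : mor X Y) (f' : mor X' Y') :
  ttens (pure g g') (pure f f') = pure (g ⊠ f) (g' ⊠ f').
Proof.
apply: tlift2_pure; [exact: (tmor_linl HM) | exact: (tmor_linr HM)
  | exact: (tmor_linl HM) | exact: (tmor_linr HM)].
Qed.

Lemma tcomp_idl (U U' V V' : C) (t : tens (mor U V) (mor U' V')) :
  tcomp (pure (idm V) (idm V')) t = t.
Proof.
apply: (tens_ext (tcomp_linr _) _ _ t) => // f f'.
by rewrite tcomp_pure !comp1m.
Qed.
Lemma tcomp_idr (U U' V V' : C) (t : tens (mor U V) (mor U' V')) :
  tcomp t (pure (idm U) (idm U')) = t.
Proof.
apply: (tens_ext (tcomp_linl _) _ _ t) => // f f'.
by rewrite tcomp_pure !compm1.
Qed.
Lemma tcomp0l (U U' V V' W W' : C) (u : tens (mor U V) (mor U' V')) :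
  tcomp (0 : tens (mor V W) (mor V' W')) u = 0.
Proof. exact: (lin0 (tcomp_linl u)). Qed.
Lemma tcomp0r (U U' V V' W W' : C) (t : tens (mor V W) (mor V' W')) :
  tcomp t (0 : tens (mor U V) (mor U' V')) = 0.
Proof. exact: (lin0 (tcomp_linr t)). Qed.
Lemma ttens0l (U U' V V' X X' Y Y' : C) (u : tens (mor X Y) (mor X' Y')) :
  ttens (0 : tens (mor U V) (mor U' V')) u = 0.
Proof. exact: (lin0 (ttens_linl u)). Qed.
Lemma ttens0r (U U' V V' X X' Y Y' : C) (t : tens (mor U V) (mor U' V')) :
  ttens t (0 : tens (mor X Y) (mor X' Y')) = 0.
Proof. exact: (lin0 (ttens_linr t)). Qed.

Lemma ent_mk M N F (m : pidx M) (n : pidx N) : ent (mk F) m n = F m n.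
Proof. by apply/matrixP=> i j; rewrite mxE ffunE. Qed.
Lemma ent_ext M N (f g : mor M N) :
  (forall m n, ent f m n = ent g m n) -> f = g.
Proof.
move=> E; apply/ffunP=> -[[m n] [a b]].
by have /matrixP/(_ a b) := E m n; rewrite !mxE.
Qed.
Lemma ent_lin M N (m : pidx M) (n : pidx N) : linear (fun f : mor M N => ent f m n).
Proof. by move=> a f g; apply/matrixP=> i j; rewrite !mxE !ffunE. Qed.
Lemma ent_sum M N (J : Type) (r : seq J) (P : pred J) (F : J -> mor M N) m n :
  ent (\sum_(j <- r | P j) F j) m n = \sum_(j <- r | P j) ent (F j) m n.
Proof. exact: (lin_sum (@ent_lin M N m n)). Qed.

Lemma diag_entry_eq (J : finType) (T : J -> J -> vectType K)
    (F : forall j, T j j) j : diag_entry F j j = F j.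
Proof.
rewrite /diag_entry; case: eqP => // e.
by rewrite (eq_irrelevance e (erefl j)).
Qed.
Lemma diag_entry_neq (J : finType) (T : J -> J -> vectType K)
    (F : forall j, T j j) j k : j != k -> diag_entry F j k = 0.
Proof. by rewrite /diag_entry; case: eqP. Qed.

Lemma ent_pid M (m : pidx M) : ent (idm M) m m = pure (idm (pl m)) (idm (pr m)).
Proof. by rewrite ent_mk diag_entry_eq. Qed.
Lemma ent_pid0 M (m m' : pidx M) : m != m' -> ent (idm M) m m' = 0.
Proof. by move=> ne; rewrite ent_mk diag_entry_neq. Qed.

(* The morphism with the single entry [f (x) g]; the identities [ent (idm _)]
   select the position and supply the casts. *)
Definition pel M N (m : pidx M) (n : pidx N) (f : mor (pl m) (pl n))
    (g : mor (pr m) (pr n)) : mor M N :=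
  mk (fun m' n' =>
    tcomp (tcomp (ent (idm N) n n') (pure f g)) (ent (idm M) m' m)).
Arguments pel {M N} m n f g.

Lemma ent_pelE M N m n (f : mor (@pl _ C M m) (@pl _ C N n)) g m' n' :
  ent (pel m n f g) m' n' =
  tcomp (tcomp (ent (idm N) n n') (pure f g)) (ent (idm M) m' m).
Proof. by rewrite [LHS]ent_mk. Qed.
Lemma ent_pel M N m n (f : mor (@pl _ C M m) (@pl _ C N n)) g :
  ent (pel m n f g) m n = pure f g.
Proof. by rewrite ent_pelE !ent_pid tcomp_idl tcomp_idr. Qed.
Lemma ent_pel0 M N m n (f : mor (@pl _ C M m) (@pl _ C N n)) g m' n' :
  (m != m') || (n != n') -> ent (pel m n f g) m' n' = 0.
Proof.
rewrite ent_pelE => /orP[mm|nn].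
  by rewrite [ent _ m' m]ent_pid0 1?eq_sym // tcomp0r.
by rewrite [ent _ n n']ent_pid0 // tcomp0l tcomp0l.
Qed.

Lemma pel_linl M N m n g :
  linear (fun f : mor (@pl _ C M m) (@pl _ C N n) => pel m n f g).
Proof.
move=> a u v; apply: ent_ext => m' n'; rewrite (ent_lin _ _ a) !ent_pelE.
have L : linear (fun f => tcomp (tcomp (ent (idm N) n n') (pure f g)) (ent (idm M) m' m)).
  apply: (lin_comp _ (tcomp_linl _)); apply: (lin_comp _ (tcomp_linr _)).
  exact: pure_linl.
exact: L.
Qed.
Lemma pel_linr M N m n f :
  linear (fun g : mor (@pr _ C M m) (@pr _ C N n) => pel m n f g).
Proof.
move=> a u v; apply: ent_ext => m' n'; rewrite (ent_lin _ _ a) !ent_pelE.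
have L : linear (fun g => tcomp (tcomp (ent (idm N) n n') (pure f g)) (ent (idm M) m' m)).
  apply: (lin_comp _ (tcomp_linl _)); apply: (lin_comp _ (tcomp_linr _)).
  exact: pure_linr.
exact: L.
Qed.
Lemma pel0l M N m n g : pel m n (0 : mor (@pl _ C M m) (@pl _ C N n)) g = 0.
Proof. exact: (lin0 (pel_linl g)). Qed.
Lemma pelZl M N m n a (f : mor (@pl _ C M m) (@pl _ C N n)) g :
  pel m n (a *: f) g = a *: pel m n f g.
Proof. exact: (linZ (pel_linl g)). Qed.
Lemma pelZr M N m n a (f : mor (@pl _ C M m) (@pl _ C N n)) g :
  pel m n f (a *: g) = a *: pel m n f g.
Proof. exact: (linZ (pel_linr f)). Qed.

(** Meant for [F = tlift (pel m n)]: what is known of [pel] on pure tensors extends to an arbitrary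
    entry by linearity. *)
Lemma ent_single M N m n (t : phom_tens m n) (F : tens _ _ -> mor M N) :
  linear F -> (forall f g, F (pure f g) = pel m n f g) ->
  (forall m' n', (m != m') || (n != n') -> ent (F t) m' n' = 0) /\ ent (F t) m n = t.
Proof.
move=> FL E; split=> [m' n' ne|].
  apply: (tens_ext (lin_comp FL (@ent_lin M N m' n')) (psi := fun=> 0) _ _ t).
    by move=> a u v; rewrite scaler0 addr0.
  by move=> f g; rewrite E ent_pel0.
apply: (tens_ext (lin_comp FL (@ent_lin M N m n)) (psi := id) _ _ t) => // f g.
by rewrite E ent_pel.
Qed.

Lemma mor_pel_decomp M N (f : mor M N) :
  f = \sum_m \sum_n tlift (pel m n) (ent f m n).
Proof.
have H m n := @ent_single M N m n (ent f m n) (tlift (pel m n)) (tlift_lin _)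
  (tlift_pure (fun g => pel_linl g) (fun f => pel_linr f)).
apply: ent_ext => m n; rewrite ent_sum (bigD1 m) //= ent_sum (bigD1 n) //=.
rewrite (H m n).2 !big1 ?addr0 // => [m' ne | n' ne].
  by rewrite ent_sum big1 // => n' _; rewrite (H _ _).1 // ne.
by rewrite (H _ _).1 // ne orbT.
Qed.

(** A morphism of the product is a sum of single entries, and each entry a sum of pure tensors.
    Hence a multilinear identity in [C2] need only be checked on morphisms [pel]. *)
Lemma mor_ext M N (X : vectType K) (phi psi : mor M N -> X) :
  linear phi -> linear psi ->
  (forall m n f g, phi (pel m n f g) = psi (pel m n f g)) -> phi =1 psi.
Proof.
move=> lphi lpsi E f; rewrite (mor_pel_decomp f) (lin_sum lphi) (lin_sum lpsi).
apply: eq_bigr => m _; rewrite (lin_sum lphi) (lin_sum lpsi).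
apply: eq_bigr => n _.
apply: (tens_ext (lin_comp (tlift_lin _) lphi) (lin_comp (tlift_lin _) lpsi)).
by move=> v w; rewrite tlift_pure ?E //; [exact: pel_linl | exact: pel_linr].
Qed.

Lemma ent_comp M N P (g : mor N P) (f : mor M N) m p :
  ent (g ∘ f) m p = \sum_n tcomp (ent g n p) (ent f m n).
Proof. by rewrite [LHS]ent_mk. Qed.
Lemma pcomp_linl M N P (f : mor M N) : linear (fun g : mor N P => g ∘ f).
Proof.
move=> a u v; apply: ent_ext => m p; rewrite (ent_lin _ _ a) !ent_comp.
rewrite scaler_sumr -big_split; apply: eq_bigr => n _.
by rewrite (ent_lin _ _ a) tcomp_linl.
Qed.
Lemma pcomp_linr M N P (g : mor N P) : linear (fun f : mor M N => g ∘ f).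
Proof.
move=> a u v; apply: ent_ext => m p; rewrite (ent_lin _ _ a) !ent_comp.
rewrite scaler_sumr -big_split; apply: eq_bigr => n _.
by rewrite (ent_lin _ _ a) tcomp_linr.
Qed.

Lemma pel_comp M N P m n p (f : mor (@pl _ C M m) (@pl _ C N n)) g
    (f' : mor _ (@pl _ C P p)) g' :
  (pel n p f' g' : mor N P) ∘ pel m n f g = pel m p (f' ∘ f) (g' ∘ g).
Proof.
apply: ent_ext => m' p'; rewrite ent_comp (bigD1 n) //= big1 => [|n' ne].
  rewrite addr0.
  case: (eqVneq m m') => [<-|mm]; last by rewrite !(ent_pel0 _ _ (m':=m')) ?mm ?tcomp0r.
  case: (eqVneq p p') => [<-|pp]; first by rewrite !ent_pel tcomp_pure.
  by rewrite !(ent_pel0 _ _ (n':=p')) ?pp ?orbT ?tcomp0l.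
by rewrite [ent _ m' n']ent_pel0 ?tcomp0r // [n == _]eq_sym ne orbT.
Qed.
Lemma pel_comp0 M N P m n n' p (f : mor (@pl _ C M m) (@pl _ C N n)) g
    (f' : mor _ (@pl _ C P p)) g' :
  n != n' -> (pel n' p f' g' : mor N P) ∘ pel m n f g = 0.
Proof.
move=> ne; apply: ent_ext => m' p'; rewrite ent_comp (lin0 (@ent_lin _ _ _ _)).
apply: big1 => n0 _; case: (eqVneq n n0) => [<-|nn]; last first.
  by rewrite [ent _ m' n0]ent_pel0 ?tcomp0r // nn orbT.
by rewrite ent_pel0 ?tcomp0l // eq_sym ne.
Qed.

Lemma idm_pel M : idm M = \sum_m pel m m (idm (pl m)) (idm (pr m)).
Proof.
apply: ent_ext => m n; rewrite ent_sum (bigD1 m) //=.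
case: (eqVneq m n) => [<-|ne].
  rewrite ent_pid ent_pel big1 ?addr0 // => m' ne.
  by rewrite ent_pel0 // ne.
rewrite ent_pid0 // ent_pel0 ?ne ?orbT // add0r big1 // => m' ne'.
by rewrite ent_pel0 // ne'.
Qed.

Lemma pel_idl M N m n (f : mor (@pl _ C M m) (@pl _ C N n)) g :
  idm N ∘ pel m n f g = pel m n f g.
Proof.
rewrite idm_pel (lin_sum (pcomp_linl _)) (bigD1 n) //= pel_comp !comp1m.
by rewrite big1 ?addr0 // => n' ne; rewrite pel_comp0 // eq_sym.
Qed.
Lemma pel_idr M N m n (f : mor (@pl _ C M m) (@pl _ C N n)) g :
  pel m n f g ∘ idm M = pel m n f g.
Proof.
rewrite idm_pel (lin_sum (pcomp_linr _)) (bigD1 m) //= pel_comp !compm1.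
by rewrite big1 ?addr0 // => n' ne; rewrite pel_comp0.
Qed.

#[global] Instance C2_linear : linear_category_laws (C2 C).
Proof.
split; [ | | | exact: pcomp_linl | exact: pcomp_linr].
- move=> M N P Q f g h.
  apply: (mor_ext (lin_comp (pcomp_linr g) (pcomp_linr h)) (pcomp_linr _) _ f).
  move=> m n {f} f f'.
  apply: (mor_ext (lin_comp (pcomp_linl _) (pcomp_linr h))
            (lin_comp (pcomp_linr h) (pcomp_linl _)) _ g).
  move=> n' p {g} g g'.
  apply: (mor_ext (pcomp_linl _) (lin_comp (pcomp_linl _) (pcomp_linl _)) _ h).
  move=> p' q {h} h h'.
  have [e|ne] := eqVneq n n'; last first.
    rewrite pel_comp0 // (lin0 (pcomp_linr _)).
    have [e|ne'] := eqVneq p p'; last by rewrite pel_comp0 // (lin0 (pcomp_linl _)).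
    by subst p'; rewrite pel_comp pel_comp0.
  subst n'; rewrite pel_comp.
  have [e|ne'] := eqVneq p p'; last by rewrite !pel_comp0 // (lin0 (pcomp_linl _)).
  by subst p'; rewrite !pel_comp !compA.
- move=> M N f; apply: (mor_ext (pcomp_linr _) _ _ f) => // m n {f} f f'.
  exact: pel_idl.
move=> M N f; apply: (mor_ext (pcomp_linl _) _ _ f) => // m n {f} f f'.
exact: pel_idr.
Qed.

End ProductCategory.
Arguments pel {K C M N} m n f g.

(** * The monoidal structure of the product category *)

Section ProductMonoidal.
Context {K : fieldType} {C : modular_data K}.
Context {HL : linear_category_laws C} {HM : monoidal_laws C}.
Implicit Types M N P Q : C2 C.

Lemma pel_ext M N (F G : mor M N) :
  (forall m, F ∘ pel m m (idm (pl m)) (idm (pr m)) =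
             G ∘ pel m m (idm (pl m)) (idm (pr m))) -> F = G.
Proof.
move=> E; rewrite -[F]compm1 -[G]compm1 idm_pel !comp_sumr.
by apply: eq_bigr => m _; rewrite E.
Qed.

Section Structural.
Variables (M N : C2 C) (F : mor M N) (s : pidx M -> pidx N).
Variables (a : forall m, mor (pl m) (pl (s m))) (b : forall m, mor (pr m) (pr (s m))).
Hypothesis Fs : forall m, ent F m (s m) = pure (a m) (b m).
Hypothesis F0 : forall m n, n != s m -> ent F m n = 0.

(** An associator or unitor of the product has a single nonzero entry for each source index [m], at
    the index [s m]. Composites with such a morphism are computed here once for all of them. *)
Lemma structural_decomp : F = \sum_m pel m (s m) (a m) (b m).
Proof.
apply: ent_ext => m n; rewrite ent_sum (bigD1 m) //=.
rewrite [X in _ + X]big1 ?addr0 => [|m' ne]; last by rewrite ent_pel0 // ne.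
have [->|ne] := eqVneq n (s m); first by rewrite Fs ent_pel.
by rewrite F0 // ent_pel0 // eq_sym ne orbT.
Qed.

Lemma structural_compl P (p : pidx P) m (f : mor (pl p) (pl m)) (g : mor (pr p) (pr m)) :
  F ∘ (pel p m f g : mor P M) = pel p (s m) (a m ∘ f) (b m ∘ g).
Proof.
rewrite structural_decomp comp_suml (bigD1 m) //= pel_comp big1 ?addr0 // => m' ne.
by rewrite pel_comp0 // eq_sym.
Qed.

Lemma structural_compr P (p : pidx P) m (f : mor (pl (s m)) (pl p))
    (g : mor (pr (s m)) (pr p)) :
  injective s ->
  (pel (s m) p f g : mor N P) ∘ F = pel m p (f ∘ a m) (g ∘ b m).
Proof.
move=> si; rewrite structural_decomp comp_sumr (bigD1 m) //= pel_comp.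
rewrite big1 ?addr0 // => m' ne; rewrite pel_comp0 //.
by apply: contraNneq ne => /si ->.
Qed.
End Structural.

Lemma ent_tmor M N M' N' (f : mor M M') (g : mor N N') x y :
  ent (f ⊠ g) x y = ttens (ent f x.1 y.1) (ent g x.2 y.2).
Proof. by rewrite [LHS]ent_mk. Qed.

Lemma ptmor_linl M N M' N' (g : mor N N') : linear (fun f : mor M M' => f ⊠ g).
Proof.
move=> a u v; apply: ent_ext => x y; rewrite (ent_lin _ _ a) !ent_tmor.
by rewrite (ent_lin _ _ a) ttens_linl.
Qed.
Lemma ptmor_linr M N M' N' (f : mor M M') : linear (fun g : mor N N' => f ⊠ g).
Proof.
move=> a u v; apply: ent_ext => x y; rewrite (ent_lin _ _ a) !ent_tmor.
by rewrite (ent_lin _ _ a) ttens_linr.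
Qed.

Lemma pel_tmor M N M' N' m m' n n' (f : mor (@pl _ C M m) (@pl _ C M' m')) g
    (f' : mor (@pl _ C N n) (@pl _ C N' n')) g' :
  (pel m m' f g : mor M M') ⊠ (pel n n' f' g' : mor N N') =
  (@pel K C (M ⊗ N) (M' ⊗ N') (m, n) (m', n') (f ⊠ f') (g ⊠ g')).
Proof.
apply: ent_ext => -[x1 x2] [y1 y2]; rewrite ent_tmor /=.
have [<-|ne] := eqVneq m x1; last first.
  rewrite [ent (pel m _ _ _) _ _]ent_pel0 ?ne // ttens0l ent_pel0 //.
  by rewrite xpair_eqE (negPf ne).
have [<-|ne] := eqVneq n x2; last first.
  rewrite [ent (pel n _ _ _) _ _]ent_pel0 ?ne // ttens0r ent_pel0 //.
  by rewrite xpair_eqE (negPf ne) andbF.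
have [<-|ne] := eqVneq m' y1; last first.
  rewrite [ent (pel m _ _ _) _ _]ent_pel0 ?ne ?orbT // ttens0l ent_pel0 //.
  by rewrite orbC xpair_eqE (negPf ne).
have [<-|ne] := eqVneq n' y2; last first.
  rewrite [ent (pel n _ _ _) _ _]ent_pel0 ?ne ?orbT // ttens0r ent_pel0 //.
  by rewrite orbC xpair_eqE (negPf ne) andbF.
by rewrite !ent_pel ttens_pure.
Qed.

Lemma ent_palpha M N P m n p :
  ent (alpha M N P) (m, n, p) (m, (n, p)) = pure (alpha _ _ _) (alpha _ _ _).
Proof.
by rewrite [LHS]ent_mk !ent_pid !ttens_pure !tmor1 tcomp_idr.
Qed.
Lemma ent_palpha0 M N P (x : pidx (M ⊗ N ⊗ P)) (y : pidx (M ⊗ (N ⊗ P))) :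
  y != (x.1.1, (x.1.2, x.2)) -> ent (alpha M N P) x y = 0.
Proof.
case: x y => [[m n] p] [m' [n' p']] /= ne; rewrite [LHS]ent_mk /=.
move: ne; rewrite !xpair_eqE !negb_and => /or3P[] ne.
- by rewrite [ent _ m m']ent_pid0 1?eq_sym // !ttens0l tcomp0r.
- by rewrite [ent _ n n']ent_pid0 1?eq_sym // !(ttens0l, ttens0r) tcomp0r.
by rewrite [ent _ p p']ent_pid0 1?eq_sym // !(ttens0l, ttens0r) tcomp0r.
Qed.
Lemma ent_palphaV M N P m n p :
  ent (alphaV M N P) (m, (n, p)) (m, n, p) = pure (alphaV _ _ _) (alphaV _ _ _).
Proof.
by rewrite [LHS]ent_mk !ent_pid !ttens_pure !tmor1 tcomp_idr.
Qed.
Lemma ent_palphaV0 M N P (x : pidx (M ⊗ (N ⊗ P))) (y : pidx (M ⊗ N ⊗ P)) :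
  y != (x.1, x.2.1, x.2.2) -> ent (alphaV M N P) x y = 0.
Proof.
case: x y => [m [n p]] [[m' n'] p'] /= ne; rewrite [LHS]ent_mk /=.
move: ne; rewrite !xpair_eqE -!andbA !negb_and => /or3P[] ne.
- by rewrite [ent _ m m']ent_pid0 1?eq_sym // !ttens0l tcomp0r.
- by rewrite [ent _ n n']ent_pid0 1?eq_sym // !(ttens0l, ttens0r) tcomp0r.
by rewrite [ent _ p p']ent_pid0 1?eq_sym // !(ttens0l, ttens0r) tcomp0r.
Qed.
Lemma ent_plam M m : ent (lam M) (tt, m) m = pure (lam _) (lam _).
Proof. by rewrite [LHS]ent_mk ent_pid tcomp_idl. Qed.
Lemma ent_plam0 M (x : pidx (uob ⊗ M)) m : m != x.2 -> ent (lam M) x m = 0.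
Proof. by move=> ne; rewrite [LHS]ent_mk ent_pid0 1?eq_sym // tcomp0l. Qed.
Lemma ent_plamV M m : ent (lamV M) m (tt, m) = pure (lamV _) (lamV _).
Proof. by rewrite [LHS]ent_mk ent_pid tcomp_idr. Qed.
Lemma ent_plamV0 M m (x : pidx (uob ⊗ M)) : x != (tt, m) -> ent (lamV M) m x = 0.
Proof.
case: x => -[] n ne; rewrite [LHS]ent_mk ent_pid0 ?tcomp0r //.
by apply: contraNneq ne => ->.
Qed.
Lemma ent_prho M m : ent (rho M) (m, tt) m = pure (rho _) (rho _).
Proof. by rewrite [LHS]ent_mk ent_pid tcomp_idl. Qed.
Lemma ent_prho0 M (x : pidx (M ⊗ uob)) m : m != x.1 -> ent (rho M) x m = 0.
Proof. by move=> ne; rewrite [LHS]ent_mk ent_pid0 1?eq_sym // tcomp0l. Qed.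
Lemma ent_prhoV M m : ent (rhoV M) m (m, tt) = pure (rhoV _) (rhoV _).
Proof. by rewrite [LHS]ent_mk ent_pid tcomp_idr. Qed.
Lemma ent_prhoV0 M m (x : pidx (M ⊗ uob)) : x != (m, tt) -> ent (rhoV M) m x = 0.
Proof.
case: x => n [] ne; rewrite [LHS]ent_mk ent_pid0 ?tcomp0r //.
by apply: contraNneq ne => ->.
Qed.

Section StructuralInstances.
Variables (M N P Q : C2 C) (q : pidx Q).
Let sa (x : pidx (M ⊗ N ⊗ P)) : pidx (M ⊗ (N ⊗ P)) := (x.1.1, (x.1.2, x.2)).
Let sv (x : pidx (M ⊗ (N ⊗ P))) : pidx (M ⊗ N ⊗ P) := (x.1, x.2.1, x.2.2).
Let aa (x : pidx (M ⊗ N ⊗ P)) : mor (@pl _ C (M ⊗ N ⊗ P) x) (@pl _ C (M ⊗ (N ⊗ P)) (sa x)) :=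
  alpha (pl x.1.1) (pl x.1.2) (pl x.2).
Let ab (x : pidx (M ⊗ N ⊗ P)) : mor (@pr _ C (M ⊗ N ⊗ P) x) (@pr _ C (M ⊗ (N ⊗ P)) (sa x)) :=
  alpha (pr x.1.1) (pr x.1.2) (pr x.2).
Let va (x : pidx (M ⊗ (N ⊗ P))) : mor (@pl _ C (M ⊗ (N ⊗ P)) x) (@pl _ C (M ⊗ N ⊗ P) (sv x)) :=
  alphaV (pl x.1) (pl x.2.1) (pl x.2.2).
Let vb (x : pidx (M ⊗ (N ⊗ P))) : mor (@pr _ C (M ⊗ (N ⊗ P)) x) (@pr _ C (M ⊗ N ⊗ P) (sv x)) :=
  alphaV (pr x.1) (pr x.2.1) (pr x.2.2).

Let Fa x : ent (alpha M N P) x (sa x) = pure (aa x) (ab x).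
Proof. by case: x => -[m n] p; apply: ent_palpha. Qed.
Let Fv x : ent (alphaV M N P) x (sv x) = pure (va x) (vb x).
Proof. by case: x => m [n p]; apply: ent_palphaV. Qed.
Let sai : injective sa.
Proof. by move=> [[m n] p] [[m' n'] p'] [-> -> ->]. Qed.
Let svi : injective sv.
Proof. by move=> [m [n p]] [m' [n' p']] [-> -> ->]. Qed.

Lemma palpha_compl m n p (f : mor (pl q) (pl m ⊗ pl n ⊗ pl p))
    (g : mor (pr q) (pr m ⊗ pr n ⊗ pr p)) :
  alpha M N P ∘ (@pel _ _ Q (M ⊗ N ⊗ P) q (m, n, p) f g) =
  @pel _ _ Q (M ⊗ (N ⊗ P)) q (m, (n, p)) (alpha _ _ _ ∘ f) (alpha _ _ _ ∘ g).
Proof. exact: (structural_compl Fa (@ent_palpha0 M N P) (m := (m, n, p))). Qed.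
Lemma palpha_compr m n p (f : mor (pl m ⊗ (pl n ⊗ pl p)) (pl q))
    (g : mor (pr m ⊗ (pr n ⊗ pr p)) (pr q)) :
  (@pel _ _ (M ⊗ (N ⊗ P)) Q (m, (n, p)) q f g) ∘ alpha M N P =
  @pel _ _ (M ⊗ N ⊗ P) Q (m, n, p) q (f ∘ alpha _ _ _) (g ∘ alpha _ _ _).
Proof. exact: (structural_compr Fa (@ent_palpha0 M N P) (m := (m, n, p))). Qed.
Lemma palphaV_compl m n p (f : mor (pl q) (pl m ⊗ (pl n ⊗ pl p)))
    (g : mor (pr q) (pr m ⊗ (pr n ⊗ pr p))) :
  alphaV M N P ∘ (@pel _ _ Q (M ⊗ (N ⊗ P)) q (m, (n, p)) f g) =
  @pel _ _ Q (M ⊗ N ⊗ P) q (m, n, p) (alphaV _ _ _ ∘ f) (alphaV _ _ _ ∘ g).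
Proof. exact: (structural_compl Fv (@ent_palphaV0 M N P) (m := (m, (n, p)))). Qed.
End StructuralInstances.

Section StructuralUnits.
Variables (M Q : C2 C) (q : pidx Q).
Let Fl (x : pidx (uob ⊗ M)) :
  ent (lam M) x x.2 = pure (lam (pl x.2)) (lam (pr x.2)).
Proof. by case: x => -[] m; apply: ent_plam. Qed.
Let Fr (x : pidx (M ⊗ uob)) :
  ent (rho M) x x.1 = pure (rho (pl x.1)) (rho (pr x.1)).
Proof. by case: x => m []; apply: ent_prho. Qed.

Lemma plam_compl m (f : mor (pl q) (uob ⊗ pl m)) (g : mor (pr q) (uob ⊗ pr m)) :
  lam M ∘ (@pel _ _ Q (uob ⊗ M) q (tt, m) f g) = pel q m (lam _ ∘ f) (lam _ ∘ g).
Proof. exact: (structural_compl Fl (@ent_plam0 M) (m := (tt, m))). Qed.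
Lemma plam_compr m (f : mor (pl m) (pl q)) (g : mor (pr m) (pr q)) :
  pel m q f g ∘ lam M =
  @pel _ _ (uob ⊗ M) Q (tt, m) q (f ∘ lam _) (g ∘ lam _).
Proof.
apply: (structural_compr Fl (@ent_plam0 M) (m := (tt, m))).
by move=> [[] x] [[] y] /= ->.
Qed.
Lemma plamV_compl m (f : mor (pl q) (pl m)) (g : mor (pr q) (pr m)) :
  lamV M ∘ pel q m f g = @pel _ _ Q (uob ⊗ M) q (tt, m) (lamV _ ∘ f) (lamV _ ∘ g).
Proof. exact: (structural_compl (@ent_plamV M) (@ent_plamV0 M)). Qed.
Lemma prho_compl m (f : mor (pl q) (pl m ⊗ uob)) (g : mor (pr q) (pr m ⊗ uob)) :
  rho M ∘ (@pel _ _ Q (M ⊗ uob) q (m, tt) f g) = pel q m (rho _ ∘ f) (rho _ ∘ g).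
Proof. exact: (structural_compl Fr (@ent_prho0 M) (m := (m, tt))). Qed.
Lemma prho_compr m (f : mor (pl m) (pl q)) (g : mor (pr m) (pr q)) :
  pel m q f g ∘ rho M =
  @pel _ _ (M ⊗ uob) Q (m, tt) q (f ∘ rho _) (g ∘ rho _).
Proof.
apply: (structural_compr Fr (@ent_prho0 M) (m := (m, tt))).
by move=> [x []] [y []] /= ->.
Qed.
Lemma prhoV_compl m (f : mor (pl q) (pl m)) (g : mor (pr q) (pr m)) :
  rhoV M ∘ pel q m f g = @pel _ _ Q (M ⊗ uob) q (m, tt) (rhoV _ ∘ f) (rhoV _ ∘ g).
Proof. exact: (structural_compl (@ent_prhoV M) (@ent_prhoV0 M)). Qed.
End StructuralUnits.

(** [expand f] reads the goal as an equality of two linear functions of [f] and reduces it to single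
    entries by [mor_ext]; [lin] proves the linearity. *)
Ltac lin := by move=> ? ? ? /=; rewrite ?(pcomp_linl, pcomp_linr, ptmor_linl, ptmor_linr).
Ltac expand f := pattern f; match goal with
  | |- (fun x => @?L x = @?R x) _ => apply: (mor_ext (phi := L) (psi := R)); [lin | lin | ]
  end; clear f.

Lemma pel_tmor_comp (M N P Q M' N' : C2 C) (f : mor M M') (f' : mor M' P)
    (g : mor N N') (g' : mor N' Q) :
  (f' ∘ f) ⊠ (g' ∘ g) = (f' ⊠ g') ∘ (f ⊠ g).
Proof.
expand f => m n f f2.
expand f' => m' n' f' f2'.
expand g => p q g g2.
expand g' => p' q' g' g2'.
rewrite !pel_tmor.
have [e|ne] := eqVneq n m'; last first.
  by rewrite pel_comp0 // (lin0 (ptmor_linl _)) pel_comp0 // xpair_eqE (negPf ne).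
have [e'|ne] := eqVneq q p'; last first.
  by rewrite [X in _ ⊠ X]pel_comp0 // (lin0 (ptmor_linr _)) pel_comp0 // xpair_eqE (negPf ne) andbF.
by subst m' p'; rewrite !pel_comp pel_tmor !tmorC.
Qed.

Lemma pel_id_tmor M N m n :
  @pel K C (M ⊗ N) (M ⊗ N) (m, n) (m, n) (idm _) (idm _) =
  pel m m (idm _) (idm _) ⊠ pel n n (idm _) (idm _).
Proof. by rewrite pel_tmor !tmor1. Qed.
Lemma idm_unit_pel : idm (uob : C2 C) =
  @pel K C (uob : C2 C) (uob : C2 C) tt tt (idm _) (idm _).
Proof. by rewrite idm_pel (bigD1 tt) //= big1 ?addr0 // => -[]. Qed.

(** Inserting the identities of the summands [m] and [n] lets the structural lemmas act on [F] and
    [G] separately. *)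
Lemma tmor_compl_pel M N M' N' P (F : mor M M') (G : mor N N') p m n f g :
  (F ⊠ G) ∘ @pel K C P (M ⊗ N) p (m, n) f g =
  ((F ∘ pel m m (idm _) (idm _)) ⊠ (G ∘ pel n n (idm _) (idm _))) ∘
    @pel K C P (M ⊗ N) p (m, n) f g.
Proof. by rewrite pel_tmor_comp -pel_id_tmor -compA pel_comp !comp1m. Qed.

#[global] Instance C2_monoidal : monoidal_laws (C2 C).
Proof.
split.
- move=> M N; apply: pel_ext => -[m n].
  by rewrite comp1m pel_id_tmor -pel_tmor_comp !comp1m.
- by move=> *; apply: pel_tmor_comp.
- by move=> *; apply: ptmor_linl.
- by move=> *; apply: ptmor_linr.
- move=> M N P; split; apply: pel_ext.
    by move=> [[m n] p]; rewrite -compA palpha_compl palphaV_compl !compA !alphaK !comp1m.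
  by move=> [m [n p]]; rewrite -compA palphaV_compl palpha_compl !compA !alphaVK !comp1m.
- move=> M; split; apply: pel_ext.
    by move=> [[] m]; rewrite -compA plam_compl plamV_compl !compA !lamK !comp1m.
  by move=> m; rewrite -compA plamV_compl plam_compl !compA !lamVK !comp1m.
- move=> M; split; apply: pel_ext.
    by move=> [m []]; rewrite -compA prho_compl prhoV_compl !compA !rhoK !comp1m.
  by move=> m; rewrite -compA prhoV_compl prho_compl !compA !rhoVK !comp1m.
- move=> M M' N N' P P' f g h.
  expand f => m m' f f'; expand g => n n' g g'; expand h => p p' h h'.
  by rewrite !pel_tmor palpha_compl palpha_compr !alphaE.
- move=> M N f; expand f => m n f f'.
  rewrite idm_unit_pel pel_tmor.
  have E := @plam_compl N (uob ⊗ M) (tt, m) n (idm uob ⊠ f) (idm uob ⊠ f').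
  rewrite [LHS]E.
  by rewrite !lamE; apply: (esym (plam_compr f f')).
- move=> M N f; expand f => m n f f'.
  rewrite idm_unit_pel pel_tmor.
  have E := @prho_compl N (M ⊗ uob) (m, tt) n (f ⊠ idm uob) (f' ⊠ idm uob).
  rewrite [LHS]E.
  by rewrite !rhoE; apply: (esym (prho_compr f f')).
- move=> M N P Q; apply: pel_ext => -[[[m n] p] q].
  rewrite -compA !palpha_compl !compA !compm1 -compA.
  rewrite tmor_compl_pel palpha_compl comp1m pel_tmor pel_comp !compm1.
  rewrite -compA palpha_compl tmor_compl_pel palpha_compl comp1m pel_tmor pel_comp.
  by rewrite !compm1 !pentagonE !compA.
- move=> M N; apply: pel_ext => -[[m []] n].
  rewrite -compA palpha_compl [LHS]tmor_compl_pel [RHS]tmor_compl_pel.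
  rewrite (@plam_compl N (uob ⊗ N) (tt, n) n (idm _) (idm _)).
  rewrite (@prho_compl M (M ⊗ uob) (m, tt) m (idm _) (idm _)) !comp1m !compm1.
  rewrite !pel_tmor !pel_comp !compm1.
  by rewrite (triangleE (pl m) (pl n)) (triangleE (pr m) (pr n)).
Qed.

End ProductMonoidal.

(** * Semisimplicity *)

Existing Class modular_laws.
#[global] Instance modular_linear (K : fieldType) (C : modular_data K)
  (HC : modular_laws C) : linear_category_laws C := mod_linear HC.
#[global] Instance modular_monoidal (K : fieldType) (C : modular_data K)
  (HC : modular_laws C) : monoidal_laws C := mod_monoidal HC.

Section Semisimple.
Context {K : fieldType} {C : modular_data K} {HC : modular_laws C}.
Implicit Types U V W X : C.

Let HS := mod_semisimple HC.

Lemma proj_incl (J : finType) (F : J -> C) j : proj F j ∘ incl F j = idm _.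
Proof. exact: (proj_inj (has_biproducts (mod_abelian HC))). Qed.
Lemma proj_incl0 (J : finType) (F : J -> C) j k :
  j != k -> proj F k ∘ incl F j = 0.
Proof. exact: (proj_inj0 (has_biproducts (mod_abelian HC))). Qed.
Lemma sum_incl_proj (J : finType) (F : J -> C) :
  \sum_j incl F j ∘ proj F j = idm (bigsum F).
Proof. exact: (sum_inj_proj (has_biproducts (mod_abelian HC))). Qed.

Lemma kernel_mono U V X (f : mor U V) (k : mor X U) : is_kernel f k -> is_mono k.
Proof.
case=> fk H Y g h e; have [|t [_ tU]] := H Y (k ∘ g).
  by rewrite compA fk comp0l.
by rewrite -(tU g) // -(tU h).
Qed.

(** The kernel of [f] is zero or all of [U]; in the first case [f] is mono, hence zero or invertible
    because [V] is simple. *)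
Lemma schur U V (f : mor U V) :
  simple_object U -> simple_object V -> f = 0 \/ is_iso f.
Proof.
move=> [_ sU] [_ sV].
have [X [k kf]] := has_kernels (mod_abelian HC) f.
have [k0|[k' [_ kk']]] := sU _ _ (kernel_mono kf).
  apply/sV/mono_cancel => Y g fg; case: kf => _ /(_ Y g fg)[t [<- _]].
  by rewrite k0 comp0l.
by left; rewrite -[f]compm1 -kk' compA kf.1 comp0l.
Qed.

Lemma simp_simpleP i : simple_object (simp i : C).
Proof. exact: simp_simple. Qed.

Lemma schur0 i j (f : mor (simp i : C) (simp j)) : i != j -> f = 0.
Proof.
move=> ne; case: (schur f (simp_simpleP i) (simp_simpleP j)) => // fi.
have e : i = j by apply: (simp_inj HS); exists f.
by rewrite e eqxx in ne.
Qed.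

Lemma sbas_sdbas V i a b : sbas V i a ∘ sdbas V i b = (a == b)%:R *: idm (simp i).
Proof. exact: (sbas_dual HS). Qed.

Lemma sbas_sdbas0 V i j a b : i != j -> sbas V i a ∘ sdbas V j b = 0.
Proof. by move=> ne; apply: schur0; rewrite eq_sym. Qed.

Lemma basis_decomp (V : vectType K) n (F : 'I_n -> V) :
  basis_of fullv (codom F) -> forall v, exists c : 'I_n -> K, v = \sum_a c a *: F a.
Proof.
move=> bF v; have sz : size (codom F) == n by rewrite size_codom card_ord.
have bF' : basis_of fullv (Tuple sz) by [].
have vF := coord_basis bF' (memvf v).
exists (fun a => coord (Tuple sz) a v); rewrite {1}vF; apply: eq_bigr => a _.
congr (_ *: _); rewrite (nth_map a) ?size_enum_ord //.
by rewrite nth_ord_enum.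
Qed.

Lemma sbas_decomp V i (g : mor V (simp i)) :
  exists c, g = \sum_a c a *: sbas V i a.
Proof. exact: basis_decomp (sbas_basis HS V i) g. Qed.
Lemma sdbas_decomp V i (g : mor (simp i) V) :
  exists c, g = \sum_a c a *: sdbas V i a.
Proof. exact: basis_decomp (sdbas_basis HS V i) g. Qed.

Definition isotypic V : mor V V := \sum_i \sum_a sdbas V i a ∘ sbas V i a.

Lemma isotypic_sdbas V i b : isotypic V ∘ sdbas V i b = sdbas V i b.
Proof.
rewrite comp_suml (bigD1 i) //= comp_suml (bigD1 b) //= -compA sbas_sdbas eqxx.
rewrite scale1r compm1 !big1 ?addr0 // => [j ne | a ne].
  by rewrite comp_suml big1 // => a _; rewrite -compA sbas_sdbas0 ?comp0r.
by rewrite -compA sbas_sdbas (negPf ne) scale0r comp0r.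
Qed.

(** The sum fixes every morphism from a simple object into [V], by the duality of the bases, and the
    identity of [V] is a sum of composites through simple objects. *)
Lemma completeness V : \sum_i \sum_a sdbas V i a ∘ sbas V i a = idm V.
Proof.
rewrite -/(isotypic V).
have P_simp i (q : mor (simp i) V) : isotypic V ∘ q = q.
  have [c ->] := sdbas_decomp q; rewrite comp_sumr; apply: eq_bigr => a _.
  by rewrite compZr isotypic_sdbas.
have [J [F [sF [f [g [gf fg]]]]]] := semisimple HS V.
have P_F j (q : mor (F j) V) : isotypic V ∘ q = q.
  have [i [h [h' [h'h _]]]] := simp_surj HS (sF j).
  by rewrite -[q]compm1 -h'h (compA h) compA P_simp.
rewrite -[LHS]compm1 -gf -[g]compm1 -sum_incl_proj comp_sumr comp_suml comp_sumr.
apply: eq_bigr => j _; rewrite !compA -(compA _ g) P_F //.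
Qed.

Lemma idm_simp_neq0 i : idm (simp i : C) != 0.
Proof. by apply/eqP; case: (simp_simpleP i). Qed.

(** The field need not be algebraically closed, so Schur's lemma alone is not enough. The dual bases
    do the rest: for indices [a != b] the nonzero [sdbas b] is invertible, so [sbas a ∘ sdbas b = 0]
    forces [sbas a = 0], against [sbas a ∘ sdbas a = idm]. Hence the endomorphisms of [simp i] form
    a line. *)
Lemma simple_scalar U (f : mor U U) : simple_object U -> exists c, f = c *: idm U.
Proof.
move=> sU; have [i [h [h' [h'h hh']]]] := simp_surj HS sU.
suff [c e] : exists c, h ∘ f ∘ h' = c *: idm (simp i).
  have fE : f = h' ∘ (h ∘ f ∘ h') ∘ h by rewrite !compA h'h comp1m -compA h'h compm1.
  by exists c; rewrite {1}fE e compZr compm1 compZl h'h.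
move: (h ∘ f ∘ h') => {f h h' h'h hh'} f.
have uniq1 (a b : 'I_(\dim {: mor (simp i : C) (simp i)})) : a = b.
  apply/eqP; apply: contraT => ab.
  have ne c : sdbas (simp i : C) i c = 0 -> False.
    move=> e0; have := sbas_sdbas (V:=simp i) c c; rewrite e0 comp0r eqxx scale1r.
    by move/esym/eqP; rewrite (negPf (idm_simp_neq0 i)).
  have [/ne//|[g [_ eg]]] := schur (sdbas (simp i : C) i b) (simp_simpleP i) (simp_simpleP i).
  have ea : sbas (simp i : C) i a = 0.
    rewrite -[LHS]compm1 -eg compA sbas_sdbas (negPf ab) scale0r comp0l //.
  have := sbas_sdbas (V:=simp i) a a; rewrite ea comp0l eqxx scale1r.
  by move/esym/eqP; rewrite (negPf (idm_simp_neq0 i)).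
have [c ec] := sbas_decomp (idm (simp i : C)).
have [d ed] := sbas_decomp f.
have [a0 a0P|no] := pickP (fun a : 'I_(\dim {: mor (simp i : C) (simp i)}) => true); last first.
  by case/eqP: (idm_simp_neq0 i); rewrite ec big1 // => a; have := no a.
have single (G : 'I_(\dim {: mor (simp i : C) (simp i)}) -> mor (simp i : C) (simp i)) :
    \sum_a G a = G a0.
  by rewrite (bigD1 a0) //= big1 ?addr0 // => a; rewrite (uniq1 a a0) eqxx.
rewrite single in ec; rewrite single in ed.
have c0 : c a0 != 0.
  by apply: contraNneq (idm_simp_neq0 i) => e; rewrite ec e scale0r.
by exists (d a0 / c a0); rewrite ec ed scalerA divfK.
Qed.

Lemma unit_scalar (f : mor (uob : C) uob) : f = scal f *: idm uob.
Proof.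
have [c ->] := simple_scalar f (mod_one HC).
have fr : free [tuple idm (uob : C)].
  by rewrite /= seq1_free; apply/eqP; case: (mod_one HC).
rewrite /scal linearZ /=.
by have := coord_free ord0 ord0 fr; rewrite /= => ->; rewrite mulr1.
Qed.

Lemma scal_id c : scal (c *: idm (uob : C)) = c.
Proof.
have := unit_scalar (c *: idm uob); move: (scal _) => d /esym/eqP.
rewrite -subr_eq0 -scalerBl scaler_eq0 subr_eq0 => /orP[/eqP//|/eqP e].
by case: (mod_one HC).
Qed.

Section Matrices.
(** A morphism acts on the multiplicity space of each [simp i]. [X] is the matrix of this action in
    the dual bases, so that composition becomes the product of matrices. *)
Definition blockmor V W i
    (X : 'M[K]_(\dim {: mor W (simp i)}, \dim {: mor V (simp i)})) : mor V W :=
  \sum_b \sum_a X b a *: (sdbas W i b ∘ sbas V i a).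

Lemma blockmor_comp U V W i (X : 'M_(_, _)) (Y : 'M_(_, _)) :
  @blockmor V W i X ∘ @blockmor U V i Y = @blockmor U W i (X *m Y).
Proof.
rewrite /blockmor comp_suml; apply: eq_bigr => b _; rewrite comp_suml.
under [RHS]eq_bigr => a _ do rewrite mxE scaler_suml.
rewrite [RHS]exchange_big; apply: eq_bigr => c _ /=.
rewrite comp_sumr (bigD1 c) //= [X in _ + X]big1 => [|d ne]; last first.
  rewrite comp_sumr big1 // => a _; rewrite compZl compZr -compA (compA _ (sdbas _ _ _)).
  by rewrite sbas_sdbas eq_sym (negPf ne) scale0r comp0l comp0r !scaler0.
rewrite addr0 comp_sumr; apply: eq_bigr => a _.
rewrite compZl compZr -compA (compA _ (sdbas _ _ _)) sbas_sdbas eqxx scale1r comp1m.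
by rewrite scalerA.
Qed.

Lemma blockmor_comp0 U V W i j (X : 'M_(_, _)) (Y : 'M_(_, _)) :
  i != j -> @blockmor V W i X ∘ @blockmor U V j Y = 0.
Proof.
move=> ne; rewrite /blockmor comp_suml big1 // => b _; rewrite comp_suml big1 // => c _.
rewrite comp_sumr big1 // => d _; rewrite comp_sumr big1 // => a _.
by rewrite compZl compZr -compA (compA _ (sdbas _ _ _)) sbas_sdbas0 // comp0l comp0r !scaler0.
Qed.

Lemma blockmor_decomp V W (f : mor V W) : exists Z : (forall i, 'M_(_, _)), f = \sum_i @blockmor V W i (Z i).
Proof.
have H i b a : exists c : K, sbas W i b ∘ f ∘ sdbas V i a = c *: idm (simp i).
  exact: simple_scalar (simp_simpleP i).
have /fin_all_exists[X XP] i : exists Xi : 'M[K]_(\dim {: mor W (simp i)}, \dim {: mor V (simp i)}),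
    forall b a, sbas W i b ∘ f ∘ sdbas V i a = Xi b a *: idm (simp i).
  have /fin_all_exists[F FP] b : exists Fb, forall a, sbas W i b ∘ f ∘ sdbas V i a = Fb a *: idm (simp i).
    exact: fin_all_exists (H i b).
  by exists (\matrix_(b, a) F b a) => b a; rewrite mxE.
exists X; rewrite -[f]comp1m -[idm W]completeness comp_suml; apply: eq_bigr => i _.
rewrite comp_suml; apply: eq_bigr => b _.
rewrite -[LHS]compm1 -[idm V]completeness comp_sumr (bigD1 i) //=.
rewrite [X in _ + X]big1 => [|j ne]; last first.
  rewrite comp_sumr big1 // => a _; rewrite !compA.
  have e : sbas W i b ∘ f ∘ sdbas V j a = 0 by apply: schur0.
  by rewrite (compE3 _ e) comp0r comp0l.
rewrite addr0 comp_sumr; apply: eq_bigr => a _; rewrite !compA.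
by rewrite (compE3 _ (XP i b a)) compZr compm1 compZl.
Qed.

(** Each block has the generalized inverse [pinvmx], with [X *m pinvmx X *m X = X]. The splitting of
    monomorphisms and of images follows from this alone. *)
Lemma von_neumann_regular V W (f : mor V W) : exists s, f ∘ s ∘ f = f.
Proof.
have [X ->] := blockmor_decomp f.
exists (\sum_i @blockmor W V i (pinvmx (X i))).
have mulsum U V' W' (F : forall i, _) (G : forall i, _) :
   (\sum_i @blockmor V' W' i (F i)) ∘ (\sum_i @blockmor U V' i (G i)) =
   \sum_i @blockmor U W' i (F i *m G i).
  rewrite comp_suml; apply: eq_bigr => i _; rewrite comp_sumr (bigD1 i) //=.
  rewrite blockmor_comp big1 ?addr0 // => j ne.
  by rewrite blockmor_comp0 // eq_sym.
by rewrite !mulsum; apply: eq_bigr => i _; rewrite mulmxKpV.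
Qed.
End Matrices.

Lemma mono_split V W (f : mor V W) : is_mono f -> exists s, s ∘ f = idm V.
Proof.
move=> fm; have [s e] := von_neumann_regular f; exists s.
by apply: fm; rewrite compA e compm1.
Qed.

(** With [f ∘ s ∘ f = f], the idempotent [f ∘ s] has the image of [f], and the kernel of
    [idm W - f ∘ s] splits it. *)
Lemma image_split V W (f : mor V W) :
  exists I (i : mor I W) (p : mor W I) (s : mor W V),
    [/\ p ∘ i = idm I, i ∘ p ∘ f = f & i ∘ p = f ∘ s].
Proof.
have [s e] := von_neumann_regular f.
have [I [k [k0 kU]]] := has_kernels (mod_abelian HC) (idm W - f ∘ s).
have km : is_mono k by apply: (kernel_mono (f := idm W - f ∘ s)); split.
have [|p [kp _]] := kU _ (f ∘ s).
  by rewrite compDl compNl comp1m compA e subrr.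
exists I, k, p, s; split=> //; last by rewrite kp.
apply: km; rewrite compA kp compm1.
by move/eqP: k0; rewrite compDl compNl comp1m subr_eq0 => /eqP.
Qed.

End Semisimple.

(** * Ribbon calculus *)

Section Tails.
Context {K : fieldType} {D : mcat K}.
Context {HL : linear_category_laws D} {HM : monoidal_laws D}.
Implicit Types U V W X Y Z : D.

(* The strands of a string diagram are tensored up from the right, onto a last
   object [Z]; a morphism acts on the leftmost strands, and no associator shows. *)
Definition t20 U V (e : mor (U ⊗ V) uob) Z : mor (U ⊗ (V ⊗ Z)) Z :=
  locked (lam Z ∘ (e ⊠ idm Z) ∘ alphaV U V Z).
Definition t02 U V (b : mor uob (U ⊗ V)) Z : mor Z (U ⊗ (V ⊗ Z)) :=
  locked (alpha U V Z ∘ (b ⊠ idm Z) ∘ lamV Z).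
Definition t22 U V U' V' (c : mor (U ⊗ V) (U' ⊗ V')) Z :
    mor (U ⊗ (V ⊗ Z)) (U' ⊗ (V' ⊗ Z)) :=
  locked (alpha U' V' Z ∘ (c ⊠ idm Z) ∘ alphaV U V Z).

Lemma t20E U V (e : mor (U ⊗ V) uob) Z :
  t20 e Z = lam Z ∘ (e ⊠ idm Z) ∘ alphaV U V Z.
Proof. by rewrite /t20 -lock. Qed.
Lemma t02E U V (b : mor uob (U ⊗ V)) Z :
  t02 b Z = alpha U V Z ∘ (b ⊠ idm Z) ∘ lamV Z.
Proof. by rewrite /t02 -lock. Qed.
Lemma t22E U V U' V' (c : mor (U ⊗ V) (U' ⊗ V')) Z :
  t22 c Z = alpha U' V' Z ∘ (c ⊠ idm Z) ∘ alphaV U V Z.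
Proof. by rewrite /t22 -lock. Qed.

Lemma t20_nat U V (e : mor (U ⊗ V) uob) Z Z' (h : mor Z Z') :
  t20 e Z' ∘ (idm U ⊠ (idm V ⊠ h)) = h ∘ t20 e Z.
Proof.
rewrite !t20E !compA (compE2 _ (alphaVEr _ _ _)) (compE2 _ (tmor_exch _ _)).
by rewrite lamE.
Qed.
Lemma t02_nat U V (b : mor uob (U ⊗ V)) Z Z' (h : mor Z Z') :
  (idm U ⊠ (idm V ⊠ h)) ∘ t02 b Z = t02 b Z' ∘ h.
Proof.
rewrite !t02E !compA -alphaEr (compE2 _ (tmor_exchV _ _)).
by rewrite (compE2 _ (lamVE _)).
Qed.
Lemma t22_nat U V U' V' (c : mor (U ⊗ V) (U' ⊗ V')) Z Z' (h : mor Z Z') :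
  t22 c Z' ∘ (idm U ⊠ (idm V ⊠ h)) = (idm U' ⊠ (idm V' ⊠ h)) ∘ t22 c Z.
Proof.
rewrite !t22E !compA (compE2 _ (alphaVEr _ _ _)) (compE2 _ (tmor_exch _ _)).
by rewrite alphaEr.
Qed.

Lemma t20_comp U V U' V' (e : mor (U ⊗ V) uob) (f : mor U' U) (g : mor V' V) Z :
  t20 (e ∘ (f ⊠ g)) Z = t20 e Z ∘ (f ⊠ (g ⊠ idm Z)).
Proof. by rewrite !t20E tmorCl -!compA alphaVE. Qed.
Lemma t02_comp U V U' V' (b : mor uob (U ⊗ V)) (f : mor U U') (g : mor V V') Z :
  t02 ((f ⊠ g) ∘ b) Z = (f ⊠ (g ⊠ idm Z)) ∘ t02 b Z.
Proof. by rewrite !t02E tmorCl !compA alphaE. Qed.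
Lemma t20_t22 U V U' V' (e : mor (U' ⊗ V') uob) (c : mor (U ⊗ V) (U' ⊗ V')) Z :
  t20 (e ∘ c) Z = t20 e Z ∘ t22 c Z.
Proof. by rewrite !t20E !t22E !compA (compK _ (alphaK _ _ _)) tmorCl !compA. Qed.
Lemma t22_t02 U V U' V' (b : mor uob (U ⊗ V)) (c : mor (U ⊗ V) (U' ⊗ V')) Z :
  t02 (c ∘ b) Z = t22 c Z ∘ t02 b Z.
Proof. by rewrite !t02E !t22E !compA (compK _ (alphaK _ _ _)) tmorCl !compA. Qed.
Lemma t22_t22 U V U' V' U'' V'' (c : mor (U ⊗ V) (U' ⊗ V'))
    (c' : mor (U' ⊗ V') (U'' ⊗ V'')) Z :
  t22 (c' ∘ c) Z = t22 c' Z ∘ t22 c Z.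
Proof. by rewrite !t22E !compA (compK _ (alphaK _ _ _)) tmorCl !compA. Qed.
Lemma t22_id U V Z : t22 (idm (U ⊗ V)) Z = idm _.
Proof. by rewrite !t22E tmor1 compm1 alphaVK. Qed.
Lemma t22_tmor U V U' V' (f : mor U U') (g : mor V V') Z :
  t22 (f ⊠ g) Z = f ⊠ (g ⊠ idm Z).
Proof. by rewrite !t22E alphaE (compK _ (alphaVK _ _ _)). Qed.

Lemma t20_tail U V (e : mor (U ⊗ V) uob) Y Z :
  t20 e Y ⊠ idm Z = t20 e (Y ⊗ Z) ∘ (idm U ⊠ alpha V Y Z) ∘ alpha U (V ⊗ Y) Z.
Proof.
rewrite !t20E !tmorCl -lam_tob (compE2 _ (alphaEl _ _ _)) -!compA.
by do 2 congr (_ ∘ _); rewrite compA pentagonM.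
Qed.
Lemma t02_tail U V (b : mor uob (U ⊗ V)) Y Z :
  t02 b Y ⊠ idm Z = alphaV U (V ⊗ Y) Z ∘ (idm U ⊠ alphaV V Y Z) ∘ t02 b (Y ⊗ Z).
Proof.
rewrite !t02E !tmorCl !compA -pentagonV -lam_tobV !compA.
by rewrite (compE2 _ (esym (alphaVEl _ _ _))).
Qed.

Lemma t20_unit U V (e : mor (U ⊗ V) uob) : t20 e uob = e ∘ (idm U ⊠ rho V).
Proof.
by rewrite !t20E lam_rho_unit rhoE rho_tob !compA (compK _ (alphaVK _ _ _)).
Qed.
Lemma t02_unit U V (b : mor uob (U ⊗ V)) : t02 b uob = (idm U ⊠ rhoV V) ∘ b.
Proof.
rewrite !t02E; have -> : lamV (uob : D) = rhoV uob.
  by apply: (retract_mono (lamK uob)); rewrite lamVK lam_rho_unit rhoVK.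
by rewrite -compA rhoVE compA rho_tobV !compA alphaVK comp1m.
Qed.
Lemma t20_inj U V (e e' : mor (U ⊗ V) uob) : t20 e uob = t20 e' uob -> e = e'.
Proof.
by rewrite !t20_unit => /(section_epi (tmor_invr U (rhoVK V))).
Qed.
Lemma t02_inj U V (b b' : mor uob (U ⊗ V)) : t02 b uob = t02 b' uob -> b = b'.
Proof.
by rewrite !t02_unit => /(retract_mono (tmor_invr U (rhoVK V))).
Qed.

Lemma t20_t02 U V (e : mor (U ⊗ V) uob) (b : mor uob (U ⊗ V)) c Z :
  e ∘ b = c *: idm uob -> t20 e Z ∘ t02 b Z = c *: idm Z.
Proof.
move=> eb; rewrite !t20E !t02E !compA (compK _ (alphaK _ _ _)).
by rewrite (compE _ (tmorClV _ _ _)) eb tmorZl compZr compZl tmor1 compm1 lamVK.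
Qed.
End Tails.

(** * Crossings, and the moves that slide strands across them *)

Section Braiding.
Context {K : fieldType} {C : modular_data K} {HC : modular_laws C}.
Implicit Types U V W X Y Z : C.
Let HR := mod_ribbon HC.

Definition br U V Z := t22 (braid U V) Z.
Definition brV U V Z := t22 (braidV U V) Z.

Lemma braidK U V : braidV U V ∘ braid U V = idm (U ⊗ V : C).
Proof. by case: (braid_inv HR U V). Qed.
Lemma braidVK U V : braid U V ∘ braidV U V = idm (V ⊗ U : C).
Proof. by case: (braid_inv HR U V). Qed.
Lemma braidE U U' V V' (f : mor U U') (g : mor V V') :
  braid U' V' ∘ (f ⊠ g) = (g ⊠ f) ∘ braid U V.
Proof. exact: braid_nat. Qed.

Lemma brK U V Z : brV U V Z ∘ br U V Z = idm _.
Proof. by rewrite /br /brV -t22_t22 braidK t22_id. Qed.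
Lemma brVK U V Z : br U V Z ∘ brV U V Z = idm _.
Proof. by rewrite /br /brV -t22_t22 braidVK t22_id. Qed.
Lemma brE U U' V V' Z (f : mor U U') (g : mor V V') :
  br U' V' Z ∘ (f ⊠ (g ⊠ idm Z)) = (g ⊠ (f ⊠ idm Z)) ∘ br U V Z.
Proof. by rewrite /br -!t22_tmor -!t22_t22 braidE. Qed.
Lemma br_nat U V Z Z' (h : mor Z Z') :
  br U V Z' ∘ (idm U ⊠ (idm V ⊠ h)) = (idm V ⊠ (idm U ⊠ h)) ∘ br U V Z.
Proof. exact: t22_nat. Qed.
Lemma brEl U U' V Z (f : mor U U') :
  br U' V Z ∘ (f ⊠ idm (V ⊗ Z)) = (idm V ⊠ (f ⊠ idm Z)) ∘ br U V Z.
Proof. by rewrite -brE tmor1. Qed.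
Lemma brEr U V V' Z (g : mor V V') :
  br U V' Z ∘ (idm U ⊠ (g ⊠ idm Z)) = (g ⊠ idm (U ⊗ Z)) ∘ br U V Z.
Proof. by rewrite brE tmor1. Qed.

Lemma hexagonR U V W Z :
  (idm V ⊠ br U W Z) ∘ br U V (W ⊗ Z) ∘ (idm U ⊠ alpha V W Z) =
  alpha V W (U ⊗ Z) ∘ br U (V ⊗ W) Z.
Proof.
have H := hexagon1 HR U V W.
apply: (section_epi (alphaVK U (V ⊗ W) Z)).
apply: (section_epi (tmor_invl Z (alphaVK U V W))).
have -> : alpha V W (U ⊗ Z) ∘ br U (V ⊗ W) Z ∘ alpha U (V ⊗ W) Z ∘ (alpha U V W ⊠ idm Z) =
   (idm V ⊠ alpha W U Z) ∘ alpha V (W ⊗ U) Z ∘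
     ((alpha V W U ∘ braid U (V ⊗ W) ∘ alpha U V W) ⊠ idm Z).
  rewrite /br !t22E !tmorCl !compA (compK _ (alphaK _ _ _)) pentagonE.
  by rewrite -!compA.
rewrite H !tmorCl !compA (compE2 _ (alphaE _ _ _)) /br !t22E !tmorCr !compA.
rewrite (compE3 _ (pentagonM U V W Z)) !compA.
rewrite (compK _ (tmor_invl Z (alphaK U V W))) (compE2 _ (esym (alphaEl _ _ _))).
rewrite (compE _ (pentagonE V U W Z)) !compA.
by rewrite (compK _ (tmor_invr V (alphaK U W Z))).
Qed.

Lemma hexagonL U V W Z :
  br U W (V ⊗ Z) ∘ (idm U ⊠ br V W Z) ∘ alpha U V (W ⊗ Z) =
  (idm W ⊠ alpha U V Z) ∘ br (U ⊗ V) W Z.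
Proof.
have H := hexagon2 HR U V W.
apply: (section_epi (alphaVK (U ⊗ V) W Z)).
apply: (section_epi (tmor_invl Z (alphaK U V W))).
apply: (retract_mono (alphaVK W U (V ⊗ Z))).
have -> : alphaV W U (V ⊗ Z) ∘ ((idm W ⊠ alpha U V Z) ∘ br (U ⊗ V) W Z ∘
      alpha (U ⊗ V) W Z ∘ (alphaV U V W ⊠ idm Z)) =
   alpha (W ⊗ U) V Z ∘
     ((alphaV W U V ∘ braid (U ⊗ V) W ∘ alphaV U V W) ⊠ idm Z).
  rewrite /br !t22E !tmorCl !compA (compK _ (alphaK _ _ _)).
  by rewrite pentagonM.
rewrite H !tmorCl !compA (alphaE _ _ _).
rewrite (compE _ (pentagonE U V W Z)) !compA.
rewrite /br !t22E !tmorCr !compA alphaK comp1m (compK _ (tmor_invl Z (alphaVK U V W))).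
rewrite (compK _ (tmor_invr U (alphaK V W Z))) (compE2 _ (esym (alphaE _ _ _))).
by rewrite (compE3 _ (pentagonM U W V Z)) !compA tmor1.
Qed.

(** The hexagon for [uob ⊗ uob] writes one braiding with the unit as two, of which one cancels. This
    needs a tail [uob ⊗ Y]; naturality along [lamV Z] then reaches every tail. *)
Lemma br_unitr U Z : lam (U ⊗ Z) ∘ br U uob Z = idm U ⊠ lam Z.
Proof.
have H Y : idm U ⊠ lam (uob ⊗ Y) = lam (U ⊗ (uob ⊗ Y)) ∘ br U uob (uob ⊗ Y).
  apply: (section_epi (tmor_invr U (alphaVK uob uob Y))).
  apply: (retract_mono (brK U uob Y)).
  rewrite (tmorCrV U (alpha uob uob Y)) lam_tob brEr -lam_tob.
  by rewrite -compA -hexagonR !compA lamE.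
apply: (section_epi (tmor_invr U (tmor_invr uob (lamVK Z)))).
rewrite -compA br_nat compA lamE -compA.
by rewrite -H !tmorCrV lamE.
Qed.
Lemma br_unitl W Z : (idm W ⊠ lam Z) ∘ br uob W Z = lam (W ⊗ Z).
Proof.
have H Y : lam (W ⊗ (uob ⊗ Y)) = (idm W ⊠ lam (uob ⊗ Y)) ∘ br uob W (uob ⊗ Y).
  apply: (section_epi (tmor_invr uob (brVK uob W Y))).
  apply: (section_epi (alphaVK uob uob (W ⊗ Y))).
  rewrite lamE -!compA lam_tob brEl -(lam_tob uob Y) tmorCr -compA -hexagonL.
  by rewrite !compA.
apply: (section_epi (tmor_invr uob (tmor_invr W (lamVK Z)))).
by rewrite -compA br_nat compA tmorCrV lamE tmorCr -compA -H lamE.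
Qed.

Lemma br_unitrV U Z : br U uob Z ∘ (idm U ⊠ lamV Z) = lamV (U ⊗ Z).
Proof.
apply: (retract_mono (lamK (U ⊗ Z))).
by rewrite compA br_unitr lamVK (tmor_invr U (lamVK Z)).
Qed.
Lemma br_unitlV W Z : br uob W Z ∘ lamV (W ⊗ Z) = idm W ⊠ lamV Z.
Proof.
apply: (retract_mono (tmor_invr W (lamK Z))).
by rewrite compA br_unitl lamVK (tmor_invr W (lamVK Z)).
Qed.

(** The hexagon merges the two crossings into one with [U ⊗ V]; naturality moves it past [e], where
    it becomes a braiding with the unit and disappears. The other slides are variants of this. *)
Lemma cap_slide U V W (e : mor (U ⊗ V) uob) Z :
  t20 e (W ⊗ Z) ∘ (idm U ⊠ br W V Z) ∘ br W U (V ⊗ Z) = idm W ⊠ t20 e Z.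
Proof.
apply: (section_epi (tmor_invr W (alphaVK U V Z))).
rewrite (compE3 _ (hexagonR W U V Z)) !t20E !compA (compK _ (alphaK _ _ _)).
rewrite (compE2 _ (esym (brEr _ _ _))) br_unitr !tmorCr.
by rewrite (compK _ (tmor_invr W (alphaK _ _ _))).
Qed.
Lemma cap_slideV U V W (e : mor (U ⊗ V) uob) Z :
  (idm W ⊠ t20 e Z) ∘ br U W (V ⊗ Z) ∘ (idm U ⊠ br V W Z) = t20 e (W ⊗ Z).
Proof.
apply: (section_epi (alphaVK U V (W ⊗ Z))).
rewrite (compE3 _ (hexagonL U V W Z)) !t20E !tmorCr !compA.
rewrite (compK _ (tmor_invr W (alphaK _ _ _))).
rewrite (compE2 _ (esym (brEl _ _ _))).
by rewrite br_unitl (compK _ (alphaK _ _ _)).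
Qed.
Lemma cup_slide U V W (b : mor uob (U ⊗ V)) Z :
  (idm U ⊠ br W V Z) ∘ br W U (V ⊗ Z) ∘ (idm W ⊠ t02 b Z) = t02 b (W ⊗ Z).
Proof.
rewrite !t02E !tmorCr !compA hexagonR (compE2 _ (brEr _ _ _)).
by rewrite (compE _ (br_unitrV W Z)).
Qed.
Lemma cup_slideV U V W (b : mor uob (U ⊗ V)) Z :
  br U W (V ⊗ Z) ∘ (idm U ⊠ br V W Z) ∘ t02 b (W ⊗ Z) = idm W ⊠ t02 b Z.
Proof.
rewrite !t02E !tmorCr !compA hexagonL (compE2 _ (brEl _ _ _)).
by rewrite (compE _ (br_unitlV W Z)).
Qed.
Lemma t22_slide U V U' V' W (f : mor (U ⊗ V) (U' ⊗ V')) Z :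
  t22 f (W ⊗ Z) ∘ (idm U ⊠ br W V Z) ∘ br W U (V ⊗ Z) =
  (idm U' ⊠ br W V' Z) ∘ br W U' (V' ⊗ Z) ∘ (idm W ⊠ t22 f Z).
Proof.
apply: (section_epi (tmor_invr W (alphaVK U V Z))).
rewrite (compE3 _ (hexagonR W U V Z)) !t22E !tmorCr !compA hexagonR.
rewrite (compK _ (alphaK _ _ _)) (compK _ (tmor_invr W (alphaK _ _ _))).
by rewrite (compE2 _ (brEr _ _ _)).
Qed.

Lemma twistE U V (f : mor U V) : twist V ∘ f = f ∘ twist U.
Proof. exact: twist_nat. Qed.

Lemma braid_unit : braid uob uob = idm (uob ⊗ uob : C).
Proof.
apply: tmor_unitI; rewrite tmor1.
have -> : braid uob uob ⊠ idm uob =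
    alphaV uob uob uob ∘ br uob uob uob ∘ alpha (uob : C) uob uob.
  by rewrite /br t22E !compA alphaK comp1m (compK _ (alphaK _ _ _)).
have -> : br uob uob uob = idm (uob ⊗ (uob ⊗ uob) : C).
  apply: (retract_mono (lamK (uob ⊗ uob))); rewrite br_unitr compm1.
  by apply: (retract_mono (lamK uob)); rewrite lamE.
by rewrite compm1 alphaK.
Qed.

(** The twist of the unit is a scalar [t]; the tensor law gives [t * t = t], and [t] is nonzero
    because the twist is invertible. *)
Lemma twist_unit : twist (uob : C) = idm uob.
Proof.
have id0 : idm (uob : C) != 0 by apply/eqP; case: (mod_one HC).
have [t tE] := simple_scalar (twist (uob : C)) (mod_one HC).
have : lam uob ∘ twist (uob ⊗ uob) ∘ lamV (uob : C) = twist uob ∘ lam uob ∘ lamV uob.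
  by rewrite twistE.
rewrite (twist_tensor HR) braid_unit !comp1m tE tmorZl tmorZr tmor1 scalerA.
rewrite compZr compm1 !compZl comp1m lamVK => /eqP.
rewrite -subr_eq0 -scalerBl scaler_eq0 (negPf id0) orbF.
rewrite -[X in _ - X]mulr1 -mulrBr mulf_eq0 subr_eq0 => /orP[/eqP t0|/eqP ->]; last by rewrite scale1r.
have [g [gt _]] := twist_iso HR (uob : C).
by case/eqP: id0; rewrite -gt tE t0 scale0r comp0r.
Qed.
End Braiding.

(** * Dual pairs, transposes and traces *)

Section DualPairs.
Context {K : fieldType} {D : mcat K}.
Context {HL : linear_category_laws D} {HM : monoidal_laws D}.
Implicit Types U V W X Y Z : D.

(** Duals other than [dualob] are needed: [dd Q ⊗ dd P] for a tensor product ([nest]), and [U]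
    itself for [dualob U] ([opp_pair]). No comparison with the chosen dual is made, since traces
    will not depend on the pair. The zigzags carry a tail, as all diagrams do. *)
Record dpair X := DPair {
  dd : D;
  de : mor (dd ⊗ X) uob;
  db : mor uob (X ⊗ dd);
  dz1 : forall Z, (idm X ⊠ t20 de Z) ∘ t02 db (X ⊗ Z) = idm (X ⊗ Z);
  dz2 : forall Z, t20 de (dd ⊗ Z) ∘ (idm dd ⊠ t02 db Z) = idm (dd ⊗ Z)
}.

Lemma zig_tail X Y (e : mor (Y ⊗ X) uob) (b : mor uob (X ⊗ Y)) :
  rho X ∘ (idm X ⊠ e) ∘ alpha X Y X ∘ (b ⊠ idm X) ∘ lamV X = idm X ->
  forall Z, (idm X ⊠ t20 e Z) ∘ t02 b (X ⊗ Z) = idm (X ⊗ Z).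
Proof.
move=> H Z; have := congr1 (fun h => h ⊠ idm Z) H; rewrite tmor1 => <-.
rewrite !tmorCl -triangleE (compE2 _ (alphaE _ _ _)).
rewrite -lam_tobV !compA (compE2 _ (esym (alphaVEl _ _ _))).
rewrite (compE _ (pentagonV _ _ _ _)) !compA (compK _ (alphaVK _ _ _)).
by rewrite t20E t02E !tmorCr !compA.
Qed.
Lemma zag_tail X Y (e : mor (Y ⊗ X) uob) (b : mor uob (X ⊗ Y)) :
  lam Y ∘ (e ⊠ idm Y) ∘ alphaV Y X Y ∘ (idm Y ⊠ b) ∘ rhoV Y = idm Y ->
  forall Z, t20 e (Y ⊗ Z) ∘ (idm Y ⊠ t02 b Z) = idm (Y ⊗ Z).
Proof.
rewrite -t20E => H Z; have := congr1 (fun h => h ⊠ idm Z) H; rewrite tmor1 => <-.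
rewrite !tmorCl t20_tail (compE2 _ (alphaE _ _ _)).
by rewrite (compE _ (triangleV _ _)) t02E !tmorCr !compA.
Qed.

Section Transpose.
Variables (X1 X2 : D) (P1 : dpair X1) (P2 : dpair X2) (f : mor X1 X2).

Definition gdual : mor (dd P2) (dd P1) :=
  t20 (de P2) (dd P1) ∘ (idm (dd P2) ⊠ ((f ⊠ idm (dd P1)) ∘ db P1)) ∘ rhoV (dd P2).

Lemma gdual_tail Z :
  gdual ⊠ idm Z = t20 (de P2) (dd P1 ⊗ Z) ∘ (idm (dd P2) ⊠ (f ⊠ idm (dd P1 ⊗ Z)))
    ∘ (idm (dd P2) ⊠ t02 (db P1) Z).
Proof.
rewrite /gdual !tmorCl t20_tail (compE2 _ (alphaE _ _ _)).
rewrite (compE _ (triangleV _ _)) !(compE _ (tmorCrV _ _ _)) compA -t02E t02_comp.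
by rewrite tmor1.
Qed.

Lemma gdual_db : (idm X2 ⊠ gdual) ∘ db P2 = (f ⊠ idm (dd P1)) ∘ db P1.
Proof.
apply: t02_inj; rewrite !t02_comp gdual_tail !tmorCr tmor1.
rewrite (compE2 _ (t02_nat _ _)) (compE2 _ (t02_nat _ _)).
by rewrite dz1 comp1m.
Qed.

Lemma gdual_de : de P1 ∘ (gdual ⊠ idm X1) = de P2 ∘ (idm (dd P2) ⊠ f).
Proof.
apply: t20_inj; rewrite !t20_comp tmor1 gdual_tail !compA.
rewrite -(t20_nat (de P2)) !(compE _ (tmorCrV _ _ _)) compA tmor_exchV.
by rewrite -compA dz1 compm1.
Qed.
End Transpose.

Definition nestb U U' V V' (b : mor uob (V ⊗ V')) (c : mor uob (U ⊗ U')) :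
    mor uob ((U ⊗ V) ⊗ (V' ⊗ U')) :=
  alphaV U V (V' ⊗ U') ∘ (idm U ⊠ t02 b U') ∘ c.

Lemma nestb_tail U U' V V' (b : mor uob (V ⊗ V')) (c : mor uob (U ⊗ U')) Z :
  t02 (nestb b c) Z =
  alphaV U V ((V' ⊗ U') ⊗ Z) ∘ (idm U ⊠ (idm V ⊠ alphaV V' U' Z)) ∘
    (idm U ⊠ t02 b (U' ⊗ Z)) ∘ t02 c Z.
Proof.
rewrite t02E (t02E c) /nestb !tmorCl !compA -pentagonM.
rewrite (compE2 _ (alphaE _ _ _)) (t02_tail b) !tmorCr !compA.
by rewrite (compK _ (tmor_invr _ (alphaVK _ _ _))).
Qed.

Section Nested.
Variables (U V : D) (P : dpair U) (Q : dpair V).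
Local Notation u' := (dd P).
Local Notation v' := (dd Q).

Definition nest_e : mor ((v' ⊗ u') ⊗ (U ⊗ V)) uob :=
  de Q ∘ (idm v' ⊠ t20 (de P) V) ∘ alpha v' u' (U ⊗ V).

Lemma nest_e_tail Z :
  t20 nest_e Z = t20 (de Q) Z ∘ (idm v' ⊠ t20 (de P) (V ⊗ Z)) ∘
    alpha v' u' (U ⊗ (V ⊗ Z)) ∘ (idm (v' ⊗ u') ⊠ alpha U V Z).
Proof.
rewrite (compE2 _ (alphaEr _ _ _)) t20E (t20E (de Q) Z) /nest_e !tmorCl !compA.
rewrite (compE _ (pentagonV _ _ _ _)) !compA (compE2 _ (esym (alphaVE _ _ _))).
rewrite (t20_tail (de P)) !tmorCr !compA.
by rewrite (compK _ (tmor_invr _ (alphaVK _ _ _))).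
Qed.

Lemma nest_dz1 Z :
  (idm (U ⊗ V) ⊠ t20 nest_e Z) ∘ t02 (nestb (db Q) (db P)) (U ⊗ V ⊗ Z) = idm _.
Proof.
apply: (retract_mono (alphaK U V Z)); rewrite compA alphaEr compm1.
rewrite nestb_tail !compA (compK _ (alphaVK _ _ _)) (compE _ (tmorCrV _ _ _)).
rewrite tmorCrV compA tmorCrV.
have -> : t20 nest_e Z ∘ alphaV v' u' (U ⊗ V ⊗ Z) =
    t20 (de Q) Z ∘ (idm v' ⊠ (t20 (de P) (V ⊗ Z) ∘ (idm u' ⊠ alpha U V Z))).
  rewrite nest_e_tail (compE2 _ (alphaEr _ _ _)) (compK _ (alphaVK _ _ _)).
  by rewrite (compE _ (tmorCrV _ _ _)).
rewrite (tmorCr V) (compE _ (t02_nat _ _)) compA dz1 comp1m tmorCr.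
by rewrite (compE _ (t02_nat _ _)) compA dz1 comp1m.
Qed.
Lemma nest_dz2 Z :
  t20 nest_e (v' ⊗ u' ⊗ Z) ∘ (idm (v' ⊗ u') ⊠ t02 (nestb (db Q) (db P)) Z) = idm _.
Proof.
rewrite nest_e_tail nestb_tail.
rewrite (compE _ (tmorCrV _ _ _)) !compA alphaVK comp1m.
rewrite tmorCrV (compE2 _ (alphaEr _ _ _)) (compE _ (tmorCrV _ _ _)).
rewrite (tmorCr u') !compA t20_nat (compE _ (dz2 P Z)) compm1.
rewrite tmorCr !compA t20_nat (compE _ (dz2 Q _)) compm1 alphaK //.
Qed.
Definition nest : dpair (U ⊗ V) := DPair nest_dz1 nest_dz2.
End Nested.

End DualPairs.

Section Twisted.
Context {K : fieldType} {C : modular_data K} {HC : modular_laws C}.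
Implicit Types U V W X Y Z : C.
Let HR := mod_ribbon HC.

Definition std_pair U : dpair U :=
  DPair (zig_tail (zigzag HR U)) (zag_tail (zigzag_dual HR U)).

Lemma dual_morE U V (f : mor U V) : dual_mor f = gdual (std_pair U) (std_pair V) f.
Proof. by rewrite /dual_mor /gdual t20E !tmorCr !compA. Qed.

Section DualCup.
Variables (X : C) (P : dpair X).
(* The cup on the other side, [coev'] for the standard pair. *)
Definition db' : mor uob (dd P ⊗ X) :=
  (idm (dd P) ⊠ twist X) ∘ braid X (dd P) ∘ db P.

Definition dtr (f : mor X X) : K := scal (de P ∘ (idm (dd P) ⊠ f) ∘ db').

Lemma db'_tail Z :
  t02 db' Z = (idm (dd P) ⊠ (twist X ⊠ idm Z)) ∘ br X (dd P) Z ∘ t02 (db P) Z.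
Proof. by rewrite /db' -compA t02_comp t22_t02 compA. Qed.
End DualCup.

Lemma gdual_db' X1 X2 (P1 : dpair X1) (P2 : dpair X2) (f : mor X1 X2) :
  (gdual P1 P2 f ⊠ idm X2) ∘ db' P2 = (idm (dd P1) ⊠ f) ∘ db' P1.
Proof.
rewrite /db' !compA tmor_exch (compE2 _ (esym (braidE _ _))).
rewrite (compE _ (gdual_db P1 P2 f)) compA (compE2 _ (braidE _ _)).
by rewrite tmorCrV twistE tmorCr.
Qed.

Lemma scal_lin : linear (@scal K C : _ -> K^o).
Proof. by move=> a u v; rewrite /scal linearP. Qed.

(** [f] travels round the loop, through the cup as its transpose and back through the cap. The pairs
    are arbitrary, so the case of an identity shows that the trace does not depend on the pair. *)
Lemma dtrC X1 X2 (P1 : dpair X1) (P2 : dpair X2) (f : mor X1 X2) (g : mor X2 X1) :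
  dtr P1 (g ∘ f) = dtr P2 (f ∘ g).
Proof.
rewrite /dtr tmorCr compA (compE _ (esym (gdual_db' P1 P2 f))) compA.
by rewrite (compE2 _ (tmor_exchV _ _)) gdual_de (compE _ (tmorCrV _ _ _)).
Qed.

Lemma dtr_lin X (P : dpair X) : linear (dtr P : _ -> K^o).
Proof.
move=> a f g; rewrite /dtr tmorDr tmorZr compDr compDl compZr compZl.
by rewrite scal_lin.
Qed.

Lemma dtr_qtrace X (P : dpair X) (f : mor X X) : dtr P f = qtrace f.
Proof. by have := dtrC P (std_pair X) (idm X) f; rewrite compm1 comp1m. Qed.
Lemma qdimE X : qdim X = qtrace (idm X).
Proof. by rewrite /qdim /qtrace tmor1 compm1. Qed.
Lemma qtrace_lin X : linear (@qtrace K C X : _ -> K^o).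
Proof. exact: (dtr_lin (std_pair X)). Qed.
Lemma qtraceC X Y (f : mor X Y) (g : mor Y X) : qtrace (g ∘ f) = qtrace (f ∘ g).
Proof. exact: (dtrC (std_pair X) (std_pair Y)). Qed.

Lemma qdim_sum X : qdim X = \sum_i (\dim {: mor X (simp i)})%:R * qdim (simp i : C).
Proof.
rewrite qdimE -completeness (lin_sum (@qtrace_lin X)); apply: eq_bigr => i _.
rewrite (lin_sum (@qtrace_lin X)) (eq_bigr (fun=> qdim (simp i : C))) => [|a _].
  by rewrite sumr_const card_ord mulr_natl.
by rewrite qtraceC sbas_sdbas eqxx scale1r -qdimE.
Qed.
End Twisted.

Section RightDuals.
Context {K : fieldType} {C : modular_data K} {HC : modular_laws C}.
Implicit Types U V W X Y Z : C.
Let HR := mod_ribbon HC.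

Lemma twist_coev U :
  (idm U ⊠ twist (dualob U)) ∘ coev U = (twist U ⊠ idm (dualob U)) ∘ coev U.
Proof. by rewrite (twist_dual HR) dual_morE (gdual_db (std_pair U) (std_pair U)). Qed.

(** By [twist_coev] the braidings and twists on the left make up the twist of [U ⊗ dualob U], which
    [coev] absorbs by naturality, the unit having trivial twist. *)
Lemma braid_twist_coev' U :
  braid (dualob U) U ∘ (idm (dualob U) ⊠ twist U) ∘ coev' U = coev U.
Proof.
have : twist (U ⊗ dualob U) ∘ coev U = coev U by rewrite twistE twist_unit compm1.
rewrite (twist_tensor HR) tmorLR !compA (compE _ (twist_coev U)) => H.
rewrite -[RHS]H.
by rewrite !compA (compE2 _ (braidE _ _)) (compE2 _ (braidE _ _)).
Qed.

(** [ev'] without its twist. Against [coev] it is neutral in the presence of a self-crossing of [U],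
    as [kink] shows. *)
Definition ev0 U : mor (U ⊗ dualob U) (uob : C) := ev U ∘ braid U (dualob U).

Lemma ev'_tail U Z :
  t20 (ev' U) Z = t20 (ev0 U) Z ∘ (twist U ⊠ idm (dualob U ⊗ Z)).
Proof. by rewrite /ev' t20_comp tmor1. Qed.
Lemma ev0_tail U Z : t20 (ev0 U) Z = t20 (ev U) Z ∘ br U (dualob U) Z.
Proof. exact: t20_t22. Qed.

(** The crossing inside [ev0] and the explicit one together carry a strand across the cup, so the
    cup slides off and a zigzag is left. *)
Lemma kink U Z :
  (idm U ⊠ t20 (ev0 U) Z) ∘ br U U (dualob U ⊗ Z) ∘ (idm U ⊠ t02 (coev U) Z) =
  idm (U ⊗ Z).
Proof.
rewrite ev0_tail tmorCr (compE3 _ (cup_slide _ _ _)).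
exact: (dz1 (std_pair U)).
Qed.

Lemma twist_coev'_tail U Z :
  (idm (dualob U) ⊠ (twist U ⊠ idm Z)) ∘ t02 (coev' U) Z =
  brV (dualob U) U Z ∘ t02 (coev U) Z.
Proof.
have E : (idm (dualob U) ⊠ twist U) ∘ coev' U = braidV (dualob U) U ∘ coev U.
  by rewrite -(braid_twist_coev' U) !compA braidK comp1m.
by rewrite -t02_comp E /brV -t22_t02.
Qed.

Lemma opp_dz1 U Z :
  (idm (dualob U) ⊠ t20 (ev' U) Z) ∘ t02 (coev' U) (dualob U ⊗ Z) = idm _.
Proof.
rewrite ev'_tail tmorCr (compE _ (twist_coev'_tail _ _)) compA.
rewrite -(cap_slide (dualob U) (ev0 U)) (compK _ (brVK _ _ _)) ev0_tail.
by rewrite (compE3 _ (cup_slideV _ _ _)) (dz2 (std_pair U)).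
Qed.

(** Composing with the invertible twist moves it onto [coev'], where it turns the cup into [coev]
    followed by an inverse braiding; what remains is [kink]. *)
Lemma opp_dz2 U Z : t20 (ev' U) (U ⊗ Z) ∘ (idm U ⊠ t02 (coev' U) Z) = idm _.
Proof.
have twm : is_mono (twist U ⊠ idm Z).
  have [g [gt _]] := twist_iso HR U.
  exact: (retract_mono (tmor_invl Z gt)).
apply: twm; rewrite compA -t20_nat (compE _ (tmorCrV _ _ _)) twist_coev'_tail.
rewrite ev'_tail -compA tmor_exch tmorCr !compA compm1.
have -> : t20 (ev0 U) (U ⊗ Z) ∘ (idm U ⊠ brV (dualob U) U Z) =
    (idm U ⊠ t20 (ev0 U) Z) ∘ br U U (dualob U ⊗ Z).
  by rewrite -cap_slideV (compK _ (tmor_invr U (brVK _ _ _))).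
by rewrite kink comp1m.
Qed.

Definition opp_pair U : dpair (dualob U) := DPair (opp_dz1 U) (opp_dz2 U).

Lemma opp_db' U : db' (opp_pair U) = coev U.
Proof.
have [g [gt _]] := twist_iso HR U.
apply: (retract_mono (tmor_invl (dualob U) gt)); rewrite -twist_coev.
rewrite /db' /=; move: (coev' U) (braid_twist_coev' U) => c H.
by rewrite !compA tmor_exch (compE2 _ (esym (braidE _ _))) (compE3 _ H).
Qed.

Lemma qdim_dual U : qdim (dualob U) = qdim U.
Proof.
rewrite qdimE -(dtr_qtrace (opp_pair U)) /dtr opp_db' tmor1 compm1 /qdim /=.
by rewrite /ev' /coev' !compA (compE2 _ (braidE _ _)).
Qed.
Lemma twist_tail U V Z :
  alpha U V Z ∘ (twist (U ⊗ V) ⊠ idm Z) =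
  br V U Z ∘ br U V Z ∘ (twist U ⊠ (twist V ⊠ idm Z)) ∘ alpha U V Z.
Proof.
rewrite -t22_tmor /br -!t22_t22 -(twist_tensor HR) t22E.
by rewrite (compK _ (alphaK _ _ _)).
Qed.

(** The left cup carries the twist of [U ⊗ V], that is the two twists and a double crossing of [U]
    with [V]. Pulling the cups apart produces inverse crossings, which undo it and leave the twists
    of the separate cups. *)
Lemma nest_db' U V (P : dpair U) (Q : dpair V) :
  db' (nest P Q) = nestb (db' P) (db' Q).
Proof.
apply: t02_inj; move: (uob : C) => Z; set u' := dd P; set v' := dd Q.
apply: (retract_mono (alphaK v' u' (U ⊗ V ⊗ Z))).
apply: (retract_mono (tmor_invr v' (tmor_invr u' (alphaK U V Z)))).
transitivity ((idm v' ⊠ t02 (db' P) (V ⊗ Z)) ∘ t02 (db' Q) Z); last first.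
  rewrite nestb_tail !compA (compK _ (alphaVK _ _ _)).
  by rewrite (tmor_invr v' (tmor_invr u' (alphaVK U V Z))) comp1m.
rewrite db'_tail /= -/u' -/v' !compA (compE2 _ (alphaEr _ _ _)) tmorCrV.
rewrite (tmorCrV u') twist_tail (compE _ (esym (hexagonR _ _ _ _))) !compA.
set T := br V U Z ∘ _ ∘ _; rewrite tmorCrV (tmorCr u' (alpha U V Z)).
rewrite (compE _ (esym (hexagonL _ _ _ _))) !compA (tmorCr v' (alpha U V _)).
rewrite (compE _ (esym (hexagonL _ _ _ _))) !compA (compE2 _ (alphaEr _ _ _)).
rewrite nestb_tail !compA (compK _ (alphaVK _ _ _)).
rewrite (compK _ (tmor_invr U (tmor_invr V (alphaVK v' u' Z)))).
pose B := (twist U ⊠ idm (V ⊗ Z)) ∘ br V U Z ∘ br U V Z.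
have TE : T = B ∘ (idm U ⊠ (twist V ⊠ idm Z)).
  by rewrite /T /B tmorLR !compA (compE2 _ (brEl _ _ _)) brEr.
have -> : (idm u' ⊠ T) ∘ br U u' (V ⊗ Z) ∘ (idm U ⊠ br V u' Z) =
    (idm u' ⊠ B) ∘ br U u' (V ⊗ Z) ∘ (idm U ⊠ br V u' Z) ∘
    (idm U ⊠ (twist V ⊠ idm (u' ⊗ Z))).
  rewrite TE tmorCr (compE2 _ (esym (br_nat _ _ _))) (compE _ (tmorCrV _ _ _)).
  by rewrite -brEl tmorCr compA.
rewrite (tmorCr v' (idm U ⊠ _)) (compE2 _ (esym (br_nat _ _ _))).
rewrite (compE _ (tmorCrV U _ _)) (compE _ (tmorCrV U _ _)) !compA -db'_tail.
(* A crossing of [U] with one leg of a cup equals the inverse crossing with the other leg. *)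
have S : br U v' (V ⊗ (u' ⊗ Z)) ∘ (idm U ⊠ t02 (db' Q) (u' ⊗ Z)) =
    (idm v' ⊠ brV U V (u' ⊗ Z)) ∘ t02 (db' Q) (U ⊗ (u' ⊗ Z)).
  by rewrite -(cup_slide U (db' Q)) !compA (tmor_invr v' (brK _ _ _)) comp1m.
rewrite (compE _ S) !compA (compE _ (esym (t02_nat _ _))) !compA.
rewrite !(compE _ (tmorCrV v' _ _)) tmorCrV; congr (_ ⊠ _ ∘ _).
rewrite -(cup_slide V (db' P)) db'_tail !tmorCr !compA.
rewrite -/u' [in RHS](compE2 _ (br_nat _ _ _)) [in RHS]tmorCrV [in RHS]brEr [in RHS]tmorCr.
(* The Yang-Baxter move: the crossing of [V] with [dd P] slides along [U]. *)
have YB := t22_slide (HC := HC) U (braid V u') Z.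
by rewrite (compE3 _ (esym YB)) !compA (compK _ (brVK _ _ _)).
Qed.

(** A partial trace: in the nested pair the loop of [U] closes inside that of [V]. *)
Lemma qtrace_nest U V (P : dpair U) (Q : dpair V) (f : mor (U ⊗ V) (U ⊗ V)) :
  qtrace f = dtr Q (t20 (de P) V ∘ (idm (dd P) ⊠ f) ∘ t02 (db' P) V).
Proof.
rewrite -(dtr_qtrace (nest P Q)) /dtr nest_db' /=; congr scal.
rewrite /nest_e /nestb !compA (compE2 _ (alphaEr _ _ _)) (compK _ (alphaVK _ _ _)).
by rewrite !(compE _ (tmorCrV _ _ _)) !compA.
Qed.

Lemma dtr_scale U (P : dpair U) c : dtr P (c *: idm U) = c * qdim U.
Proof. by rewrite dtr_qtrace qdimE (linZ (@qtrace_lin _ _ _ U)). Qed.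

Lemma de_db' U (P : dpair U) : de P ∘ db' P = qdim U *: idm uob.
Proof.
rewrite [LHS]unit_scalar; congr (_ *: _).
by rewrite qdimE -(dtr_qtrace P) /dtr tmor1 compm1.
Qed.

Lemma qdim_tens U V : qdim (U ⊗ V : C) = qdim U * qdim V.
Proof.
rewrite qdimE (qtrace_nest (std_pair U) (std_pair V)) tmor1 compm1.
by rewrite (t20_t02 V (de_db' (std_pair U))) dtr_scale.
Qed.

End RightDuals.

Lemma lin_bij_dim (K : fieldType) (V W : vectType K) (f : V -> W) (g : W -> V) :
  linear f -> cancel f g -> cancel g f -> \dim {:V} = \dim {:W}.
Proof.
move=> fl fg gf.
pose Lf := GRing.isLinear.Build K V W *:%R f fl.
pose h : {linear V -> W} := HB.pack f Lf.
have hE v : linfun h v = f v by rewrite lfunE.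
have ker0 : lker (linfun h) == 0%VS.
  by apply/lker0P => u v; rewrite !hE => /(can_inj fg).
have im : limg (linfun h) = fullv.
  apply/eqP; rewrite eqEsubv subvf; apply/subvP => w _.
  by rewrite -[w]gf -hE memv_img ?memvf.
by rewrite -im limg_dim_eq // (eqP ker0) capv0.
Qed.

(** * Fusion and the global dimension *)

Section Loops.
Context {K : fieldType} {C : modular_data K} {HC : modular_laws C}.
Implicit Types U V W X Y Z : C.
Let HR := mod_ribbon HC.

Lemma dim_hom_simp V i : \dim {: mor (simp i) V} = \dim {: mor V (simp i)}.
Proof.
have := size_basis (X := in_tuple _) (sdbas_basis (mod_semisimple HC) V i).
by rewrite size_codom card_ord.
Qed.

Lemma dim_hom_adj U V X : \dim {: mor V (dualob U ⊗ X)} = \dim {: mor (U ⊗ V) X}.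
Proof.
apply: (@lin_bij_dim _ _ _ (fun h => t20 (ev' U) X ∘ (idm U ⊠ h))
  (fun g => (idm (dualob U) ⊠ g) ∘ t02 (coev' U) V)).
- by move=> a u v; rewrite tmorDr tmorZr compDr compZr.
- move=> h; rewrite tmorCr (compE _ (t02_nat _ _)) compA opp_dz1 comp1m //.
move=> g; rewrite tmorCr compA t20_nat -compA opp_dz2 compm1 //.
Qed.

(** Bending [simp i] turns the multiplicity into that of [simp j] in [dualob (simp i) ⊗ simp k], so
    the sum is the dimension of this product. *)
Lemma fusion i k : \sum_j (\dim {: mor (simp i ⊗ simp j : C) (simp k)})%:R * qdim (simp j : C) =
  qdim (simp i : C) * qdim (simp k : C).
Proof.
rewrite -[in RHS](qdim_dual (simp i)) -qdim_tens qdim_sum; apply: eq_bigr => j _.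
by rewrite -(dim_hom_simp (dualob (simp i) ⊗ simp k)) dim_hom_adj.
Qed.

(** Locked, so that the double braiding moves as one piece under [compA]. *)
Definition cc U V : mor (U ⊗ V) (U ⊗ V) := locked (braid V U ∘ braid U V).
Lemma ccD U V : cc U V = braid V U ∘ braid U V.
Proof. by rewrite /cc -lock. Qed.

(* The strand [V] encircled by [U], with [f] inserted on the circle. *)
Definition wloop U (P : dpair U) (f : mor U U) V : mor V V :=
  t20 (de P) V ∘ (idm (dd P) ⊠ (cc U V ∘ (f ⊠ idm V))) ∘ t02 (db' P) V.
Definition loop U (P : dpair U) V : mor V V := wloop P (idm U) V.

Lemma loopE U (P : dpair U) V :
  loop P V = t20 (de P) V ∘ (idm (dd P) ⊠ cc U V) ∘ t02 (db' P) V.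
Proof. by rewrite /loop /wloop tmor1 compm1. Qed.

Lemma ccE U U' V (f : mor U U') : cc U' V ∘ (f ⊠ idm V) = (f ⊠ idm V) ∘ cc U V.
Proof. by rewrite !ccD -compA braidE compA braidE compA. Qed.

Lemma wloop_lin U (P : dpair U) V : linear (fun f => wloop P f V).
Proof.
move=> a f g; rewrite /wloop tmorDl tmorZl compDr compZr tmorDr tmorZr.
by rewrite compDr compDl compZr compZl.
Qed.

(** As in [dtrC], with naturality of the double braiding to pass the strand [V]. *)
Lemma wloopC X Y (P : dpair X) (Q : dpair Y) (f : mor X Y) (g : mor Y X) V :
  wloop P (g ∘ f) V = wloop Q (f ∘ g) V.
Proof.
rewrite /wloop !tmorCl !compA [in LHS]ccE !tmorCr !compA -t20_comp.
rewrite -(gdual_de Q P g) t20_comp tmor1.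
rewrite !(compE2 _ (tmor_exch _ _)) -(tmor1 X V).
rewrite (compE _ (esym (t02_comp _ _ _ _))) gdual_db' t02_comp.
by rewrite !compA.
Qed.

Lemma loop_tail U (P : dpair U) V Z :
  loop P V ⊠ idm Z = t20 (de P) (V ⊗ Z) ∘ (idm (dd P) ⊠ (br V U Z ∘ br U V Z))
    ∘ t02 (db' P) (V ⊗ Z).
Proof.
rewrite loopE !tmorCl t20_tail t02_tail !compA (compE2 _ (alphaE _ _ _)).
rewrite (compK _ (alphaVK _ _ _)) !(compE _ (tmorCrV _ _ _)) !compA -t22E.
by rewrite ccD t22_t22.
Qed.

Lemma cc_nest U W V :
  alpha U W V ∘ cc (U ⊗ W) V ∘ alphaV U W V =
  (idm U ⊠ braid V W) ∘ br V U W ∘ br U V W ∘ (idm U ⊠ braid W V).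
Proof.
have H1 : alpha U W V ∘ braid V (U ⊗ W) = (idm U ⊠ braid V W) ∘ br V U W.
  rewrite /br t22E !compA -(hexagon1 HR) -!compA alphaVK compm1 //.
have H2 : braid (U ⊗ W) V ∘ alphaV U W V = br U V W ∘ (idm U ⊠ braid W V).
  rewrite /br t22E (compE3 _ (esym (hexagon2 HR U W V))) !compA.
  by rewrite alphaVK comp1m.
by rewrite ccD !compA H1 (compE _ H2) !compA.
Qed.

Lemma cap_cc U W (P : dpair U) V :
  t20 (de P) (W ⊗ V) ∘ (idm (dd P) ⊠ (alpha U W V ∘ cc (U ⊗ W) V ∘ alphaV U W V))
    ∘ t02 (db' P) (W ⊗ V) = braid V W ∘ (loop P V ⊠ idm W) ∘ braid W V.
Proof.
rewrite cc_nest !tmorCr !compA t20_nat (compE _ (t02_nat _ _)) !compA loop_tail.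
by rewrite tmorCr !compA.
Qed.

(** A circle labelled [U ⊗ W] is two parallel circles round [V]; the inner one is replaced by its
    scalar. *)
Lemma loop_nest U W (P : dpair U) (Q : dpair W) V c :
  loop P V = c *: idm V -> loop (nest P Q) V = c *: loop Q V.
Proof.
move=> e; rewrite !loopE nest_db' /= nest_e_tail nestb_tail.
rewrite !compA !(compE2 _ (esym (alphaVEr _ _ _))) (compK _ (alphaVK _ _ _)).
rewrite !(compE _ (tmorCrV (dd Q) _ _)) !compA !(compE _ (tmorCrV (dd P) _ _)) !compA.
rewrite cap_cc e tmorZl tmor1 compZr compm1 compZl -ccD.
by rewrite tmorZr compZr compZl.
Qed.

Lemma loop_sum U (P : dpair U) V :
  loop P V = \sum_i (loop (std_pair (simp i)) V *+ \dim {: mor U (simp i)}).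
Proof.
rewrite /loop -completeness (lin_sum (wloop_lin P V)); apply: eq_bigr => i _.
rewrite (lin_sum (wloop_lin P V)) -[in RHS](card_ord (\dim _)) -sumr_const.
apply: eq_bigr => a _.
by rewrite (wloopC P (std_pair (simp i))) sbas_sdbas eqxx scale1r.
Qed.

Lemma chi_exists j : exists x : label C -> K,
  forall i, loop (std_pair (simp i)) (simp j) = x i *: idm (simp j : C).
Proof.
apply: (@fin_all_exists _ _ (fun i c => loop (std_pair (simp i)) (simp j) = c *: idm (simp j : C))).
by move=> i; apply: simple_scalar (simp_simpleP j).
Qed.

Lemma chi_mul j x :
  (forall i, loop (std_pair (simp i)) (simp j) = x i *: idm (simp j : C)) ->
  forall l i, x l * x i =
    \sum_k (\dim {: mor (simp l ⊗ simp i : C) (simp k)})%:R * x k.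
Proof.
move=> xP l i; have := loop_nest (std_pair (HC := HC) (simp i)) (xP l).
rewrite loop_sum xP scalerA => /esym/eqP.
under eq_bigr => k _ do rewrite xP -scaler_nat scalerA.
rewrite -scaler_suml -subr_eq0 -scalerBl scaler_eq0 (negPf (idm_simp_neq0 j)) orbF.
by rewrite subr_eq0 => /eqP.
Qed.

(** Closing the encircled strand gives a Hopf link. *)
Lemma smatrix_chi j x :
  (forall i, loop (std_pair (simp i)) (simp j) = x i *: idm (simp j : C)) ->
  forall i, qtrace (braid (simp j) (simp i) ∘ braid (simp i) (simp j)) =
    x i * qdim (simp j : C).
Proof.
move=> xP i; rewrite (qtrace_nest (std_pair (simp i)) (std_pair (simp j))).
by rewrite -ccD -loopE xP dtr_scale.
Qed.

Lemma label_inhabited : inhabited (label C).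
Proof. by have [i _] := simp_surj (mod_semisimple HC) (mod_one HC); exists. Qed.

(** A simple object of dimension zero would give the invertible [smatrix] a zero column. *)
Lemma qdim_simp_neq0 j : qdim (simp j : C) != 0.
Proof.
apply/eqP => d0; have [x xP] := chi_exists j.
have s0 : smatrix C *m delta_mx (enum_rank j) (0 : 'I_1) = 0.
  apply/matrixP => a b; rewrite -colE !mxE /= enum_rankK (smatrix_chi xP) d0.
  by rewrite mulr0.
have := mulKmx (mod_smatrix HC) (delta_mx (enum_rank j) (0 : 'I_1)).
rewrite s0 mulmx0 => /matrixP/(_ (enum_rank j) 0); rewrite !mxE !eqxx => /eqP.
by rewrite eq_sym oner_eq0.
Qed.

(* The column of characters [x] of the fusion ring satisfies
   [x l * S = qdim l * S] for [S = \sum_i qdim i * x i]; if [S != 0] then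
   [x = qdim] and [S = Dim]. *)
Lemma Dim_neq0 : Dim C != 0.
Proof.
apply/eqP => D0.
have x0 j x : (forall i, loop (std_pair (simp i)) (simp j) = x i *: idm (simp j : C)) ->
    \sum_i qdim (simp i : C) * x i = 0.
  move=> xP; set S := \sum_i _.
  have xS l : x l * S = qdim (simp l : C) * S.
    rewrite [in LHS]mulr_sumr.
    under eq_bigr => i _ do rewrite mulrCA (chi_mul xP) mulr_sumr.
    rewrite exchange_big mulr_sumr; apply: eq_bigr => k _ /=.
    under eq_bigr => i _ do rewrite mulrA [qdim _ * _]mulrC.
    by rewrite -mulr_suml fusion mulrA.
  apply/eqP/contraT => S0; case/eqP: (S0); rewrite -D0 /Dim; apply: eq_bigr => i _.
  by rewrite (mulIf S0 (xS i)).
(* If all these sums vanish, the row of dimensions is killed by [smatrix], hence zero, against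
   [qdim_simp_neq0]. *)
have d0 : (\row_a qdim (simp (enum_val a) : C)) *m smatrix C = 0.
  apply/matrixP => a b; rewrite !mxE.
  have [x xP] := chi_exists (enum_val b : label C).
  under eq_bigr => c _ do rewrite !mxE /= (smatrix_chi xP) mulrA.
  rewrite -mulr_suml.
  have -> : \sum_(c < #|label C|) qdim (simp (enum_val c) : C) * x (enum_val c) =
      \sum_i qdim (simp i : C) * x i.
    rewrite [RHS](reindex (fun c : 'I_#|label C| => enum_val c)) //.
    by exists enum_rank => ? _; rewrite ?enum_rankK ?enum_valK.
  by rewrite (x0 _ _ xP) mul0r.
have [i0] := label_inhabited.
have := mulmxK (mod_smatrix HC) (\row_a qdim (simp (enum_val a) : C)).
rewrite d0 mul0mx => /matrixP/(_ 0 (enum_rank i0)); rewrite !mxE enum_rankK => /esym/eqP.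
by rewrite (negPf (qdim_simp_neq0 i0)).
Qed.

Lemma fusion_Dim k :
  \sum_i \sum_j qdim (simp i : C) * qdim (simp j : C) *
    (\dim {: mor (simp i ⊗ simp j : C) (simp k)})%:R = Dim C * qdim (simp k : C).
Proof.
rewrite mulr_suml; apply: eq_bigr => i _; rewrite expr2 -mulrA -fusion mulr_sumr.
by apply: eq_bigr => j _; rewrite -mulrA [qdim (simp j) * _]mulrC.
Qed.
End Loops.

(** * The adjunctions between T and R *)

Section ZigZag.
Context {K : fieldType} {D : mcat K}.
Context {HL : linear_category_laws D} {HM : monoidal_laws D}.
Lemma zig_of_tail (X Y : D) (e : mor (Y ⊗ X) uob) (b : mor uob (X ⊗ Y)) :
  (forall Z, (idm X ⊠ t20 e Z) ∘ t02 b (X ⊗ Z) = idm (X ⊗ Z)) ->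
  rho X ∘ (idm X ⊠ e) ∘ alpha X Y X ∘ (b ⊠ idm X) ∘ lamV X = idm X.
Proof.
move/(_ uob); rewrite t20_unit tmorCr (compE _ (t02_nat _ _)) t02E !compA => H.
apply: (section_epi (rhoVK X)); rewrite comp1m -[RHS]compm1 -[in RHS]H.
by rewrite !compA.
Qed.
Lemma zag_of_tail (X Y : D) (e : mor (Y ⊗ X) uob) (b : mor uob (X ⊗ Y)) :
  (forall Z, t20 e (Y ⊗ Z) ∘ (idm Y ⊠ t02 b Z) = idm (Y ⊗ Z)) ->
  t20 e Y ∘ (idm Y ⊠ b) ∘ rhoV Y = idm Y.
Proof.
move/(_ uob); rewrite t02_unit tmorCr !compA t20_nat => H.
apply: (retract_mono (rhoVK Y)).
by rewrite !compA H comp1m compm1.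
Qed.
End ZigZag.

Section FunctorT.
Context {K : fieldType} {C : modular_data K} {HC : modular_laws C}.
Implicit Types M N P : C2 C.

Lemma Tmor_lin M N : linear (@Tmor K C M N).
Proof.
move=> a f g; rewrite /Tmor scaler_sumr -big_split; apply: eq_bigr => m _ /=.
rewrite scaler_sumr -big_split; apply: eq_bigr => n _ /=.
by rewrite (@ent_lin _ _ M N m n a) tlift_lin compDr compZr compDl compZl.
Qed.

Lemma Tmor_pel M N (m : pidx M) (n : pidx N) f g :
  Tmor (pel m n f g : mor M N) =
  incl (@Tsummand _ _ N) n ∘ (f ⊠ g) ∘ proj (@Tsummand _ _ M) m.
Proof.
have lin0E (V W X : vectType K) (B : V -> W -> X) : tlift B 0 = 0 by apply: (lin0 (tlift_lin B)).
rewrite /Tmor (bigD1 m) //= (bigD1 n) //= ent_pel.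
rewrite tlift_pure; [|exact: (tmor_linl _)|exact: (tmor_linr _)].
rewrite !big1 ?addr0 // => [m' ne | n' ne].
  by rewrite big1 // => n' _; rewrite ent_pel0 1?eq_sym ?ne // lin0E comp0r comp0l.
by rewrite ent_pel0 ?[n == _]eq_sym ?ne ?orbT // lin0E comp0r comp0l.
Qed.

Lemma Tmor_id M : Tmor (idm M) = idm (Tob M).
Proof.
rewrite idm_pel (lin_sum (@Tmor_lin M M)) -sum_incl_proj; apply: eq_bigr => m _.
by rewrite Tmor_pel tmor1 compm1.
Qed.

Lemma Tmor_comp M N P (g : mor N P) (f : mor M N) :
  Tmor (g ∘ f) = Tmor g ∘ Tmor f.
Proof.
pattern f; match goal with |- (fun x => @?L x = @?R x) _ =>
  apply: (mor_ext (phi := L) (psi := R)) end => [a u v|a u v|m n {f} f f'].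
- by rewrite compDr compZr Tmor_lin.
- by rewrite Tmor_lin compDr compZr.
pattern g; match goal with |- (fun x => @?L x = @?R x) _ =>
  apply: (mor_ext (phi := L) (psi := R)) end => [a u v|a u v|n' p {g} g g'].
- by rewrite compDl compZl Tmor_lin.
- by rewrite Tmor_lin compDl compZl.
rewrite !Tmor_pel !compA; have [e|ne] := eqVneq n n'.
  by subst n'; rewrite pel_comp Tmor_pel tmorC (compK _ (proj_incl _ _)) !compA.
rewrite pel_comp0 // (lin0 (@Tmor_lin M P)).
by rewrite (compE _ (proj_incl0 _ ne)) comp0r !comp0l.
Qed.

Lemma mk_pel M N F :
  mk F = \sum_(m : pidx M) \sum_(n : pidx N) tlift (pel m n) (F m n) :> mor M N.
Proof.
rewrite [LHS]mor_pel_decomp; apply: eq_bigr => m _; apply: eq_bigr => n _.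
by rewrite ent_mk.
Qed.

Lemma tlift_pel_sum M N (m : pidx M) (n : pidx N) (J : finType)
    (f : J -> mor (pl m) (pl n)) (g : J -> mor (pr m) (pr n)) :
  tlift (pel m n) (\sum_a (pure (f a) (g a) : tens _ _)) = \sum_a (pel m n (f a) (g a) : mor M N).
Proof.
rewrite (lin_sum (tlift_lin _)); apply: eq_bigr => a _.
by rewrite tlift_pure //; [exact: pel_linl | exact: pel_linr].
Qed.

Section Hat.
Local Notation dl := dualob.

(* [locked], lest [compA] rewrite inside. *)
Definition cap (B u : C) : mor ((B ⊗ dl u) ⊗ u) B :=
  locked (rho B ∘ (idm B ⊠ ev u) ∘ alpha B (dl u) u).
Lemma capD (B u : C) : cap B u = rho B ∘ (idm B ⊠ ev u) ∘ alpha B (dl u) u.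
Proof. by rewrite /cap -lock. Qed.
(* The left tensor factor of a term of [chihat]. *)
Definition hat1 (V W u B : C) (F : mor (V ⊗ W) B) (q : mor u W) : mor V (B ⊗ dl u) :=
  (F ⊠ idm (dl u)) ∘ alphaV V W (dl u) ∘ (idm V ⊠ (q ⊠ idm (dl u)))
  ∘ (idm V ⊠ coev u) ∘ rhoV V.
End Hat.

Lemma capE A B u (h : mor A B) :
  cap B u ∘ ((h ⊠ idm (dualob u)) ⊠ idm u) = h ∘ cap A u.
Proof.
rewrite !capD (compE _ (alphaEl _ _ _)) !compA (compE2 _ (tmor_exchV _ _)).
by rewrite rhoE.
Qed.

(** The strand [u] bent by [hat1] is straightened by the cap. Summed over dual bases, [q ∘ p]
    becomes an identity, which is how [tr] inverts [chihat]. *)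
Lemma cap_hat1 V W u B (F : mor (V ⊗ W) B) (q : mor u W) (p : mor W u) :
  cap B u ∘ (hat1 F q ⊠ p) = F ∘ (idm V ⊠ (q ∘ p)).
Proof.
have zz : cap u u ∘ (coev u ⊠ idm u) ∘ lamV u = idm u.
  by rewrite capD; exact: zigzag (mod_ribbon HC) u.
rewrite tmorLR !compA /hat1 !tmorCl !compA capE.
have -> : cap (V ⊗ W) u = (idm V ⊠ cap W u) ∘ alpha V (W ⊗ dualob u) u ∘
    (alpha V W (dualob u) ⊠ idm u).
  rewrite !capD rho_tob (compE2 _ (alphaEr _ _ _)).
  by rewrite (compE _ (pentagonE _ _ _ _)) !tmorCr !compA.
rewrite !compA (compK _ (tmor_invl u (alphaVK _ _ _))).
rewrite !(compE2 _ (alphaE _ _ _)) (compE _ (triangleV _ _)).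
rewrite !(compE _ (tmorCrV V _ _)); congr (_ ∘ (_ ⊠ _)).
rewrite !compA capE.
by rewrite (compE3 _ zz) compm1.
Qed.

Lemma hat1_cap V W B u k (f : mor V (B ⊗ dualob u)) (g : mor W u) (q : mor k W) :
  hat1 (cap B u ∘ (f ⊠ g)) q = hat1 (cap B u ∘ (f ⊠ (g ∘ q))) (idm k).
Proof.
rewrite /hat1 tmor1 tmor1 compm1; congr (_ ∘ _ ∘ _).
rewrite (compE _ (alphaVE _ _ _)) compA tmorClV -compA.
by rewrite -tmorC compm1.
Qed.

Lemma hat1_cap_id V B u (f : mor V (B ⊗ dualob u)) :
  hat1 (cap B u ∘ (f ⊠ idm u)) (idm u) = f.
Proof.
have zz : t20 (ev u) (dualob u) ∘ (idm _ ⊠ coev u) ∘ rhoV _ = idm (dualob u).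
  exact: (zag_of_tail (dz2 (std_pair u))).
rewrite /hat1 tmor1 tmor1 compm1 tmorCl (compE2 _ (esym (alphaVEl _ _ _))).
rewrite (compE2 _ (tmor_exch _ _)) -compA rhoVE !compA -[RHS]comp1m; congr (_ ∘ _).
rewrite capD !tmorCl (compE _ (pentagonV _ _ _ _)) !compA.
rewrite (compE2 _ (esym (alphaVE _ _ _))) triangleVl.
rewrite rho_tobV (compE2 _ (alphaEr _ _ _)) !compA (compK _ (alphaVK _ _ _)).
by rewrite !tmorCrV -t20E zz tmor1.
Qed.

Lemma hat1_lin V W u B (q : mor u W) : linear (fun F : mor (V ⊗ W) B => hat1 F q).
Proof.
by move=> a F G; rewrite /hat1 tmorDl tmorZl !compDl !compZl.
Qed.

Lemma chihatE M A (f : mor (Tob M) A) :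
  chihat f = \sum_m \sum_i \sum_a pel m (i : pidx (Rob A : C2 C))
    (hat1 (f ∘ incl (@Tsummand _ _ M) m) (sdbas (pr m) i a)) (sbas (pr m) i a).
Proof.
rewrite /chihat mk_pel; apply: eq_bigr => m _; apply: eq_bigr => i _.
exact: tlift_pel_sum.
Qed.

Lemma chihat_lin M A : linear (@chihat K C M A).
Proof.
move=> a f g; rewrite !chihatE scaler_sumr -big_split; apply: eq_bigr => m _ /=.
rewrite scaler_sumr -big_split; apply: eq_bigr => i _ /=.
rewrite scaler_sumr -big_split; apply: eq_bigr => b _ /=.
by rewrite compDl compZl hat1_lin pel_linl.
Qed.

(* [rhohat] and the inverse of [chihat] in closed form. *)
Definition rh (A : C) : mor (Tob (Rob A)) A :=
  \sum_i cap A (simp i) ∘ proj (@Tsummand _ _ (Rob A)) i.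
Definition tr M A (g : mor M (Rob A : C2 C)) : mor (Tob M) A := rh A ∘ Tmor g.

Lemma tr_lin M A : linear (@tr M A).
Proof. by move=> a f g; rewrite /tr Tmor_lin compDr compZr. Qed.

Lemma tr_pel M A (m : pidx M) (i : label C) f g :
  tr (pel m (i : pidx (Rob A : C2 C)) f g : mor M _) =
  cap A (simp i) ∘ (f ⊠ g) ∘ proj (@Tsummand _ _ M) m.
Proof.
rewrite /tr Tmor_pel /rh comp_suml (bigD1 i) //= !compA.
rewrite (compK _ (proj_incl _ _)) big1 ?addr0 // => j ne.
by rewrite !compA (compE _ (proj_incl0 _ _)) 1?eq_sym // comp0r !comp0l.
Qed.

Lemma tr_chihat M A (f : mor (Tob M) A) : tr (chihat f) = f.
Proof.
rewrite chihatE (lin_sum (@tr_lin M A)) -[RHS]compm1 -sum_incl_proj comp_sumr.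
apply: eq_bigr => m _; rewrite (lin_sum (@tr_lin M A)).
rewrite compA.
have E : f ∘ incl _ m = f ∘ incl (@Tsummand _ _ M) m ∘
    (idm (pl m) ⊠ \sum_i \sum_a sdbas (pr m) i a ∘ sbas (pr m) i a).
  by rewrite completeness tmor1 compm1.
rewrite [in RHS]E tmor_sumr comp_sumr comp_suml; apply: eq_bigr => i _.
rewrite (lin_sum (@tr_lin M A)) tmor_sumr comp_sumr comp_suml.
by apply: eq_bigr => a _; rewrite tr_pel cap_hat1.
Qed.

(** On a single entry, Schur's lemma kills all other labels, and duality recovers the coefficients
    of [g] in the basis [sbas]. *)
Lemma chihat_tr M A (g : mor M (Rob A : C2 C)) : chihat (tr g) = g.
Proof.
apply: (mor_ext (lin_comp (@tr_lin M A) (@chihat_lin M A)) _ _ g) => // m i {g} f g.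
have [c gE] := sbas_decomp (V := pr m) (g : mor _ (simp i)).
have h0 V W u B q : @hat1 V W u B 0 q = 0 by apply: (lin0 (hat1_lin _)).
rewrite tr_pel chihatE (bigD1 m) //= [X in _ + X]big1 => [|m' ne]; last first.
  apply: big1 => k _; apply: big1 => a _.
  by rewrite (compE _ (proj_incl0 _ ne)) comp0r h0 pel0l.
rewrite addr0 (bigD1 i) //= [X in _ + X]big1 => [|k ne]; last first.
  apply: big1 => a _; rewrite (compK _ (proj_incl _ _)) hat1_cap.
  by rewrite [g ∘ _](schur0 _ ne) tmor0r comp0r h0 pel0l.
rewrite addr0 [in RHS]gE (lin_sum (pel_linr _)); apply: eq_bigr => a _.
rewrite (compK _ (proj_incl _ _)) hat1_cap.
have -> : (g : mor _ (simp i)) ∘ sdbas (pr m) i a = c a *: idm (simp i).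
  rewrite gE comp_suml (bigD1 a) //= compZl sbas_sdbas eqxx scale1r.
  rewrite big1 ?addr0 // => b ne.
  by rewrite compZl sbas_sdbas (negPf ne) scale0r scaler0.
rewrite tmorZr compZr (linZ (hat1_lin _)) hat1_cap_id pelZl pelZr //.
Qed.

(** The formal inverse [chihatV] is a left inverse because [chihat] is linear and injective; it is
    applied to [idm] written as [chihat (tr idm)]. *)
Lemma rhohatE A : rhohat A = rh A.
Proof.
have E : linfun (@chihat K C (Rob A) A) =1 @chihat K C (Rob A) A.
  pose L := GRing.isLinear.Build K _ _ *:%R _ (@chihat_lin (Rob A) A).
  pose h : {linear _ -> _} := HB.pack (@chihat K C (Rob A) A) L.
  exact: (lfunE h).
have inj : lker (linfun (@chihat K C (Rob A) A)) == 0%VS.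
  by apply/lker0P => f g; rewrite !E => /(congr1 (@tr _ _)); rewrite !tr_chihat.
rewrite /rhohat /chihatV -[idm _]chihat_tr -E lker0_lfunK //.
by rewrite /tr Tmor_id compm1.
Qed.
End FunctorT.

Section Check.
Context {K : fieldType} {C : modular_data K} {HC : modular_laws C}.
Implicit Types M N P : C2 C.
Local Notation dl := dualob.

Definition cup (B u : C) : mor B ((B ⊗ dl u) ⊗ u) :=
  locked (alphaV B (dl u) u ∘ (idm B ⊠ coev' u) ∘ rhoV B).
Lemma cupD B u : cup B u = alphaV B (dl u) u ∘ (idm B ⊠ coev' u) ∘ rhoV B.
Proof. by rewrite /cup -lock. Qed.
(* The left tensor factor of a term of [chicheck]. *)
Definition chk1 (V W u B : C) (G : mor B (V ⊗ W)) (p : mor W u) : mor (B ⊗ dl u) V :=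
  rho V ∘ (idm V ⊠ ev' u) ∘ (idm V ⊠ (p ⊠ idm (dl u)))
  ∘ alpha V W (dl u) ∘ (G ⊠ idm (dl u)).

Lemma cupE A B u (h : mor A B) :
  ((h ⊠ idm (dl u)) ⊠ idm u) ∘ cup A u = cup B u ∘ h.
Proof.
rewrite !cupD !compA -alphaVEl (compE2 _ (tmor_exch _ _)).
by rewrite (compE2 _ (rhoVE _)).
Qed.

Lemma chk1_cup V W u B (G : mor B (V ⊗ W)) (p : mor W u) (q : mor u W) :
  (chk1 G p ⊠ q) ∘ cup B u = (idm V ⊠ (q ∘ p)) ∘ G.
Proof.
have zz : t20 (ev' u) u ∘ (idm u ⊠ coev' u) ∘ rhoV u = idm u.
  exact: (zag_of_tail (dz2 (opp_pair u))).
rewrite tmorRL -compA /chk1 (tmorCl u) -compA cupE !compA tmorCr; congr (_ ∘ _).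
rewrite -!compA; congr (_ ∘ _); rewrite cupD !tmorCl !compA.
rewrite (compE _ (pentagonV _ _ _ _)) !compA.
rewrite !(compE2 _ (esym (alphaVE _ _ _))) triangleVl.
rewrite (compE2 _ (alphaEr _ _ _)) rho_tobV !compA (compK _ (alphaVK _ _ _)).
rewrite !tmorCrV; congr (_ ⊠ _).
rewrite (compE2 _ (esym (alphaVEl _ _ _))) -t20E.
rewrite (compE2 _ (tmor_exch _ _)) (compE _ (rhoVE _)) !compA zz comp1m //.
Qed.

Lemma chk1_cap V W B u k (f : mor (B ⊗ dl u) V) (g : mor u W) (p : mor W k) :
  chk1 ((f ⊠ g) ∘ cup B u) p = chk1 ((f ⊠ (p ∘ g)) ∘ cup B u) (idm k).
Proof.
rewrite /chk1 tmor1 tmor1 compm1 !tmorCl !compA (compE2 _ (alphaE _ _ _)).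
rewrite (compE _ (esym (tmorC _ _ _ _))) tmorClV comp1m.
by rewrite (compE2 _ (alphaE _ _ _)).
Qed.

Lemma chk1_cup_id V B u (f : mor (B ⊗ dl u) V) :
  chk1 ((f ⊠ idm u) ∘ cup B u) (idm u) = f.
Proof.
have zz : rho (dl u) ∘ (idm (dl u) ⊠ ev' u) ∘ alpha (dl u) u (dl u) ∘ (coev' u ⊠ idm (dl u))
    ∘ lamV (dl u) = idm (dl u).
  exact: (zig_of_tail (dz1 (opp_pair u))).
rewrite /chk1 tmor1 tmor1 compm1 tmorCl !compA (compE2 _ (alphaEl _ _ _)).
rewrite (compE2 _ (tmor_exchV _ _)) rhoE -[RHS]compm1 -!compA; congr (_ ∘ _).
rewrite cupD !tmorCl !compA (compE _ (esym (pentagonM _ _ _ _))) !compA.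
rewrite (compE2 _ (alphaE _ _ _)) (compE _ (triangleV _ _)).
rewrite (compE2 _ (esym (alphaVEr _ _ _))) rho_tob (compK _ (alphaVK _ _ _)).
by rewrite !tmorCrV zz tmor1.
Qed.

Lemma chk1_lin V W u B (p : mor W u) : linear (fun G : mor B (V ⊗ W) => chk1 G p).
Proof.
by move=> a F G; rewrite /chk1 tmorDl tmorZl !compDr !compZr.
Qed.

Lemma chicheckE A M (g : mor A (Tob M)) :
  chicheck g = \sum_i \sum_m \sum_a (Dim C / qdim (simp i : C)) *:
    pel (i : pidx (Rob A : C2 C)) m
    (chk1 (proj (@Tsummand _ _ M) m ∘ g) (sbas (pr m) i a)) (sdbas (pr m) i a).
Proof.
rewrite /chicheck mk_pel; apply: eq_bigr => i _; apply: eq_bigr => m _.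
rewrite (lin_sum (tlift_lin _)); apply: eq_bigr => a _.
rewrite (linZ (tlift_lin _)) tlift_pure //; [exact: pel_linl | exact: pel_linr].
Qed.

Lemma chicheck_lin A M : linear (@chicheck K C A M).
Proof.
move=> a f g; rewrite !chicheckE scaler_sumr -big_split; apply: eq_bigr => m _ /=.
rewrite scaler_sumr -big_split; apply: eq_bigr => i _ /=.
rewrite scaler_sumr -big_split; apply: eq_bigr => b _ /=.
by rewrite compDr compZr chk1_lin pel_linl scalerDr !scalerA mulrC.
Qed.

(* [deltacheck] and the inverse of [chicheck] in closed form. *)
Definition dc (A : C) : mor A (Tob (Rob A)) :=
  \sum_i (qdim (simp i : C) / Dim C) *: (incl (@Tsummand _ _ (Rob A)) i ∘ cup A (simp i)).
Definition ctr A M (h : mor (Rob A : C2 C) M) : mor A (Tob M) := Tmor h ∘ dc A.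

Lemma ctr_lin A M : linear (@ctr A M).
Proof. by move=> a f g; rewrite /ctr Tmor_lin compDl compZl. Qed.

Lemma ctr_pel A M (i : label C) m f g :
  ctr (pel (i : pidx (Rob A : C2 C)) m f g : mor _ M) =
  (qdim (simp i : C) / Dim C) *: (incl (@Tsummand _ _ M) m ∘ (f ⊠ g) ∘ cup A (simp i)).
Proof.
rewrite /ctr Tmor_pel /dc comp_sumr (bigD1 i) //= compZr !compA.
rewrite (compK _ (proj_incl _ _)) big1 ?addr0 // => j ne.
by rewrite compZr !compA (compE _ (proj_incl0 _ ne)) comp0r !comp0l scaler0.
Qed.

Lemma ctr_chicheck A M (g : mor A (Tob M)) : ctr (chicheck g) = g.
Proof.
rewrite chicheckE (lin_sum (@ctr_lin A M)).
under eq_bigr => i _ do rewrite (lin_sum (@ctr_lin A M)).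
rewrite exchange_big -[RHS]comp1m -sum_incl_proj comp_suml; apply: eq_bigr => m _ /=.
have E : proj _ m ∘ g = (idm (pl m) ⊠ \sum_i \sum_a sdbas (pr m) i a ∘ sbas (pr m) i a)
    ∘ (proj (@Tsummand _ _ M) m ∘ g).
  by rewrite completeness tmor1 comp1m.
rewrite -[in RHS]compA [in RHS]E tmor_sumr comp_suml comp_sumr; apply: eq_bigr => i _.
rewrite (lin_sum (@ctr_lin A M)) tmor_sumr comp_suml comp_sumr; apply: eq_bigr => a _.
(* The weight [dim i / Dim C] of [dc] cancels the factor [Dim C / dim i] of [chicheck]; both numbers
   must be nonzero here. *)
rewrite (linZ (@ctr_lin A M)) ctr_pel scalerA mulrA divfK ?qdim_simp_neq0 //.
by rewrite divff ?Dim_neq0 // scale1r -compA chk1_cup.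
Qed.

Lemma chicheck_ctr A M (h : mor (Rob A : C2 C) M) : chicheck (ctr h) = h.
Proof.
apply: (mor_ext (lin_comp (@ctr_lin A M) (@chicheck_lin A M)) _ _ h) => // i m {h} f g.
have [c gE] := sdbas_decomp (V := pr m) (g : mor (simp i) _).
have h0 V W u B q : @chk1 V W u B 0 q = 0 by apply: (lin0 (chk1_lin _)).
rewrite ctr_pel (linZ (@chicheck_lin A M)) chicheckE.
rewrite (bigD1 i) //= [X in _ + X]big1 => [|k ne]; last first.
  apply: big1 => m' _; apply: big1 => a _.
  have [e|ne'] := eqVneq m m'; last first.
    by rewrite !compA (proj_incl0 _ ne') !comp0l h0 pel0l scaler0.
  subst m'; rewrite !compA proj_incl comp1m chk1_cap.
  rewrite [_ ∘ g](schur0 (i := i)) 1?eq_sym // tmor0r comp0l h0 pel0l scaler0 //.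
rewrite addr0 (bigD1 m) //= [X in _ + X]big1 => [|m' ne]; last first.
  apply: big1 => a _.
  by rewrite !compA (proj_incl0 _) 1?eq_sym // !comp0l h0 pel0l scaler0.
rewrite addr0 [in RHS]gE (lin_sum (pel_linr _)) scaler_sumr; apply: eq_bigr => a _.
rewrite !compA proj_incl comp1m chk1_cap.
have -> : sbas (pr m) i a ∘ (g : mor (simp i) _) = c a *: idm (simp i).
  rewrite gE comp_sumr (bigD1 a) //= compZr sbas_sdbas eqxx scale1r.
  rewrite big1 ?addr0 // => b ne.
  by rewrite compZr sbas_sdbas eq_sym (negPf ne) scale0r scaler0.
rewrite tmorZr compZl (linZ (chk1_lin _)) chk1_cup_id pelZl pelZr !scalerA.
by rewrite mulrA divfK ?Dim_neq0 // divff ?mul1r ?qdim_simp_neq0.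
Qed.

Lemma deltacheckE A : deltacheck A = dc A.
Proof.
have E : linfun (@chicheck K C A (Rob A)) =1 @chicheck K C A (Rob A).
  pose L := GRing.isLinear.Build K _ _ *:%R _ (@chicheck_lin A (Rob A)).
  pose h : {linear _ -> _} := HB.pack (@chicheck K C A (Rob A)) L.
  exact: (lfunE h).
have inj : lker (linfun (@chicheck K C A (Rob A))) == 0%VS.
  by apply/lker0P => f g; rewrite !E => /(congr1 (@ctr _ _)); rewrite !ctr_chicheck.
rewrite /deltacheck /chicheckV -[idm _]chicheck_ctr -E lker0_lfunK //.
by rewrite /ctr Tmor_id comp1m.
Qed.
End Check.

(** * Compatibility of [T] with the tensor products *)

Section Coherence.
Context {K : fieldType} {C : modular_data K} {HC : modular_laws C}.
Implicit Types M N P : C2 C.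

Lemma bigsum_ext (J : finType) (F : J -> C) X (f g : mor (bigsum F) X) :
  (forall j, f ∘ incl F j = g ∘ incl F j) -> f = g.
Proof.
move=> E; rewrite -[f]compm1 -[g]compm1 -sum_incl_proj !comp_sumr.
by apply: eq_bigr => j _; rewrite !compA E.
Qed.

Lemma t22_tail U V U' V' (c : mor (U ⊗ V : C) (U' ⊗ V')) Y Z :
  (idm U' ⊠ alpha V' Y Z) ∘ alpha U' (V' ⊗ Y) Z ∘ (t22 c Y ⊠ idm Z) =
  t22 c (Y ⊗ Z) ∘ (idm U ⊠ alpha V Y Z) ∘ alpha U (V ⊗ Y) Z.
Proof.
rewrite !t22E !tmorCl !compA -(pentagonE U' V' Y Z) (compE2 _ (alphaEl _ _ _)).
by rewrite (compE3 _ (pentagonM _ _ _ _)) !compA.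
Qed.

Lemma swapVE U V W X :
  swapV U V W X = alphaV U V (W ⊗ X) ∘ (idm U ⊠ br W V X) ∘ alpha U W (V ⊗ X) :> mor (_ : C) _.
Proof. by rewrite /swapV /br t22E. Qed.
Lemma swapE U V W X :
  swap U V W X = alphaV U W (V ⊗ X) ∘ (idm U ⊠ brV W V X) ∘ alpha U V (W ⊗ X) :> mor (_ : C) _.
Proof. by rewrite /swap /brV t22E. Qed.

Lemma brE3 V V' W W' X X' (g : mor (V : C) V') (h : mor (W : C) W') (k : mor (X : C) X') :
  br W' V' X' ∘ (h ⊠ (g ⊠ k)) = (g ⊠ (h ⊠ k)) ∘ br W V X.
Proof.
have -> : h ⊠ (g ⊠ k) = (h ⊠ (g ⊠ idm X')) ∘ (idm W ⊠ (idm V ⊠ k)).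
  by rewrite -!tmorC !compm1 comp1m.
rewrite compA brE -compA br_nat compA -!tmorC !compm1 comp1m //.
Qed.

Lemma swapV_nat U U' V V' W W' X X' (f : mor (U : C) U') (g : mor (V : C) V')
    (h : mor (W : C) W') (k : mor (X : C) X') :
  swapV U' V' W' X' ∘ ((f ⊠ h) ⊠ (g ⊠ k)) = ((f ⊠ g) ⊠ (h ⊠ k)) ∘ swapV U V W X.
Proof.
rewrite !swapVE !compA (compE2 _ (alphaE _ _ _)) -alphaVE.
have E : (idm U' ⊠ br W' V' X') ∘ (f ⊠ (h ⊠ (g ⊠ k))) =
    (f ⊠ (g ⊠ (h ⊠ k))) ∘ (idm U ⊠ br W V X).
  by rewrite -!tmorC brE3 comp1m compm1.
by rewrite (compE2 _ E).
Qed.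

Lemma swapK U V W X : swapV U V W X ∘ swap U V W X = idm (U ⊗ V ⊗ (W ⊗ X) : C).
Proof.
rewrite swapVE swapE !compA (compK _ (alphaVK _ _ _)).
by rewrite (compK _ (tmor_invr U (brVK _ _ _))) alphaK.
Qed.

(** Both sides are brought to a form where [W] crosses [U'] and then [V'], and [V] crosses [U'], in
    separate steps. One side gets there by [hexagonR], the other by [hexagonL]. *)
Lemma swapV_assoc U U' V V' W W' :
  alpha (U ⊗ U') (V ⊗ V') (W ⊗ W') ∘ (swapV U U' V V' ⊠ idm (W ⊗ W'))
    ∘ swapV (U ⊗ V) (U' ⊗ V') W W' =
  (idm (U ⊗ U') ⊠ swapV V V' W W') ∘ swapV U U' (V ⊗ W) (V' ⊗ W')
    ∘ (alpha U V W ⊠ alpha U' V' W') :> mor (_ : C) _.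
Proof.
apply: (retract_mono (alphaK U U' _)).
apply: (retract_mono (tmor_invr U (tmor_invr U' (alphaK V V' _)))).
rewrite !swapVE !compA.
transitivity ((idm U ⊠ br V U' (V' ⊗ (W ⊗ W'))) ∘ (idm U ⊠ (idm V ⊠ (idm U' ⊠ br W V' W')))
  ∘ (idm U ⊠ (idm V ⊠ br W U' (V' ⊗ W'))) ∘ (idm U ⊠ (idm V ⊠ (idm W ⊠ alpha U' V' W')))
  ∘ alpha U V (W ⊗ _) ∘ alpha (U ⊗ V) W _).
  rewrite !tmorCl !compA.
  rewrite (compE _ (pentagonE U U' (V ⊗ V') (W ⊗ W'))) !compA.
  rewrite (compK _ (tmor_invl _ (alphaVK _ _ _))) (compE2 _ (alphaE _ _ _)).
  rewrite (tmorCrV U) (tmorCrV U) (t22_tail (braid V U') V') !tmorCr.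
  rewrite (compE3 _ (esym (pentagonE _ _ _ _))) !compA (compK _ (alphaVK _ _ _)).
  rewrite (compE2 _ (alphaEr _ _ _)) (compE _ (tmorCrV U _ _)) (tmorCrV V) -hexagonR.
  by rewrite !tmorCr !compA.
rewrite (tmorLR (alpha U V W)) !compA (compE2 _ (alphaEr _ _ _)).
rewrite (compK _ (alphaVK _ _ _)) !tmorCr !compA.
rewrite (tmor_invr U (tmor_invr U' (alphaVK _ _ _))) comp1m.
rewrite [in RHS](compE _ (tmorCrV U _ _)) -hexagonL !tmorCr !compA.
rewrite [in RHS](compE3 _ (esym (pentagonE U V W _))) !compA.
rewrite [in RHS](compE2 _ (alphaEr _ _ _)) [in RHS](compE2 _ (alphaEr _ _ _)).
by rewrite (tmorCrV U) br_nat tmorCr.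
Qed.

Lemma psiT2_incl M N m n :
  psiT2 M N ∘ incl (@Tsummand _ _ (M ⊗ N)) (m, n) =
  (incl (@Tsummand _ _ M) m ⊠ incl (@Tsummand _ _ N) n)
  ∘ swapV (pl m) (pr m) (pl n) (pr n).
Proof.
rewrite /psiT2 comp_suml (bigD1 m) //= comp_suml (bigD1 n) //=.
rewrite (compK _ (proj_incl _ _)) !big1 ?addr0 // => [m' ne | n' ne].
  rewrite comp_suml big1 // => n' _.
  have ne' : (m, n) != (m', n') by rewrite xpair_eqE eq_sym (negPf ne).
  by rewrite (compE _ (proj_incl0 _ ne')) comp0r.
have ne' : (m, n) != (m, n') by rewrite xpair_eqE eqxx eq_sym (negPf ne).
by rewrite (compE _ (proj_incl0 _ ne')) comp0r.
Qed.

Lemma proj_psiT2 M N m n :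
  (proj (@Tsummand _ _ M) m ⊠ proj (@Tsummand _ _ N) n) ∘ psiT2 M N =
  swapV (pl m) (pr m) (pl n) (pr n) ∘ proj (@Tsummand _ _ (M ⊗ N)) (m, n).
Proof.
rewrite /psiT2 comp_sumr (bigD1 m) //= comp_sumr (bigD1 n) //= !compA.
rewrite -tmorC !proj_incl tmor1 comp1m !big1 ?addr0 // => [m' ne | n' ne].
  rewrite comp_sumr big1 // => n' _; rewrite !compA -tmorC.
  by rewrite (proj_incl0 _ ne) tmor0l !comp0l.
by rewrite !compA -tmorC (proj_incl0 _ ne) tmor0r !comp0l.
Qed.

Lemma psiT2_phiT2 M N : psiT2 M N ∘ phiT2 M N = idm _.
Proof.
rewrite /phiT2 comp_sumr -tmor1 -!sum_incl_proj tmor_suml; apply: eq_bigr => m _.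
rewrite comp_sumr tmor_sumr; apply: eq_bigr => n _.
by rewrite 2!compA psiT2_incl (compK _ (swapK _ _ _ _)) -tmorC.
Qed.

Lemma psiT2_nat M M' N N' (f : mor M M') (g : mor N N') :
  psiT2 M' N' ∘ Tmor (f ⊠ g) = (Tmor f ⊠ Tmor g) ∘ psiT2 M N.
Proof.
pattern f; match goal with |- (fun x => @?L x = @?R x) _ =>
  apply: (mor_ext (phi := L) (psi := R)) end => [a u v|a u v|m m' {f} f f'].
- by rewrite tmorDl tmorZl Tmor_lin compDr compZr.
- by rewrite Tmor_lin tmorDl tmorZl compDl compZl.
pattern g; match goal with |- (fun x => @?L x = @?R x) _ =>
  apply: (mor_ext (phi := L) (psi := R)) end => [a u v|a u v|n n' {g} g g'].
- by rewrite tmorDr tmorZr Tmor_lin compDr compZr.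
- by rewrite Tmor_lin tmorDr tmorZr compDl compZl.
rewrite pel_tmor !Tmor_pel !tmorC (compE _ (proj_psiT2 _ _)).
rewrite [LHS]compA [in LHS]compA [in LHS]psiT2_incl [RHS]compA.
by rewrite (compE2 _ (swapV_nat _ _ _ _)).
Qed.

(** Lets a morphism of [C2] be evaluated on a summand inside [Tmor], where the lemmas on [pel]
    apply. *)
Lemma Tmor_incl M N (F : mor M N) m :
  Tmor F ∘ incl (@Tsummand _ _ M) m =
  Tmor (F ∘ pel m m (idm (pl m)) (idm (pr m))) ∘ incl (@Tsummand _ _ M) m.
Proof.
by rewrite Tmor_comp Tmor_pel tmor1 compm1 (compE _ (compK _ (proj_incl _ _))).
Qed.

Lemma psiT2_assoc M N P :
  alpha (Tob M) (Tob N) (Tob P) ∘ (psiT2 M N ⊠ idm (Tob P)) ∘ psiT2 (M ⊗ N) P =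
  (idm (Tob M) ⊠ psiT2 N P) ∘ psiT2 M (N ⊗ P) ∘ Tmor (alpha M N P).
Proof.
apply: bigsum_ext => -[[m n] p]; rewrite -[RHS]compA Tmor_incl palpha_compl Tmor_pel.
rewrite !compm1 (compK _ (proj_incl _ _)).
have H := swapV_assoc (pl m) (pr m) (pl n) (pr n) (pl p) (pr p).
have e1 := psiT2_incl m n; have e4 := psiT2_incl n p.
have e2 : psiT2 (M ⊗ N) P ∘ incl _ (m, n, p) = (incl _ (m, n) ⊠ incl _ p) ∘
    swapV (pl m ⊗ pl n) (pr m ⊗ pr n) (pl p) (pr p) by apply: psiT2_incl.
have e3 : psiT2 M (N ⊗ P) ∘ incl _ (m, (n, p)) = (incl _ m ⊠ incl _ (n, p)) ∘
    swapV (pl m) (pr m) (pl n ⊗ pl p) (pr n ⊗ pr p) by apply: psiT2_incl.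
(* The crossings become variables governed by [H] and the equations [e1] to [e4], so that rewriting
   does not enter them. *)
move: H e1 e2 e3 e4.
move: (swapV (pl m) (pr m) (pl n) (pr n)) (swapV (pl m ⊗ pl n) _ _ _).
move: (swapV (pl n) (pr n) (pl p) (pr p)) (swapV (pl m) (pr m) (pl n ⊗ pl p) _).
move=> s3 s4 s1 s2 H e1 e2 e3 e4.
rewrite (compE _ e2) !compA (compE _ e3) !compA.
have E1 : (psiT2 M N ⊠ idm (Tob P)) ∘ (incl _ (m, n) ⊠ incl _ p) =
    ((incl _ m ⊠ incl _ n) ⊠ incl _ p) ∘ (s1 ⊠ idm _).
  by rewrite -!tmorC e1 comp1m compm1.
have E2 : (idm (Tob M) ⊠ psiT2 N P) ∘ (incl _ m ⊠ incl _ (n, p)) =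
    (incl _ m ⊠ (incl _ n ⊠ incl _ p)) ∘ (idm _ ⊠ s3).
  by rewrite -!tmorC e4 comp1m compm1.
rewrite E2 (compE _ E1) !compA alphaE -!compA; congr (_ ∘ _).
by rewrite !compA.
Qed.

Lemma psiT2_unitr M :
  (idm (Tob M) ⊠ psiT0 C) ∘ psiT2 M uob ∘ Tmor (rhoV M) = rhoV (Tob M).
Proof.
apply: bigsum_ext => m; rewrite -[LHS]compA Tmor_incl prhoV_compl Tmor_pel.
rewrite !compm1 (compK _ (proj_incl _ _)).
have e : psiT2 M uob ∘ incl _ (m, tt) = (incl _ m ⊠ incl (@Tsummand _ _ (uob : C2 C)) tt) ∘
    swapV (pl m) (pr m) uob uob by apply: psiT2_incl.
have H : (idm (pl m ⊗ pr m) ⊠ lam uob) ∘ swapV (pl m) (pr m) uob uob ∘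
    (rhoV (pl m) ⊠ rhoV (pr m)) = rhoV (pl m ⊗ pr m).
  rewrite swapVE !compA (tmorLR (rhoV _)) !compA (compE _ (triangleV _ _)).
  rewrite !(compE _ (tmorCrV _ _ _)) compA br_unitlV tmorCr !compA.
  rewrite (compE2 _ (alphaVEr _ _ _)) tmorCrV lamVK tmor1 comp1m.
  by rewrite rho_tobV.
move: e H; move: (swapV _ _ _ _) => s e H.
have E : (idm (Tob M) ⊠ psiT0 C) ∘ (incl _ m ⊠ incl _ tt) =
    (incl _ m ⊠ idm uob) ∘ (idm _ ⊠ lam uob).
  by rewrite -!tmorC comp1m compm1 comp1m /psiT0 (compK _ (proj_incl _ _)).
by rewrite compA (compE _ e) compA E (compE3 _ H) rhoVE.
Qed.

Lemma psiT2_unitl M :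
  (psiT0 C ⊠ idm (Tob M)) ∘ psiT2 uob M ∘ Tmor (lamV M) = lamV (Tob M).
Proof.
apply: bigsum_ext => m; rewrite -[LHS]compA Tmor_incl plamV_compl Tmor_pel.
rewrite !compm1 (compK _ (proj_incl _ _)).
have e : psiT2 uob M ∘ incl _ (tt, m) = (incl (@Tsummand _ _ (uob : C2 C)) tt ⊠ incl _ m) ∘
    swapV uob uob (pl m) (pr m) by apply: psiT2_incl.
have H : (lam uob ⊠ idm (pl m ⊗ pr m)) ∘ swapV uob uob (pl m) (pr m) ∘
    (lamV (pl m) ⊠ lamV (pr m)) = lamV (pl m ⊗ pr m).
  rewrite swapVE !compA (tmorLR (lamV _)) !compA -lam_tobV !compA.
  rewrite (compK _ (alphaVK _ _ _)) (compE2 _ (lamVE _)) -!compA.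
  rewrite br_unitrV !compA (compE _ (lam_tobV _ _)) tmorClV lamVK tmor1 comp1m //.
move: e H; move: (swapV _ _ _ _) => s e H.
have E : (psiT0 C ⊠ idm (Tob M)) ∘ (incl _ tt ⊠ incl _ m) =
    (idm uob ⊠ incl _ m) ∘ (lam uob ⊠ idm _).
  by rewrite -!tmorC comp1m compm1 comp1m /psiT0 (compK _ (proj_incl _ _)).
by rewrite compA (compE _ e) compA E (compE3 _ H) lamVE.
Qed.
End Coherence.

(** * The functor [R] on algebras and bimodules, and absolute simplicity *)

Section FunctorR.
Context {K : fieldType} {C : modular_data K} {HC : modular_laws C}.
Implicit Types (M N P Q : C2 C) (A B E F G H : C).

Lemma RmorE A B (f : mor A B) :
  Rmor f = \sum_i pel (i : pidx (Rob A : C2 C)) (i : pidx (Rob B : C2 C))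
    (f ⊠ idm (dualob (simp i))) (idm (simp i)).
Proof.
rewrite /Rmor mk_pel; apply: eq_bigr => i _; rewrite (bigD1 i) //= diag_entry_eq.
rewrite tlift_pure; [|move=> g; exact: (@pel_linl K C (Rob A) (Rob B) i i g)|move=> g; exact: (@pel_linr K C (Rob A) (Rob B) i i g)].
rewrite big1 ?addr0 // => j ne; rewrite diag_entry_neq 1?eq_sym //.
exact: (lin0 (tlift_lin _)).
Qed.

Lemma rh_nat A B (k : mor A B) : rh B ∘ Tmor (Rmor k) = k ∘ rh A.
Proof.
rewrite RmorE (lin_sum (@Tmor_lin _ _ _ _ _)) comp_sumr /rh comp_sumr.
apply: eq_bigr => i _; rewrite Tmor_pel comp_suml (bigD1 i) //= !compA.
rewrite (compK _ (proj_incl _ _)) capE big1 ?addr0 // => j ne.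
by rewrite eq_sym in ne; rewrite !compA (compE _ (proj_incl0 _ ne)) comp0r !comp0l.
Qed.

Lemma tr_comp M N A (g : mor N (Rob A : C2 C)) (h : mor M N) :
  tr (g ∘ h) = tr g ∘ Tmor h.
Proof. by rewrite /tr Tmor_comp compA. Qed.
Lemma tr_inj M A (f g : mor M (Rob A : C2 C)) : tr f = tr g -> f = g.
Proof. by move=> e; rewrite -(chihat_tr f) e chihat_tr. Qed.
Lemma tr_id A : tr (idm (Rob A : C2 C)) = rh A.
Proof. by rewrite /tr Tmor_id compm1. Qed.
Lemma tr_Rmor_comp M A B (k : mor A B) (g : mor M (Rob A : C2 C)) :
  tr (Rmor k ∘ g) = k ∘ tr g.
Proof. by rewrite /tr Tmor_comp compA rh_nat compA. Qed.
Lemma tr_Rmor A B (k : mor A B) : tr (Rmor k) = k ∘ rh A.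
Proof. by rewrite -[Rmor k]compm1 tr_Rmor_comp tr_id. Qed.

Lemma Rmor_comp A B E (g : mor B E) (f : mor A B) : Rmor (g ∘ f) = Rmor g ∘ Rmor f.
Proof. by apply: tr_inj; rewrite tr_Rmor_comp !tr_Rmor compA. Qed.
Lemma Rmor_id A : Rmor (idm A) = idm (Rob A : C2 C).
Proof. by apply: tr_inj; rewrite tr_Rmor tr_id comp1m. Qed.
Lemma Rmor_lin A B : linear (@Rmor K C A B).
Proof.
move=> a f g; apply: tr_inj.
by rewrite tr_Rmor (@tr_lin _ _ _ _ _) !tr_Rmor compDl compZl.
Qed.

Lemma cap_cup A u : cap A u ∘ cup A u = qdim u *: idm A.
Proof.
rewrite cupD capD !compA (compK _ (alphaVK _ _ _)) (compE _ (tmorCrV _ _ _)).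
rewrite (_ : ev u ∘ coev' u = qdim u *: idm uob); last exact: unit_scalar.
by rewrite tmorZr tmor1 compZr compm1 compZl rhoVK.
Qed.

(** The loop of [simp i] contributes [dim i], with the weight [dim i / Dim C] from [dc]; the squares
    add up to [Dim C]. *)
Lemma rh_dc A : rh A ∘ dc A = idm A.
Proof.
rewrite /rh /dc comp_suml (eq_bigr (fun i => (qdim (simp i : C) ^+ 2 / Dim C) *: idm A)).
  by rewrite -scaler_suml -mulr_suml -/(Dim C) divff ?Dim_neq0 // scale1r.
move=> i _; rewrite comp_sumr (bigD1 i) //= compZr compA (compK _ (proj_incl _ _)).
rewrite cap_cup scalerA big1 ?addr0 => [|j ne].
  by rewrite mulrAC -expr2.
by rewrite compZr compA (compE _ (proj_incl0 _ ne)) comp0r comp0l scaler0.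
Qed.
Lemma rh_epi A : is_epi (rh A).
Proof. exact: section_epi (rh_dc A). Qed.

Lemma Rmor_inj A B (f g : mor A B) : Rmor f = Rmor g -> f = g.
Proof. by move=> e; apply: (@rh_epi A); rewrite -!tr_Rmor e. Qed.

Lemma tr_phiR2 A B : tr (phiR2 A B) = (rh A ⊠ rh B) ∘ psiT2 (Rob A : C2 C) (Rob B).
Proof.
rewrite /phiR2 -compA !tr_Rmor_comp !rhohatE /deltahat tr_chihat compm1 //.
Qed.
Lemma tr_phiR0 : tr (phiR0 C) = psiT0 C.
Proof. exact: tr_chihat. Qed.

Lemma tr_prod M N A B E (k : mor (A ⊗ B) E) (p : mor M (Rob A : C2 C))
    (q : mor N (Rob B : C2 C)) :
  tr (Rmor k ∘ phiR2 A B ∘ (p ⊠ q)) = k ∘ (tr p ⊠ tr q) ∘ psiT2 M N.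
Proof.
rewrite -compA tr_Rmor_comp tr_comp tr_phiR2 (compE _ (psiT2_nat _ _)).
by rewrite /tr tmorC !compA.
Qed.
Lemma tr_prod1 A B E (k : mor (A ⊗ B) E) :
  tr (Rmor k ∘ phiR2 A B) = k ∘ (rh A ⊠ rh B) ∘ psiT2 _ _.
Proof. by rewrite tr_Rmor_comp tr_phiR2 compA. Qed.

(** Four different products are allowed, so that this one statement serves the algebra, both actions
    and their compatibility. *)
Lemma prod_assoc A B E F G H (j : mor (A ⊗ B) F) (k : mor (F ⊗ E) G)
    (j' : mor (B ⊗ E) H) (k' : mor (A ⊗ H) G) :
  k ∘ (j ⊠ idm E) = k' ∘ (idm A ⊠ j') ∘ alpha A B E ->
  Rmor k ∘ phiR2 F E ∘ ((Rmor j ∘ phiR2 A B) ⊠ idm (Rob E : C2 C)) =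
  Rmor k' ∘ phiR2 A H ∘ (idm (Rob A : C2 C) ⊠ (Rmor j' ∘ phiR2 B E)) ∘ alpha _ _ _.
Proof.
move=> e; apply: tr_inj; rewrite [LHS]tr_prod [RHS]tr_comp [in RHS]tr_prod !tr_prod1 !tr_id.
have -> : (j ∘ (rh A ⊠ rh B) ∘ psiT2 (Rob A : C2 C) (Rob B)) ⊠ rh E =
   (j ⊠ idm E) ∘ ((rh A ⊠ rh B) ⊠ rh E) ∘ (psiT2 _ _ ⊠ idm _).
  by rewrite -!tmorC comp1m compm1.
have -> : rh A ⊠ (j' ∘ (rh B ⊠ rh E) ∘ psiT2 (Rob B : C2 C) (Rob E)) =
   (idm A ⊠ j') ∘ (rh A ⊠ (rh B ⊠ rh E)) ∘ (idm _ ⊠ psiT2 _ _).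
  by rewrite -!tmorC comp1m compm1.
rewrite !compA e (compE3 _ (esym (psiT2_assoc _ _ _))) !compA.
by rewrite (compE2 _ (alphaE _ _ _)).
Qed.

Lemma prod_unitl A B E (u : mor uob A) (k : mor (A ⊗ B) E) (f : mor B E) :
  k ∘ (u ⊠ idm B) = f ∘ lam B ->
  Rmor k ∘ phiR2 A B ∘ ((Rmor u ∘ phiR0 C) ⊠ idm (Rob B : C2 C)) =
  Rmor f ∘ lam (Rob B : C2 C).
Proof.
move=> e; apply: (section_epi (lamK (Rob B : C2 C))); apply: tr_inj.
rewrite (compK _ (lamVK _)) tr_comp tr_prod tr_Rmor_comp tr_phiR0 tr_id tr_Rmor.
have -> : (u ∘ psiT0 C) ⊠ rh B = (u ⊠ idm B) ∘ (idm uob ⊠ rh B) ∘ (psiT0 C ⊠ idm _).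
  by rewrite -!tmorC !comp1m !compm1.
rewrite !compA e (compE2 _ (lamE _)).
by rewrite (compE3 _ (psiT2_unitl _)) (compK _ (lamVK _)).
Qed.

Lemma prod_unitr A B E (u : mor uob B) (k : mor (A ⊗ B) E) (f : mor A E) :
  k ∘ (idm A ⊠ u) = f ∘ rho A ->
  Rmor k ∘ phiR2 A B ∘ (idm (Rob A : C2 C) ⊠ (Rmor u ∘ phiR0 C)) =
  Rmor f ∘ rho (Rob A : C2 C).
Proof.
move=> e; apply: (section_epi (rhoK (Rob A : C2 C))); apply: tr_inj.
rewrite (compK _ (rhoVK _)) tr_comp tr_prod tr_Rmor_comp tr_phiR0 tr_id tr_Rmor.
have -> : rh A ⊠ (u ∘ psiT0 C) = (idm A ⊠ u) ∘ (rh A ⊠ idm uob) ∘ (idm _ ⊠ psiT0 C).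
  by rewrite -!tmorC !comp1m !compm1.
rewrite !compA e (compE2 _ (rhoE _)).
by rewrite (compE3 _ (psiT2_unitr _)) (compK _ (rhoVK _)).
Qed.

Lemma prod_nat A A' B B' E E' (f : mor A A') (g : mor B B') (h : mor E E')
    (k : mor (A ⊗ B) E) (k' : mor (A' ⊗ B') E') :
  h ∘ k = k' ∘ (f ⊠ g) ->
  Rmor h ∘ (Rmor k ∘ phiR2 A B) = Rmor k' ∘ phiR2 A' B' ∘ (Rmor f ⊠ Rmor g).
Proof.
move=> e; apply: tr_inj; rewrite tr_Rmor_comp tr_prod1 tr_prod !tr_Rmor tmorC !compA.
by rewrite e.
Qed.

Section Modules.
Variables (A : algebra C).
Hypothesis HA : algebra_laws A.

Definition Rbimodule (N : bimodule A) : bimodule (Ralg A) :=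
  @Bimodule K (C2 C) (Ralg A) (Rob N) (Rmor (lact N) ∘ phiR2 A N)
    (Rmor (ract N) ∘ phiR2 N A).

Lemma Rbimodule_laws (N : bimodule A) : bimodule_laws N -> bimodule_laws (Rbimodule N).
Proof.
case=> lm lu rm ru lr; split; rewrite /Rbimodule /=.
- exact: prod_assoc.
- by rewrite (prod_unitl (f := idm N)) ?comp1m // Rmor_id comp1m.
- exact: prod_assoc.
- by rewrite (prod_unitr (f := idm N)) ?comp1m // Rmor_id comp1m.
exact: prod_assoc.
Qed.

Lemma Ralg_laws : algebra_laws (Ralg A).
Proof.
have [l1 l2 l3 l4 l5] := Rbimodule_laws (regular_bimodule_laws HA).
by split.
Qed.

Lemma Rmor_bimodule_map (N M : bimodule A) (f : mor N M) :
  bimodule_map f -> @bimodule_map _ _ _ (Rbimodule N) (Rbimodule M) (Rmor f).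
Proof.
case=> fl fr; have := prod_nat fl; have := prod_nat fr.
by rewrite Rmor_id => *; split.
Qed.

Lemma idm_Ralg : idm (Ralg A : C2 C) = 0 -> idm A = 0.
Proof.
by move=> e; apply: Rmor_inj; rewrite (lin0 (@Rmor_lin A A)) Rmor_id.
Qed.

Lemma phiT0_psiT0 : phiT0 C ∘ psiT0 C = idm (Tob (uob : C2 C)).
Proof.
rewrite /phiT0 /psiT0 !compA (compK _ (lamK _)) -sum_incl_proj.
by rewrite (bigD1 tt) //= big1 ?addr0 // => -[].
Qed.

Lemma absolutely_simple_Ralg : absolutely_simple A <-> absolutely_simple (Ralg A).
Proof.
have [mA m1 m2] := HA; have [RA R1 R2] := Ralg_laws.
split=> /absolutely_simpleP[id0 H]; apply/absolutely_simpleP; split.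
- by move/idm_Ralg.
- move=> g [gl gr].
  pose x := g ∘ unt (Ralg A).
  (* [T] sends the unit to the unit up to [psiT0], so the value of [g] at the unit is a morphism
     [y : 1 -> A]. *)
  have [y trx] : exists y, tr x = y ∘ psiT0 C.
    by exists (tr x ∘ phiT0 C); rewrite -compA phiT0_psiT0 compm1.
  (* Left linearity makes [g] right multiplication by [y], right linearity makes it left
     multiplication. Both descriptions are images under [R]; faithfulness gives [f1 = f2], which is
     then linear on both sides. *)
  pose f1 := mul A ∘ (idm A ⊠ y) ∘ rhoV A.
  pose f2 := mul A ∘ (y ⊠ idm A) ∘ lamV A.
  have g1 : Rmor f1 = g.
    apply: tr_inj; rewrite tr_Rmor /f1.
    rewrite (left_linear_endo Ralg_laws gl) -/x.
    rewrite tr_comp tr_prod tr_id trx.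
    have -> : rh A ⊠ (y ∘ psiT0 C) = (idm A ⊠ y) ∘ (rh A ⊠ idm uob) ∘ (idm _ ⊠ psiT0 C).
      by rewrite -!tmorC !comp1m !compm1.
    by rewrite !compA (compE3 _ (psiT2_unitr _)) (compE2 _ (rhoVE _)).
  have g2 : Rmor f2 = g.
    apply: tr_inj; rewrite tr_Rmor /f2.
    rewrite (right_linear_endo Ralg_laws gr) -/x.
    rewrite tr_comp tr_prod tr_id trx.
    have -> : (y ∘ psiT0 C) ⊠ rh A = (y ⊠ idm A) ∘ (idm uob ⊠ rh A) ∘ (psiT0 C ⊠ idm _).
      by rewrite -!tmorC !comp1m !compm1.
    by rewrite !compA (compE3 _ (psiT2_unitl _)) (compE2 _ (lamVE _)).
  have f12 : f1 = f2 by apply: Rmor_inj; rewrite g1.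
  have [|c fc] := H f1.
    split=> /=.
      rewrite /f1 !tmorCr !compA -(compE2 _ (rhoVE _)) (compE2 _ (tmor_exchV _ _)).
      by rewrite mA (compE2 _ (alphaEr _ _ _)) rho_tobV !compA (compK _ (alphaVK _ _ _)).
    rewrite f12 /f2 !tmorCl !compA -(compE2 _ (lamVE _)) (compE2 _ (tmor_exch _ _)).
    by rewrite mA (compE2 _ (alphaEl _ _ _)) -lam_tobV !compA (compK _ (alphaVK _ _ _)).
  by exists c; rewrite -g1 fc (linZ (@Rmor_lin A A)) Rmor_id.
- by move=> e; apply: id0; rewrite -Rmor_id e (lin0 (@Rmor_lin A A)).
move=> f fP; have [c fc] := H _ (Rmor_bimodule_map fP).
by exists c; apply: Rmor_inj; rewrite fc (linZ (@Rmor_lin A A)) Rmor_id.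
Qed.
End Modules.
End FunctorR.

(** * Simplicity of A and R(A) *)

Section ActionMaps.
Context {K : fieldType} {D : mcat K}.
Context {HL : linear_category_laws D} {HM : monoidal_laws D}.
Variables (A : algebra D) (N : bimodule A) (f : mor N A).
Hypothesis fP : @bimodule_map _ _ A N (regular_bimodule A) f.

Lemma map_lact X (p : mor X A) : f ∘ (lact N ∘ (p ⊠ idm N)) = mul A ∘ (p ⊠ f).
Proof. by rewrite compA fP.1 -[LHS]compA -tmorC comp1m compm1. Qed.
Lemma map_ract X (p : mor X A) : f ∘ (ract N ∘ (idm N ⊠ p)) = mul A ∘ (f ⊠ p).
Proof. by rewrite compA fP.2 -[LHS]compA -tmorC comp1m compm1. Qed.

Lemma map_right_mult (u : mor uob N) : algebra_laws A -> f ∘ u = unt A ->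
  f ∘ (lact N ∘ (idm A ⊠ u) ∘ rhoV A) = idm A.
Proof.
case=> _ _ m2 fu; rewrite !compA fP.1 -[X in X ∘ _]compA -tmorCr fu m2.
exact: rhoVK.
Qed.
End ActionMaps.

Section Simplicity.
Context {K : fieldType} {C : modular_data K} {HC : modular_laws C}.
Variables (A : algebra C) (HA : algebra_laws A).

(** A mono of bimodules splits in [C], so [Rmor] keeps it mono. If its image is invertible, the
    image of the splitting is the inverse, and faithfulness brings this back to [C]. *)
Lemma simple_of_simple_Ralg : simple_algebra (Ralg A) -> simple_algebra A.
Proof.
move=> [id0 H]; split.
  by move=> e; apply: id0; rewrite -[LHS]Rmor_id e (lin0 (@Rmor_lin _ _ _ A A)).
move=> N NL f fP fM.
have [s sf] := mono_split (bimodule_mono_mono HA NL fP fM).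
have RsRf : Rmor s ∘ Rmor f = idm (Rob N : C2 C) by rewrite -Rmor_comp sf Rmor_id.
have Rm : @bimodule_mono _ _ _ (Rbimodule N) (Rbimodule (regular_bimodule A)) (Rmor f).
  by apply: mono_bimodule_mono; apply: (retract_mono RsRf).
have := H _ (Rbimodule_laws NL) _ (Rmor_bimodule_map fP) Rm.
case=> [e|[g [_ fg]]].
  by left; apply: Rmor_inj; rewrite e (lin0 (@Rmor_lin _ _ _ N A)).
right; exists s; split=> //; apply: Rmor_inj; rewrite Rmor_comp Rmor_id.
by rewrite -[Rmor s]compm1 -fg (compA g) RsRf comp1m.
Qed.

(** [X] carries no action: being an ideal is expressed by products with [t] factoring through [t].
    This makes the split image a subbimodule, which is zero or everything. *)
Lemma ideal_zero_or_split X (t : mor X A) L L' : simple_algebra A ->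
  mul A ∘ (idm A ⊠ t) = t ∘ L -> mul A ∘ (t ⊠ idm A) = t ∘ L' ->
  t = 0 \/ exists s, t ∘ s = idm A.
Proof.
move=> [_ H] LP RP; have [I [i [p [s [pi ipf ip]]]]] := image_split t.
have isi : i = t ∘ (s ∘ i) by rewrite compA -ip -compA pi compm1.
have il : i ∘ p ∘ mul A ∘ (idm A ⊠ i) = mul A ∘ (idm A ⊠ i).
  by rewrite [in idm A ⊠ i]isi !tmorCr !compA (compE _ LP) LP !compA ipf.
have ir : i ∘ p ∘ mul A ∘ (i ⊠ idm A) = mul A ∘ (i ⊠ idm A).
  by rewrite [in i ⊠ idm A]isi !tmorCl !compA (compE _ RP) RP !compA ipf.
have HB := regular_bimodule_laws HA.
case: (H _ (sub_bimodule_laws HB pi il ir) i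
  (sub_bimodule_incl (M := regular_bimodule A) il ir)).
- by apply: mono_bimodule_mono; exact: retract_mono pi.
- by move=> i0; left; rewrite -ipf i0 !comp0l.
case=> j [ji ij]; right; exists s; rewrite -ip -ij.
by congr (_ ∘ _); rewrite -[p]compm1 -ij compA pi comp1m.
Qed.

(* The component of [Hom(1, M ⊗ Q)], [Q = ⊕ W x W^], that the pairing of
   [W] with its dual turns back into a given [y : 1 -> T M]. *)
Section Unbend.
Variables (M : C2 C) (y : mor uob (Tob M)).
Definition unbend_ob : C2 C :=
  @PairSum K C (pidx M) (fun n => pr n) (fun n => dualob (pr n)).
Definition unbend_pairing : mor (Tob unbend_ob) (uob : C) :=
  \sum_n ev0 (pr (n : pidx M)) ∘ proj (@Tsummand _ _ unbend_ob) n.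
Definition unbend : mor (uob : C2 C) (M ⊗ unbend_ob) :=
  \sum_n @pel K C (uob : C2 C) (M ⊗ unbend_ob) tt (n, n)
    (proj (@Tsummand _ _ M) n ∘ y) (coev (pr n)).

(** The reason for pairing with [ev0]: [psiT2] braids the two copies of [W], and with [ev0] the
    resulting curl is straight, whereas [ev'] would leave a twist. *)
Lemma kink_unit W :
  (idm W ⊠ ev0 W) ∘ br W W (dualob W) ∘ (idm W ⊠ coev W) = idm (W ⊗ uob : C).
Proof.
rewrite -(kink W uob) t20_unit t02_unit !tmorCr !compA.
rewrite [in RHS](compE2 _ (br_nat _ _ _)).
by rewrite (compK _ (tmor_invr W (tmor_invr W (rhoVK _)))).
Qed.

Lemma unbendP :
  (idm (Tob M) ⊠ unbend_pairing) ∘ psiT2 M unbend_ob ∘ Tmor unbend =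
  rhoV (Tob M) ∘ y ∘ psiT0 C.
Proof.
rewrite /unbend (lin_sum (@Tmor_lin _ _ _ _ _)) comp_sumr.
have term n : (idm (Tob M) ⊠ unbend_pairing) ∘ psiT2 M unbend_ob ∘
    Tmor (@pel K C (uob : C2 C) (M ⊗ unbend_ob) tt (n, n)
      (proj (@Tsummand _ _ M) n ∘ y) (coev (pr n))) =
    ((incl _ n ∘ proj (@Tsummand _ _ M) n ∘ y) ⊠ idm uob) ∘ proj _ tt.
  rewrite Tmor_pel.
  have e : psiT2 M unbend_ob ∘ incl _ (n, n) = (incl _ n ⊠ incl (@Tsummand _ _ unbend_ob) n) ∘
    swapV (pl n) (pr n) (pr n) (dualob (pr n)) by apply: psiT2_incl.
  set yn := proj _ n ∘ y.
  have H : (idm (pl n ⊗ pr n) ⊠ ev0 (pr n)) ∘ swapV (pl n) (pr n) (pr n) (dualob (pr n))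
      ∘ (yn ⊠ coev (pr n)) = yn ⊠ idm uob.
    rewrite swapVE !compA (tmorRL yn) !compA (compE2 _ (alphaEr _ _ _)).
    rewrite -alphaVEr !(compE _ (tmorCrV (pl n) _ _)) compA kink_unit.
    by rewrite tmor1 compm1 alphaK comp1m.
  move: e H; move: (swapV _ _ _ _) => s e H.
  have E : (idm (Tob M) ⊠ unbend_pairing) ∘ (incl _ n ⊠ incl _ n) =
      (incl _ n ⊠ idm uob) ∘ (idm _ ⊠ ev0 (pr n)).
    rewrite -!tmorC comp1m compm1 comp1m; congr (_ ⊠ _).
    rewrite /unbend_pairing comp_suml (bigD1 n) //= (compK _ (proj_incl _ _)).
    rewrite big1 ?addr0 // => m ne; rewrite eq_sym in ne.
    by rewrite (compE _ (proj_incl0 _ ne)) comp0r.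
  rewrite 2!compA (compE _ e) compA E (compE3 _ H).
  by rewrite tmorClV compA.
rewrite (eq_bigr _ (fun n _ => term n)) -comp_suml -tmor_suml -comp_suml.
have E : y ⊠ idm uob = rhoV _ ∘ y ∘ rho uob.
  by rewrite -[LHS]comp1m -rhoK -[LHS]compA rhoE compA.
by rewrite sum_incl_proj comp1m /psiT0 lam_rho_unit E compA.
Qed.
End Unbend.

(* The image of the transpose of [f] is an ideal, as the transpose of the
   inclusion of [A x 1] in [R(A)] is split epi. *)
Section Ideal.
Variables (N : bimodule (Ralg A)) (f : mor N (Ralg A)).
Hypothesis fP : @bimodule_map _ _ (Ralg A) N (regular_bimodule (Ralg A)) f.

Definition pure_ob : C2 C := @PairSum K C unit (fun=> A : C) (fun=> uob).
Definition pure_map : mor pure_ob (Rob A : C2 C) :=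
  chihat (rho A ∘ proj (@Tsummand _ _ pure_ob) tt).
Definition pure_sec : mor A (Tob pure_ob) :=
  incl (@Tsummand _ _ pure_ob) tt ∘ rhoV A.

Lemma pure_secK : tr pure_map ∘ pure_sec = idm A.
Proof.
by rewrite tr_chihat /pure_sec compA (compK _ (proj_incl _ _)) rhoVK.
Qed.

Lemma tr_left_ideal : exists L, mul A ∘ (idm A ⊠ tr f) = tr f ∘ L.
Proof.
have e : mul A ∘ (tr pure_map ⊠ tr f) = tr f ∘ Tmor (lact N ∘ (pure_map ⊠ idm _)) ∘ phiT2 pure_ob N.
  have := congr1 (@tr _ _ _ _) (map_lact fP pure_map).
  rewrite tr_comp => ->; rewrite [X in _ = X ∘ _]tr_prod.
  by rewrite (compK _ (psiT2_phiT2 _ _)).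
exists (Tmor (lact N ∘ (pure_map ⊠ idm _)) ∘ phiT2 pure_ob N ∘ (pure_sec ⊠ idm _)).
by rewrite !compA -e -compA -tmorC compm1 pure_secK.
Qed.
Lemma tr_right_ideal : exists L, mul A ∘ (tr f ⊠ idm A) = tr f ∘ L.
Proof.
have e : mul A ∘ (tr f ⊠ tr pure_map) = tr f ∘ Tmor (ract N ∘ (idm _ ⊠ pure_map)) ∘ phiT2 N pure_ob.
  have := congr1 (@tr _ _ _ _) (map_ract fP pure_map).
  rewrite tr_comp => ->; rewrite [X in _ = X ∘ _]tr_prod.
  by rewrite (compK _ (psiT2_phiT2 _ _)).
exists (Tmor (ract N ∘ (idm _ ⊠ pure_map)) ∘ phiT2 N pure_ob ∘ (idm _ ⊠ pure_sec)).
by rewrite !compA -e -compA -tmorC compm1 pure_secK.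
Qed.

Lemma tr_zero_or_split : simple_algebra A ->
  f = 0 \/ exists s, tr f ∘ s = idm A.
Proof.
move=> simpleA; have [L LP] := tr_left_ideal; have [L' RP] := tr_right_ideal.
have [e|] := ideal_zero_or_split simpleA LP RP; last by right.
by left; apply: tr_inj; rewrite e (lin0 (@tr_lin _ _ _ _ _)).
Qed.
End Ideal.

Lemma simple_Ralg_of_simple : simple_algebra A -> simple_algebra (Ralg A).
Proof.
move=> simpleA; split; first by move=> e; apply: simpleA.1; exact: idm_Ralg.
move=> N NL f fP fm; have RA := Ralg_laws (HC := HC) HA.
have [|[s tfs]] := tr_zero_or_split fP simpleA; [by left|right].
have fM : is_mono f.
  by apply: (bimodule_mono_mono RA NL fP fm).
pose y := s ∘ unt A.
(* The transpose of [e] is the pairing followed by the unit of [A], so acting by [e] closes off the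
   extra factor of [unbend y]. *)
pose q : mor (unbend_ob N) (Rob uob : C2 C) := chihat (unbend_pairing N).
pose e : mor (unbend_ob N) (Ralg A : C2 C) := Rmor (unt A) ∘ q.
pose u := ract N ∘ (idm (bob N) ⊠ e) ∘ unbend y.
have fu : f ∘ u = unt (Ralg A).
  have fe : f ∘ u = Rmor (mul A) ∘ phiR2 A A ∘ (f ⊠ e) ∘ unbend y.
    by rewrite /u -[RHS]/(mul (Ralg A) ∘ (f ⊠ e) ∘ _) -(map_ract fP) compA.
  apply: tr_inj; rewrite fe tr_comp tr_prod.
  have -> : tr e = unt A ∘ unbend_pairing N by rewrite tr_Rmor_comp tr_chihat.
  move: (tr f) tfs => t ts.
  have -> : t ⊠ (unt A ∘ unbend_pairing N) =
      (idm A ⊠ unt A) ∘ (t ⊠ idm uob) ∘ (idm _ ⊠ unbend_pairing N).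
    by rewrite -!tmorC !comp1m !compm1.
  rewrite !compA (mul_unitr HA) rhoE (compE3 _ (unbendP _)) !compA.
  by rewrite (compK _ (rhoVK _)) ts comp1m [RHS]tr_Rmor_comp tr_phiR0 [RHS]compA.
have fs : f ∘ (lact N ∘ (idm _ ⊠ u) ∘ rhoV _) = idm (Ralg A : C2 C).
  by apply: (map_right_mult fP).
exists (lact N ∘ (idm _ ⊠ u) ∘ rhoV _); split=> //.
by apply: fM; rewrite [LHS]compA fs comp1m compm1.
Qed.
End Simplicity.

(** * Specialness of A and R(A) *)

Section Special.
Context {K : fieldType} {C : modular_data K} {HC : modular_laws C}.
Implicit Types (M N : C2 C) (A B E k u v X : C).
Local Notation dl := dualob.

Lemma hat1_precomp V V' W u B (F : mor (V' ⊗ W : C) B) (q : mor u W) (s : mor V V') :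
  hat1 F q ∘ s = hat1 (F ∘ (s ⊠ idm W)) q.
Proof.
rewrite /hat1 -[LHS]compA -rhoVE !compA !(compE2 _ (tmor_exchV _ _)).
by rewrite (compE2 _ (alphaVEl _ _ _)) tmorClV.
Qed.

(** For this special [F] the cap of [P] meets the cup of [k], and together they transpose [q]. *)
Lemma hat1_dual E X (P : dpair X) k (q : mor k X) :
  hat1 (rho E ∘ (idm E ⊠ de P) ∘ alpha E (dd P) X) q =
  idm E ⊠ gdual (std_pair k) P q.
Proof.
rewrite /hat1 /gdual !tmorCl (compE _ (pentagonV _ _ _ _)) !compA.
rewrite (compE2 _ (esym (alphaVE _ _ _))) triangleVl.
rewrite 2!(compE2 _ (alphaEr _ _ _)).
by rewrite rho_tobV !compA (compK _ (alphaVK _ _ _)) t20E !tmorCr !compA.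
Qed.

(** The transpose of [q] slides through the cup and becomes [q] on the other leg, where [p] cancels
    it. *)
Lemma cup_dual E X (P : dpair X) k (q : mor k X) (p : mor X k) :
  p ∘ q = idm k ->
  ((idm E ⊠ gdual (std_pair k) P q) ⊠ p) ∘
    (alphaV E (dd P) X ∘ (idm E ⊠ db' P) ∘ rhoV E) = cup E k.
Proof.
move=> pq; rewrite cupD 2!compA -alphaVE.
rewrite (compE _ (tmorCrV _ _ _)) (tmorRL (gdual _ _ _)) -[_ ⊠ _ ∘ _ ∘ db' _]compA.
by rewrite (gdual_db' (std_pair k) P q) compA tmorCrV pq tmor1 comp1m.
Qed.

Lemma alphaV_whisker U V W X :
  (alphaV U V W ⊠ idm X) ∘ alphaV U (V ⊗ W) X =
  alphaV (U ⊗ V) W X ∘ alphaV U V (W ⊗ X) ∘ (idm U ⊠ alpha V W X) :> mor (_ : C) _.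
Proof. by rewrite pentagonVV (compK _ (tmor_invr U (alphaK V W X))). Qed.

Lemma cup_tail A u Z :
  alpha (A ⊗ dl u) u Z ∘ (cup A u ⊠ idm Z) =
  alphaV A (dl u) (u ⊗ Z) ∘ (idm A ⊠ t02 (coev' u) Z).
Proof.
rewrite cupD !tmorCl !compA -pentagonM (compE2 _ (alphaE _ _ _)).
by rewrite (compE _ (triangleV _ _)) t02E !tmorCr !compA.
Qed.
Lemma cap_tail A u Z :
  (cap A u ⊠ idm Z) ∘ alphaV (A ⊗ dl u) u Z ∘ alphaV A (dl u) (u ⊗ Z) =
  idm A ⊠ t20 (ev u) Z.
Proof.
rewrite capD !tmorCl (compE _ (pentagonV _ _ _ _)) !compA.
rewrite (compK _ (alphaVK _ _ _)) (compE2 _ (esym (alphaVE _ _ _))) triangleVl.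
by rewrite t20E !tmorCr.
Qed.

Section Strands.
Variables (A B u v : C).
Local Notation Y := ((A ⊗ dl u) ⊗ (B ⊗ dl v)).
Local Notation PQ := (nest (std_pair u) (std_pair v)).

(* Passes [B ⊗ v^] over [u^], so that parallel cups (caps) become nested. *)
Definition unshuffle : mor ((A ⊗ B) ⊗ (dl v ⊗ dl u)) Y :=
  alphaV A (dl u) (B ⊗ dl v) ∘
  (idm A ⊠ (braid (B ⊗ dl v) (dl u) ∘ alphaV B (dl v) (dl u))) ∘
  alpha A B (dl v ⊗ dl u).

Lemma unshuffle_tail X :
  (unshuffle ⊠ idm X) ∘ alphaV (A ⊗ B) (dl v ⊗ dl u) X ∘ alphaV A B (dl v ⊗ dl u ⊗ X) =
  alphaV (A ⊗ dl u) (B ⊗ dl v) X ∘ alphaV A (dl u) (B ⊗ dl v ⊗ X) ∘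
  (idm A ⊠ (br (B ⊗ dl v) (dl u) X ∘ alphaV B (dl v) (dl u ⊗ X)
            ∘ (idm B ⊠ alpha (dl v) (dl u) X))).
Proof.
rewrite /unshuffle !tmorCl (compE _ (pentagonV _ _ _ _)) !compA.
rewrite (compK _ (alphaVK _ _ _)) (compE2 _ (esym (alphaVE _ _ _))).
rewrite alphaV_whisker -!compA; do 2! congr (_ ∘ _); rewrite !tmorCrV.
congr (_ ⊠ _); rewrite /br t22E tmorCl -!compA; do 2! congr (_ ∘ _).
by rewrite alphaV_whisker !compA.
Qed.

Lemma swap_cups :
  swap (A ⊗ dl u) u (B ⊗ dl v) v ∘ (cup A u ⊠ cup B v) =
  (unshuffle ⊠ idm (u ⊗ v)) ∘
  (alphaV (A ⊗ B) (dl v ⊗ dl u) (u ⊗ v) ∘ (idm (A ⊗ B) ⊠ db' PQ) ∘ rhoV (A ⊗ B)).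
Proof.
rewrite rho_tobV !compA (compE2 _ (esym (alphaVEr _ _ _))) unshuffle_tail.
rewrite swapE (tmorLR (cup A u)) !compA (compE _ (cup_tail _ _ _)) !compA.
rewrite (compE2 _ (esym (alphaVEr _ _ _))) -!compA; do 2! congr (_ ∘ _).
rewrite !tmorCrV; congr (_ ⊠ _).
rewrite -(cup_slide (B ⊗ dl v) (coev' u)) !compA (tmor_invr _ (brK _ _ _)) comp1m.
rewrite nest_db' /nestb cupD !tmorCr !compA.
rewrite (compK _ (tmor_invr B (alphaVK _ _ _))).
by rewrite -(compE2 _ (alphaVEr _ _ _)).
Qed.

Lemma caps_swapV :
  (cap A u ⊠ cap B v) ∘ swapV (A ⊗ dl u) u (B ⊗ dl v) v ∘ (unshuffle ⊠ idm (u ⊗ v)) =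
  rho (A ⊗ B) ∘ (idm (A ⊗ B) ⊠ de PQ) ∘ alpha (A ⊗ B) (dl v ⊗ dl u) (u ⊗ v).
Proof.
rewrite swapVE; apply: (section_epi (alphaK (A ⊗ B) (dl v ⊗ dl u) (u ⊗ v))).
rewrite [RHS](compK _ (alphaVK _ _ _)).
apply: (section_epi (alphaK A B (dl v ⊗ dl u ⊗ (u ⊗ v)))).
rewrite (compE3 _ (unshuffle_tail _)) -[RHS]compA -alphaVEr rho_tob !compA.
rewrite !(compK _ (alphaVK _ _ _)) (tmorRL (cap A u)).
rewrite -(compE2 _ (alphaVEr _ _ _)) (compE3 _ (cap_tail _ _ _)) !tmorCrV.
congr (_ ⊠ _); rewrite !compA (compE3 _ (cap_slide _ _ _)).
rewrite -(compE2 _ (alphaVEr _ _ _)) capD (compK _ (alphaVK _ _ _)) /= /nest_e.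
by rewrite !tmorCr !compA.
Qed.

(* Two parallel strands [u], [v] pinched to a summand [k] of [u ⊗ v]. *)
Lemma pinch_cups k (q : mor k (u ⊗ v)) (p : mor (u ⊗ v) k) : p ∘ q = idm k ->
  (hat1 ((cap A u ⊠ cap B v) ∘ swapV (A ⊗ dl u) u (B ⊗ dl v) v) q ⊠ p)
    ∘ swap (A ⊗ dl u) u (B ⊗ dl v) v ∘ (cup A u ⊠ cup B v) = cup (A ⊗ B) k.
Proof.
move=> pq; rewrite -compA swap_cups.
move: caps_swapV; move: (_ ∘ swapV _ _ _ _) => G GE.
rewrite compA -tmorC compm1 hat1_precomp GE (hat1_dual _ PQ).
exact: (@cup_dual (A ⊗ B) _ PQ _ q p pq).
Qed.
End Strands.

Lemma dc_nat A B (f : mor A B) : Tmor (Rmor f) ∘ dc A = dc B ∘ f.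
Proof.
rewrite RmorE (lin_sum (@Tmor_lin _ _ _ _ _)) comp_suml /dc comp_suml.
apply: eq_bigr => i _; rewrite Tmor_pel comp_sumr (bigD1 i) //= compZr compZl !compA.
rewrite (compK _ (proj_incl _ _)) (compE _ (cupE _ _)) !compA big1 ?addr0 // => j ne.
by rewrite compZr !compA (compE _ (proj_incl0 _ ne)) comp0r !comp0l scaler0.
Qed.

Lemma ctr_comp A M N (g : mor M N) (h : mor (Rob A : C2 C) M) :
  ctr (g ∘ h) = Tmor g ∘ ctr h.
Proof. by rewrite /ctr Tmor_comp !compA. Qed.
Lemma ctr_Rmor_comp A B M (h : mor (Rob B : C2 C) M) (f : mor A B) :
  ctr (h ∘ Rmor f) = ctr h ∘ f.
Proof. by rewrite /ctr Tmor_comp -!compA dc_nat. Qed.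

Lemma ctr_inj A M (f g : mor (Rob A : C2 C) M) : ctr f = ctr g -> f = g.
Proof. by move=> e; rewrite -(chicheck_ctr f) e chicheck_ctr. Qed.

Lemma ctr_psiR2 A B : ctr (psiR2 A B) = phiT2 (Rob A) (Rob B) ∘ (dc A ⊠ dc B).
Proof.
rewrite /psiR2 !ctr_Rmor_comp !deltacheckE /rhocheck ctr_chicheck comp1m //.
Qed.

Lemma proj_phiT2 M N m n :
  proj (@Tsummand _ _ (M ⊗ N)) (m, n) ∘ phiT2 M N =
  swap (pl m) (pr m) (pl n) (pr n) ∘
    (proj (@Tsummand _ _ M) m ⊠ proj (@Tsummand _ _ N) n).
Proof.
rewrite /phiT2 comp_sumr (bigD1 m) //= comp_sumr (bigD1 n) //= !compA.
rewrite proj_incl comp1m !big1 ?addr0 // => [m' ne | n' ne].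
  rewrite comp_sumr big1 // => n' _; rewrite !compA.
  have ne' : (m', n') != (m, n) by rewrite xpair_eqE (negPf ne).
  by rewrite (proj_incl0 _ ne') !comp0l.
have ne' : (m, n') != (m, n) by rewrite xpair_eqE eqxx (negPf ne).
by rewrite !compA (proj_incl0 _ ne') !comp0l.
Qed.

Lemma proj_dc A (i : label C) :
  proj (@Tsummand _ _ (Rob A)) i ∘ dc A = (qdim (simp i : C) / Dim C) *: cup A (simp i).
Proof.
rewrite /dc comp_sumr (bigD1 i) //= compZr compA proj_incl comp1m big1 ?addr0 // => j ne.
by rewrite compZr compA (proj_incl0 _ ne) comp0l scaler0.
Qed.

Lemma rh_incl A (i : label C) :
  rh A ∘ incl (@Tsummand _ _ (Rob A)) i = cap A (simp i).
Proof.
rewrite /rh comp_suml (bigD1 i) //= (compK _ (proj_incl _ _)) big1 ?addr0 // => j ne.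
by rewrite eq_sym in ne; rewrite (compE _ (proj_incl0 _ ne)) comp0r.
Qed.

(** The contribution of one channel [a] from [simp i ⊗ simp j] to [simp k]. By [pinch_cups] it is
    the same for all [a], so only the number of channels enters the sum. *)
Lemma pinch_phiR2 A B (i j k : label C) (a : 'I_(\dim {: mor (simp i ⊗ simp j : C) (simp k)})) :
  Tmor (@pel K C (Rob A ⊗ Rob B : C2 C) (Rob (A ⊗ B)) (i, j) k
      (hat1 ((rh A ⊠ rh B) ∘ psiT2 (Rob A) (Rob B)
               ∘ incl (@Tsummand _ _ (Rob A ⊗ Rob B)) (i, j)) (sdbas _ k a))
      (sbas (simp i ⊗ simp j) k a))
    ∘ (phiT2 (Rob A) (Rob B) ∘ (dc A ⊠ dc B)) =
  (qdim (simp i : C) / Dim C * (qdim (simp j : C) / Dim C)) *: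
    (incl (@Tsummand _ _ (Rob (A ⊗ B))) k ∘ cup (A ⊗ B) (simp k)).
Proof.
have pq : sbas (simp i ⊗ simp j) k a ∘ sdbas _ k a = idm (simp k : C).
  by rewrite sbas_sdbas eqxx scale1r.
have E : (rh A ⊠ rh B) ∘ psiT2 (Rob A) (Rob B) ∘ incl _ (i, j) =
    (cap A (simp i) ⊠ cap B (simp j)) ∘ swapV (A ⊗ dl (simp i)) (simp i) (B ⊗ dl (simp j)) (simp j).
  by rewrite -[LHS]compA psiT2_incl [LHS]compA -tmorC !rh_incl.
rewrite E Tmor_pel; have := pinch_cups A B pq.
have P : proj _ (i, j) ∘ (phiT2 (Rob A) (Rob B) ∘ (dc A ⊠ dc B)) =
    (qdim (simp i : C) / Dim C * (qdim (simp j : C) / Dim C)) *: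
    (swap (A ⊗ dl (simp i)) (simp i) (B ⊗ dl (simp j)) (simp j) ∘ (cup A (simp i) ⊠ cup B (simp j))).
  rewrite [LHS]compA proj_phiT2 -[LHS]compA -tmorC !proj_dc tmorZl tmorZr.
  by rewrite !compZr scalerA.
rewrite -[X in _ -> X = _]compA P; move: (swapV _ _ _ _) (swap _ _ _ _) => s' s H.
by rewrite compZr -H !compA.
Qed.

Lemma phiR2_psiR2 A B : phiR2 A B ∘ psiR2 A B = idm (Rob (A ⊗ B) : C2 C).
Proof.
apply: ctr_inj; rewrite ctr_comp ctr_psiR2 /ctr Tmor_id comp1m.
(* As [chihat] of its transpose, [phiR2] is an explicit sum over labels and basis elements. *)
rewrite -[phiR2 A B]chihat_tr tr_phiR2 chihatE (lin_sum (@Tmor_lin _ _ _ _ _)).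
rewrite comp_suml.
pose Z (k : label C) := incl (@Tsummand _ _ (Rob (A ⊗ B))) k ∘ cup (A ⊗ B) (simp k).
transitivity (\sum_(x : label C * label C) \sum_(k : label C)
  (qdim (simp x.1 : C) / Dim C * (qdim (simp x.2 : C) / Dim C) *
   (\dim {: mor (simp x.1 ⊗ simp x.2 : C) (simp k)})%:R) *: Z k).
  apply: eq_bigr => -[i j] _; rewrite (lin_sum (@Tmor_lin _ _ _ _ _)) comp_suml.
  apply: eq_bigr => k _; rewrite (lin_sum (@Tmor_lin _ _ _ _ _)) comp_suml.
  rewrite (eq_bigr (fun=> (qdim (simp i : C) / Dim C * (qdim (simp j : C) / Dim C)) *: Z k)).
    by rewrite sumr_const card_ord -scaler_nat scalerA mulrC.
  by move=> a _; exact: pinch_phiR2.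
rewrite exchange_big /dc; apply: eq_bigr => k _ /=; rewrite -scaler_suml; congr (_ *: _).
have D0 := Dim_neq0 (HC := HC).
(* Clearing the two factors [1 / Dim C], one from each [dc], leaves [fusion_Dim]. *)
apply: (mulIf D0); apply: (mulIf D0); rewrite divfK // [RHS]mulrC -fusion_Dim.
rewrite pair_big !mulr_suml; apply: eq_bigr => -[i j] _ /=; set n := _%:R.
rewrite (mulrAC _ n) -(mulrA _ (_ / _)) divfK // (mulrAC _ n) (mulrAC _ (qdim _)).
by rewrite divfK.
Qed.

Lemma ev'_coev u : ev' u ∘ coev u = qdim u *: idm (uob : C).
Proof. by rewrite -[coev u]opp_db' -qdim_dual; exact: (de_db' (opp_pair u)). Qed.

Lemma chk1_hat1 V W u B (G : mor B (V ⊗ W : C)) (F : mor (V ⊗ W) B) (p : mor W u)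
    (q : mor u W) c : G ∘ F = idm _ -> p ∘ q = c *: idm u ->
  chk1 G p ∘ hat1 F q = (c * qdim u) *: idm V.
Proof.
move=> GF pq; rewrite /chk1 /hat1 !compA (compK _ (tmor_invl (dl u) GF)).
rewrite (compK _ (alphaVK _ _ _)) !(compE _ (tmorCrV V _ _)) !compA.
rewrite (compE _ (tmorClV _ _ _)) pq tmorZl tmor1 compZr compm1 compZl ev'_coev.
by rewrite scalerA tmorZr tmor1 compZr compm1 compZl rhoVK.
Qed.

Lemma psiR0_phiR0 : psiR0 C ∘ phiR0 C = Dim C *: idm (uob : C2 C).
Proof.
have S (V : zmodType) (F : unit -> V) : \sum_m F m = F tt.
  by rewrite (bigD1 tt) //= big1 ?addr0 // => -[].
have GF : proj _ tt ∘ phiT0 C ∘ (psiT0 C ∘ incl (@Tsummand _ _ (uob : C2 C)) tt) = idm _.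
  by rewrite -compA (compA _ (psiT0 C)) phiT0_psiT0 comp1m proj_incl.
rewrite /psiR0 /phiR0 chicheckE chihatE [X in _ ∘ X]S.
under [X in X ∘ _]eq_bigr => i _ do rewrite S.
move: (proj _ tt ∘ phiT0 C) (psiT0 C ∘ incl _ tt) GF => G F GF.
rewrite idm_unit_pel -[X in pel _ _ _ X]completeness.
have L := @pel_linr K C (uob : C2 C) (uob : C2 C) tt tt (idm uob).
rewrite (lin_sum L) scaler_sumr comp_suml; apply: eq_bigr => i _.
rewrite (lin_sum L) scaler_sumr comp_suml; apply: eq_bigr => a _.
rewrite comp_sumr (bigD1 i) //= [X in _ + X]big1 => [|j ne]; last first.
  by rewrite comp_sumr big1 // => b _; rewrite compZl pel_comp0 // scaler0.
have x b : chk1 G (sbas uob i a) ∘ hat1 F (sdbas uob i b) =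
    ((a == b)%:R * qdim (simp i)) *: idm uob.
  by apply: chk1_hat1 => //; exact: sbas_sdbas.
rewrite addr0 comp_sumr (bigD1 a) //= [X in _ + X]big1 => [|b ne]; last first.
  by rewrite compZl pel_comp x eq_sym (negPf ne) mul0r scale0r pel0l scaler0.
(* The closed loop gives [dim i], which cancels the denominator in [chicheck] and leaves [Dim C] for
   every label. *)
rewrite addr0 compZl pel_comp x eqxx mul1r pelZl scalerA divfK ?qdim_simp_neq0 //.
Qed.

Lemma Rfrob_mul_comul (A : frobenius C) :
  mul (Rfrob A) ∘ comul (Rfrob A) = Rmor (mul A ∘ comul A).
Proof.
rewrite -[LHS]/(Rmor (mul A) ∘ phiR2 A A ∘ (psiR2 A A ∘ Rmor (comul A))).
by rewrite [LHS]compA (compK _ (phiR2_psiR2 A A)) Rmor_comp.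
Qed.

Lemma Rfrob_counit_unt (A : frobenius C) :
  counit (Rfrob A) ∘ unt (Rfrob A) =
  (scal (counit A ∘ unt A) * Dim C) *: idm (uob : C2 C).
Proof.
rewrite -[LHS]/(psiR0 C ∘ Rmor (counit A) ∘ (Rmor (unt A) ∘ phiR0 C)).
rewrite [LHS]compA (compE _ (esym (Rmor_comp _ _))) [counit A ∘ _]unit_scalar.
rewrite (linZ (@Rmor_lin _ _ _ uob uob)) Rmor_id compZr compm1 compZl psiR0_phiR0 scalerA.
by rewrite -unit_scalar.
Qed.

Lemma idm_unit_neq0 : idm (uob : C2 C) != 0.
Proof.
apply/eqP => e; have := Tmor_id (uob : C2 C); rewrite e (lin0 (@Tmor_lin _ _ _ _ _)).
move=> T0; case: (mod_one HC) => + _; apply.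
have : psiT0 C ∘ phiT0 C = idm (uob : C).
  by rewrite /psiT0 /phiT0 !compA (compK _ (proj_incl _ _)) lamVK.
by move=> <-; rewrite -[phiT0 C]comp1m -T0 comp0l comp0r.
Qed.

Lemma special_Rfrob (A : frobenius C) : special A <-> special (Rfrob A).
Proof.
have D0 := Dim_neq0 (HC := HC).
split=> -[z [x [z0 x0 mc cu]]].
  exists z, (x * Dim C); split=> //; first by rewrite mulf_neq0.
    by rewrite Rfrob_mul_comul mc (linZ (@Rmor_lin _ _ _ _ _)) Rmor_id.
  by rewrite Rfrob_counit_unt cu scal_id.
(* Endomorphisms of the unit are scalars anyway; only the fact that this one is nonzero has to come
   from [R(A)]. *)
exists z, (scal (counit A ∘ unt A)); split=> //; last exact: unit_scalar.
  move: cu; rewrite Rfrob_counit_unt => /eqP.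
  rewrite -subr_eq0 -scalerBl scaler_eq0 (negPf idm_unit_neq0) orbF subr_eq0.
  by apply: contraTneq => ->; rewrite mul0r eq_sym.
apply: Rmor_inj; rewrite (linZ (@Rmor_lin _ _ _ _ _)) Rmor_id.
by rewrite -Rfrob_mul_comul.
Qed.
End Special.

Theorem corollary2p27 (R : realType) (C : modular_category R[i])
    (A : algebra C) (hA : algebra_laws A) :
  (absolutely_simple A <-> absolutely_simple (Ralg A)) /\
  (forall (Delta : mor A (tob A A)) (epsilon : mor A uob),
     let F := Frobenius Delta epsilon in
     frobenius_laws F ->
     (simple_algebra F /\ special F <->
      simple_algebra (Rfrob F) /\ special (Rfrob F))).
Proof.
have HC := mdataP C; split=> [|Delta epsilon F _].
  exact: absolutely_simple_Ralg.
have HF : algebra_laws F by [].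
have spF := @special_Rfrob _ _ HC F.
split=> -[sF /spF ?]; split=> //.
  exact: (simple_Ralg_of_simple (A := F)).
exact: (simple_of_simple_Ralg (A := F)).
Qed.
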